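(* Let $(\mathfrak G_n)_n$, $\mathfrak G_n=(N_n,V_n)$, be uniformly doubling graphs with polynomial growth of dimension $d$. Then, for any $n\in\mathbb N$, any $a,b\ge1$, any $p\in[1,\infty]$, any $d\ge1$ and any $q_n\in[n]=\{1,\dots,n\}$, there exists a partition $\mathcal P_{M_n}=\{B_1,\dots,B_{M_n}\}$ of $N_n$ satisfying $\max_{m\in[M_n]}|B_m|\lesssim q_n$ such that $$\Big\|\sup_{f\in\mathcal F}\mathbb G_n(f)\Big\|_{L^1(\mathbb P)}\lesssim\Lambda_{p,d}(q_n)\,\gamma_{2,a}\Big(\mathcal F,\max_{i\in N_n}\|\cdot\|_{L^{2p}(P_{Z_i})}\Big)+\Big(\frac{q_n}{\sqrt n}+\sqrt n\,\bar\tau_{\operatorname{cone}\mathcal F}\big(\mathcal P_{M_n},\mathcal C_{q_n^{1/d}}[\mathcal P_{M_n}]\big)\Big)\gamma_{1,b}(\mathcal F,\|\cdot\|_\infty),$$ where, for $p=1$, $\Lambda_{1,d}(q_n):=\sqrt{q_n}$ and, for $p\in(1,\infty]$, $$\Lambda_{p,d}(q_n):=\max_{m\in[M_n]}\;q_n^{\frac{1-1/d}2}\sqrt{\min\big\{\Lambda^{\sharp}_{p,d}(q_n;m),\Lambda^{\mathrm{sum}}_{p,d}(q_n;m)\big\}},$$ $$\Lambda^\sharp_{p,d}(q_n;m):=q_n^{\frac{1+p}p}\Big(\int_0^1\Big[\sum_{\rho=0}^{\lfloor2q_n^{1/d}\rfloor+1}1\{\alpha_{\mathcal F,B_m}(\rho)\ge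 u\}\Big]^{\frac p{p-1}}du\Big)^{1-\frac1p},\qquad\Lambda^{\mathrm{sum}}_{p,d}(q_n;m):=\sum_{\rho=0}^{\lfloor2q_n^{1/d}\rfloor+1}\big(\alpha_{\mathcal F,B_m}(\rho)\big)^{1-\frac1p}$$ (with $\frac{1+p}p=\frac p{p-1}=1$ and $\frac1p=0$ if $p=\infty$). Here $\lesssim$ hides constants depending only on the doubling and polynomial-growth constants.
   Context: Setup. For each $n$, $\mathfrak G_n=(N_n,V_n)$ is a finite graph with $|N_n|=n$; $d_n(i,j)$ is the shortest-path distance ($+\infty$ if no path exists, $d_n(i,i)=0$), $d_n(A,B)=\inf_{i\in A,j\in B}d_n(i,j)$. $(Z_i)_{i\in N_n}$ are random elements with values in a Polish space $(\mathsf Z,\mathcal Z)$ (probability $\mathbb P$, expectation $\mathbb E$; $P_{Z_i}$ is the law of $Z_i$). For disjoint $A,B\subseteq N_n$ with $d_n(A,B)=+\infty$, $\sigma(Z_i:i\in A)$ and $\sigma(Z_j:j\in B)$ are independent. $\mathcal F\ni0$ is a class of real-valued measurable functions on $\mathsf Z$, and $\mathbb G_n(f)=n^{-1/2}\sum_{i\in N_n}\{f(Z_i)-\mathbb E[f(Z_i)]\}$. $[M]=\{1,\dots,M\}$; $Z_B=(Z_i)_{i\in B}$; $\mathcal F-\mathcal F=\{f-g:f,g\in\mathcal F\}$; $\operatorname{cone}\mathcal F=\{\lambda f:f\in\mathcal F,\lambda>0,\|\lambda f\|_\infty\le1\}$. Geometry. Let $B(x,R)=\{y\in N_n:d_n(x,y)\le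 R\}$ and $\partial B(x,s)=\{y\in N_n:d_n(x,y)=s\}$. The sequence $(\mathfrak G_n)$ is uniformly doubling with polynomial growth of dimension $d$ if (i) there is $C_{\mathrm{dbl}}<\infty$ independent of $n$ such that for every $x\in N_n$ and $R>0$ there are points $x_1,\dots,x_{C_{\mathrm{dbl}}}\in N_n$ with $B(x,R)\subseteq\bigcup_{k=1}^{C_{\mathrm{dbl}}}B(x_k,R/2)$, and $d=\log_2C_{\mathrm{dbl}}$; (ii) there is $C<\infty$ independent of $n$ such that $\max_{x\in N_n}|\partial B(x,s)|\le Cs^{d-1}$ for all $s\ge1$. Colorings. For a partition $\mathcal P_M=\{B_1,\dots,B_M\}$ of $N_n$ and $r>0$, a proper $r$-coloring is a map $c:[M]\to\mathbb N$ such that $c(m)=c(m')$, $m\ne m'$ imply $d_n(B_m,B_{m'})>r$. $K_r=K_r(\mathcal P_M)$ is the smallest possible number of distinct colors over all proper $r$-colorings; $\mathcal C_r[\mathcal P_M]$ denotes the collection of color classes $C_k=c^{-1}(k)$, $k\in[K_r]$, of an (arbitrary, fixed) proper $r$-coloring with colors $[K_r]$. $\tau$-coefficient. For a Polish space $\mathsf X$ with pseudometric $d_{\mathsf X}$, an $\mathsf X$-valued $X$ with $\mathbb E[d_{\mathsf X}(X,x_0)]<\infty$ for some $x_0$, and a sub-$\sigma$-field $\mathcal M$, $\tau_{d_{\mathsf X}}(\mathcal M,X):=\big\|\sup_g|\mathbb E[g(X)\mid\mathcal M]-\mathbb E[g(X)]|\big\|_{L^1(\mathbb P)}$, supremum over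 measurable $g:\mathsf X\to\mathbb R$ that are $1$-Lipschitz for $d_{\mathsf X}$. For $\mathcal B\subseteq\operatorname{span}\mathcal F$ and $z,z'\in\mathsf Z^m$ let $d_{\mathcal B,m}(z,z')=\sum_{s=1}^m\sup_{f\in\mathcal B}|f(z_s)-f(z_s')|$, and $$\bar\tau_{\mathcal B}(\mathcal P_M,\mathcal C_r[\mathcal P_M]):=\frac1n\sum_{k=1}^{K_r}\sum_{m\in C_k}\tau_{d_{\mathcal B,|B_m|}}\Big(\sigma\big(Z_j:j\in\textstyle\bigcup_{m'\in C_k,m'<m}B_{m'}\big),Z_{B_m}\Big),$$ with the trivial $\sigma$-field when the union is empty. Mixing. For real random variables, $\alpha(X,Y)=2\sup_{s,t\in\mathbb R}|\mathbb P(X\ge t,Y\ge s)-\mathbb P(X\ge t)\mathbb P(Y\ge s)|$; $\alpha_{\mathcal F,B}(\rho)=\sup_{f\in\mathcal F-\mathcal F}\ \sup_{i,j\in B:\,d_n(i,j)\ge\rho}\alpha(f(Z_i),f(Z_j))$, with $\alpha_{\mathcal F,B}(0):=1$, $\alpha_{\mathcal F,B}(\infty):=0$. Talagrand complexity. For $s>0$, an admissible partition sequence of order $s$ for $\mathcal F$ is a sequence $T^\infty=(T_l)_{l\ge0}$ of partitions of $\mathcal F$ that is increasing (each $T_{l+1}$ refines $T_l$) with $\operatorname{card}(T_0)=1$ and $\operatorname{card}(T_l)\le2^{2^{l/s}}$ for $l\ge1$. $T(f,T_l)$ is the element of $T_l$ containing $f$ and $D(f,T_l)(z)=\sup_{f_1,f_2\in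 T(f,T_l)}|f_1(z)-f_2(z)|$. For a seminorm-type functional $\mathbf d$, $\gamma_{q,s}(\mathcal F,\mathbf d)=\inf_{T^\infty}\sup_{f\in\mathcal F}\sum_{l=0}^\infty2^{l/q}\mathbf d(D(f,T_l))$, the infimum being over admissible partition sequences of order $s$. *)

(* Defs.v *)
From HB Require Import structures.
From mathcomp Require Import all_boot all_order all_algebra.
From mathcomp Require Import all_classical all_reals all_analysis.
From mathcomp Require Import measurable_realfun.
Import Order.TTheory GRing.Theory Num.Theory.
Import numFieldNormedType.Exports.

Set Implicit Arguments.
Unset Strict Implicit.
Unset Printing Implicit Defensive.

Local Open Scope classical_set_scope.
Local Open Scope ring_scope.
Local Open Scope card_scope.

(* Graphs are symmetric relations [e] on a finite type; loops are not excluded,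
   as they change neither distances nor balls. *)

(* The infimum is over walks from [i] to [j], recorded without their starting
   point, so that [size s] is the number of edges; the empty walk gives
   [gdist i i = 0], and [ereal_inf set0 = +oo] covers unreachable vertices. *)
Definition gdist (R : realType) (N : finType) (e : rel N) (i j : N) : \bar R :=
  ereal_inf [set (size s)%:R%:E | s in [set s | path e i s /\ last i s = j]].

Definition gdist_set (R : realType) (N : finType) (e : rel N)
    (A B : {set N}) : \bar R :=
  ereal_inf [set gdist R e i j | i in [set` A] & j in [set` B]].

Definition gball (R : realType) (N : finType) (e : rel N) (x : N) (r : R) :
    {set N} :=
  [set y | (gdist R e x y <= r%:E)%E]%SET.

Definition gsphere (R : realType) (N : finType) (e : rel N) (x : N) (s : R) :
    {set N} :=
  [set y | gdist R e x y == s%:E]%SET.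

Definition uniformly_doubling (R : realType) (N : nat -> finType)
    (V : forall n, rel (N n)) (Cdbl : nat) (Cgr d : R) : Prop :=
  [/\ d = ln Cdbl%:R / ln 2,
      forall (n : nat) (x : N n) (r : R), 0 < r ->
        exists c : 'I_Cdbl -> N n,
          gball (V n) x r
            \subset (\bigcup_(k < Cdbl) gball (V n) (c k) (r / 2))%SET
    & forall (n : nat) (x : N n) (s : R), 1 <= s ->
        #|gsphere (V n) x s|%:R <= Cgr * s `^ (d - 1)].

Definition is_partition (N : finType) (M : nat) (B : 'I_M -> {set N}) : Prop :=
  injective B /\ finset.partition [set B m | m : 'I_M]%SET [set: N]%SET.

Definition proper_coloring (R : realType) (N : finType) (e : rel N) (M : nat)
    (B : 'I_M -> {set N}) (r : R) (C : eqType) (c : 'I_M -> C) : Prop :=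
  forall m m', c m = c m' -> m != m' ->
    (r%:E < gdist_set R e (B m) (B m'))%E.

Definition colorable (R : realType) (N : finType) (e : rel N) (M : nat)
    (B : 'I_M -> {set N}) (r : R) : pred nat :=
  fun K => `[< exists c : 'I_M -> nat,
                 proper_coloring e B r c /\ size (undup (codom c)) = K >].

Lemma colorable_exists (R : realType) (N : finType) (e : rel N) (M : nat)
    (B : 'I_M -> {set N}) (r : R) : exists K, colorable e B r K.
Proof.
exists (size (undup (codom (@nat_of_ord M)))); apply/asboolP.
by exists (@nat_of_ord M); split=> // m m' /val_inj ->; rewrite eqxx.
Qed.

Definition coloring_number (R : realType) (N : finType) (e : rel N) (M : nat)
    (B : 'I_M -> {set N}) (r : R) : nat :=
  ex_minn (colorable_exists e B r).

Definition polish (R : realType) (T : topologicalType) : Prop :=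
  (exists2 D : set T, countable D & dense D) /\
  exists dist : T -> T -> R,
    [/\ forall x y, dist x y = 0 <-> x = y,
        forall x y, dist x y = dist y x,
        forall x y z, dist x z <= dist x y + dist y z,
        forall x (U : set T), nbhs x U <->
          exists2 r : R, 0 < r & [set y | dist x y < r] `<=` U
      & forall u : nat -> T,
          (forall r : R, 0 < r -> exists k, forall i j,
             (k <= i)%N -> (k <= j)%N -> dist (u i) (u j) < r) ->
          exists l : T, u @ \oo --> l].

Definition supnorm (R : realType) (T : Type) (h : T -> \bar R) : \bar R :=
  ereal_sup [set `|h z|%E | z in setT].

Definition cone (R : realType) (T : Type) (F : set (T -> R)) : set (T -> R) :=
  [set g | exists f lam, [/\ F f, 0 < lam, g = (fun z => lam * f z)
                           & (supnorm (fun z => (g z)%:E) <= 1)%E]].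

Definition diff_class (R : realType) (T : Type) (F : set (T -> R)) :
    set (T -> R) :=
  [set (fun z => f z - g z) | f in F & g in F].

Definition empirical_process (R : realType) (dO dZ : measure_display)
    (Om : measurableType dO) (P : probability Om R) (Zs : measurableType dZ)
    (N : finType) (Z : N -> {RV P >-> Zs}) (f : Zs -> R) (w : Om) : R :=
  (Num.sqrt #|N|%:R)^-1 *
    \sum_(i : N) (f (Z i w) - fine ('E_P[fun w' => f (Z i w')])%E).

Definition sigma_gen (R : realType) (dO dZ : measure_display)
    (Om : measurableType dO) (P : probability Om R) (Zs : measurableType dZ)
    (N : finType) (Z : N -> {RV P >-> Zs}) (A : {set N}) : set (set Om) :=
  <<s \bigcup_(i in [set` A]) preimage_set_system setT (Z i) measurable >>.

Definition independent (R : realType) (dO : measure_display)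
    (Om : measurableType dO) (P : probability Om R) (G H : set (set Om)) :
    Prop :=
  forall E D, G E -> H D -> (P (E `&` D) = P E * P D)%E.

(* [h] is one of the a.s. equal versions of E[Y | M]. *)
Definition is_cond_exp (R : realType) (dO : measure_display)
    (Om : measurableType dO) (P : probability Om R) (M : set (set Om))
    (Y h : Om -> R) : Prop :=
  [/\ P.-integrable setT (EFin \o Y), P.-integrable setT (EFin \o h),
      forall S : set R, measurable S -> M (h @^-1` S)
    & forall E, M E -> (\int[P]_(w in E) (h w)%:E = \int[P]_(w in E) (Y w)%:E)%E].

(* The supremum of a (possibly uncountable) family of random variables that are
   only defined almost surely: their least upper bound for the a.s. order. *)
Definition is_as_sup (R : realType) (dO : measure_display)
    (Om : measurableType dO) (P : probability Om R) (H : set (Om -> \bar R))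
    (U : Om -> \bar R) : Prop :=
  [/\ measurable_fun setT U,
      forall h, H h -> {ae P, forall w, (h w <= U w)%E}
    & forall V : Om -> \bar R, measurable_fun setT V ->
        (forall h, H h -> {ae P, forall w, (h w <= V w)%E}) ->
        {ae P, forall w, (U w <= V w)%E}].

Definition as_sup (R : realType) (dO : measure_display)
    (Om : measurableType dO) (P : probability Om R) (H : set (Om -> \bar R)) :
    Om -> \bar R :=
  xget (cst 0%E) [set U | is_as_sup P H U].

Definition lipschitz1 (R : realType) (T : Type) (dist : T -> T -> \bar R)
    (g : T -> R) : Prop :=
  forall x y, (`|g x - g y|%:E <= dist x y)%E.

(* All versions [h] of E[g(xi) | M] are included; this does not change the
   almost sure supremum. *)
Definition tau (R : realType) (dO dX : measure_display)
    (Om : measurableType dO) (P : probability Om R) (X : measurableType dX)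
    (dist : X -> X -> \bar R) (M : set (set Om)) (xi : Om -> X) : \bar R :=
  'N[P]_1[as_sup P
    [set u | exists g h, [/\ measurable_fun setT g, lipschitz1 dist g,
                             is_cond_exp P M (fun w => g (xi w)) h
      & u = (fun w => `|(h w)%:E - 'E_P[fun w' => g (xi w')]|%E)]]]%E.

Definition dist_class (R : realType) (T : Type) (C : set (T -> R)) (m : nat)
    (z z' : m.-tuple T) : \bar R :=
  (\sum_(s < m) ereal_sup [set `|f (tnth z s) - f (tnth z' s)|%:E | f in C])%E.

Definition subvec (R : realType) (dO dZ : measure_display)
    (Om : measurableType dO) (P : probability Om R) (Zs : measurableType dZ)
    (N : finType) (Z : N -> {RV P >-> Zs}) (A : {set N}) (w : Om) :
    #|A|.-tuple Zs :=
  [tuple Z (enum_val s) w | s < #|A|].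

Definition tau_bar (R : realType) (dO dZ : measure_display)
    (Om : measurableType dO) (P : probability Om R) (Zs : measurableType dZ)
    (N : finType) (Z : N -> {RV P >-> Zs}) (C : set (Zs -> R)) (M : nat)
    (B : 'I_M -> {set N}) (K : nat) (c : 'I_M -> 'I_K) : \bar R :=
  ((#|N|%:R^-1)%:E * \sum_(k < K) \sum_(m < M | c m == k)
     tau P (@dist_class R Zs C #|B m|)
         (sigma_gen Z (\bigcup_(m' < M | (c m' == k) && (m' < m)%N) B m')%SET)
         (subvec Z (B m)))%E.

Definition alpha_mix (R : realType) (dO : measure_display)
    (Om : measurableType dO) (P : probability Om R) (X Y : Om -> R) : R :=
  2 * sup [set `| fine (P [set w | t <= X w /\ s <= Y w])
                  - fine (P [set w | t <= X w]) * fine (P [set w | s <= Y w]) |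
          | s in [set: R] & t in [set: R]].

(* All values of [alpha_mix] are nonnegative, so [sup set0 = 0] is the right
   convention when no pair of vertices of [B] is at distance at least [rho]. *)
Definition alpha_class (R : realType) (dO dZ : measure_display)
    (Om : measurableType dO) (P : probability Om R) (Zs : measurableType dZ)
    (N : finType) (e : rel N) (Z : N -> {RV P >-> Zs}) (F : set (Zs -> R))
    (B : {set N}) (rho : \bar R) : R :=
  if rho == 0%E then 1 else if rho == +oo%E then 0 else
  sup [set x | exists f i j, [/\ diff_class F f, i \in B, j \in B,
                                 (rho <= gdist R e i j)%E
         & x = alpha_mix P (fun w => f (Z i w)) (fun w => f (Z j w))]].

(* [al] stands for the mixing profile [alpha_class e Z F B] of a block [B]; the
   wildcard branches are the conventions on the exponents for [p = +oo]. *)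
Definition Lambda_sharp (R : realType) (p : \bar R) (d : R) (q : nat)
    (al : \bar R -> R) : R :=
  let L := (Num.truncn (2 * q%:R `^ d^-1)).+1 in
  let e1 := if p is r%:E then (1 + r) / r else 1 in
  let e2 := if p is r%:E then r / (r - 1) else 1 in
  let e3 := if p is r%:E then 1 - r^-1 else 1 in
  q%:R `^ e1 *
  (Rintegral lebesgue_measure `[0, 1]%classic (fun u : R =>
     (\sum_(0 <= rho < L.+1) (u <= al rho%:R%:E)%R%:R) `^ e2)) `^ e3.

Definition Lambda_sum (R : realType) (p : \bar R) (d : R) (q : nat)
    (al : \bar R -> R) : R :=
  let L := (Num.truncn (2 * q%:R `^ d^-1)).+1 in
  let e3 := if p is r%:E then 1 - r^-1 else 1 in
  \sum_(0 <= rho < L.+1) al rho%:R%:E `^ e3.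

Definition Lambda (R : realType) (p : \bar R) (d : R) (q M : nat)
    (al : 'I_M -> \bar R -> R) : R :=
  if p == 1%E then Num.sqrt q%:R else
  \big[Num.max/0]_(m < M)
    (q%:R `^ ((1 - d^-1) / 2) *
     Num.sqrt (Num.min (Lambda_sharp p d q (al m)) (Lambda_sum p d q (al m)))).

Definition admissible (R : realType) (T : Type) (s : R) (F : set (T -> R))
    (Tl : nat -> set (set (T -> R))) : Prop :=
  [/\ forall l, classical_sets.partition (Tl l) id F,
      forall l A, Tl l.+1 A -> exists2 A', Tl l A' & A `<=` A',
      Tl 0%N #= `I_1
    & forall l, (0 < l)%N ->
        exists2 k, Tl l #= `I_k & k%:R <= 2 `^ (2 `^ (l%:R / s)) :> R].

Definition diam_fun (R : realType) (T : Type) (f : T -> R)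
    (Q : set (set (T -> R))) (z : T) : \bar R :=
  ereal_sup [set `|f1 z - f2 z|%:E | f1 in pblock Q id f & f2 in pblock Q id f].

Definition talagrand_gamma (R : realType) (T : Type) (q s : R)
    (F : set (T -> R)) (dd : (T -> \bar R) -> \bar R) : \bar R :=
  ereal_inf
    [set ereal_sup
      [set (\sum_(0 <= l <oo) (2 `^ (l%:R / q))%:E * dd (diam_fun f (Tl l)))%E
      | f in F]
    | Tl in [set Tl | admissible s F Tl]].

Definition max_Lnorm (R : realType) (dO dZ : measure_display)
    (Om : measurableType dO) (P : probability Om R) (Zs : measurableType dZ)
    (N : finType) (Z : N -> {RV P >-> Zs}) (p : \bar R) (h : Zs -> \bar R) :
    \bar R :=
  \big[maxe/0%E]_(i : N) 'N[distribution P (Z i)]_p[h]%E.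

(* Main.v *)
(* The Voronoi cells of a maximal q^(1/d)-separated set are blocks of size O(q)
   and diameter at most 2 q^(1/d), and the doubling property bounds the number of
   colors independently of n. Within a color class the blocks are decoupled one
   at a time. The maximum of the process over the chains is dominated by a
   constant plus a sum of exponentials of linear forms; integrating one block out
   of such a bound only multiplies each exponential by a moment generating
   function, and the error is a difference of conditional and plain expectations
   of a Lipschitz function of the block, which tau controls. The moment
   generating functions obey Bernstein's inequality, so chaining along the common
   refinement of the partition sequences for gamma_2 and gamma_1 gives the two Talagrand terms.

   The variance of a block sum is bounded by truncating both factors of each
   covariance at a level chosen from alpha and the L^(2p) norm; counting vertices
   on spheres then yields q^(1-1/d) Lambda^sum per vertex. The minimum with
   Lambda^sharp costs only a constant, since Lambda^sum <= 8 Lambda^sharp always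
   holds. *)
Require Import Defs.
From HB Require Import structures.
From mathcomp Require Import all_boot all_order all_algebra.
From mathcomp Require Import all_classical all_reals all_analysis.
From mathcomp Require Import measurable_realfun ess_sup_inf.
From mathcomp Require Import ring lra.
Import Order.TTheory GRing.Theory Num.Theory.
Import numFieldNormedType.Exports.
Set Implicit Arguments.
Unset Strict Implicit.
Unset Printing Implicit Defensive.
Local Open Scope classical_set_scope.
Local Open Scope ring_scope.

(** * Bounded random variables and covariances *)

Section bounded_measurable.
Context (R : realType) (dO : measure_display) (Om : measurableType dO)
  (P : probability Om R).

(** A finite gamma_1 makes [F] uniformly bounded: the only cell at level 0 contains [0], so the
    first term of the series already dominates every sup norm. The argument therefore runs on
    bounded variables. Infinite functionals have positive coefficients and make the bound trivial;
    if gamma_1 vanishes, [F] is reduced to [0]. The same sup bound [A0] puts [f / A0] in [cone F],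
    which is why tau comes multiplied by gamma_1.

    Two obstacles shape the decoupling. The cost in tau must not grow with the number of levels or
    chains: [chain_max] therefore looks only at the endpoints of a chain, which keeps its Lipschitz
    constant fixed, and telescoping is confined to its exponential majorant. Moreover, the function
    to be tested depends on the past, whereas tau compares expectations of fixed functions; rounding
    the past to finitely many values turns this into a finite choice, which the almost sure supremum
    inside the L1 norm absorbs.

    The supremum over [F] need not be measurable: only a majorant built from finitely many chains is
    ever integrated as a random variable. *)

Definition bmeas (X : Om -> R) : Prop :=
  measurable_fun setT X /\ exists C : R, forall w, `|X w| <= C.

Definition Ex (X : Om -> R) : R := fine ('E_P[X])%E.

Lemma bmeas_integrable X : bmeas X -> P.-integrable setT (EFin \o X).
Proof.
move=> [mX [C hC]].
apply: measurable_bounded_integrable => //.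
  by rewrite -ge0_fin_numE// fin_num_measure.
exists C; split; first exact: num_real.
by move=> x Cx w _ /=; apply: le_trans (hC w) (ltW Cx).
Qed.

Lemma ExE X : Ex X = \int[P]_w X w.
Proof. by rewrite /Ex unlock. Qed.

Lemma bmeas_ExE X : bmeas X -> ('E_P[X] = (Ex X)%:E)%E.
Proof.
move=> bX; rewrite /Ex fineK// unlock; apply: integrable_fin_num => //.
exact: bmeas_integrable.
Qed.

Lemma bmeas_cst c : bmeas (fun=> c).
Proof. by split; [exact: measurable_cst|exists `|c|]. Qed.

Lemma bmeasD X Y : bmeas X -> bmeas Y -> bmeas (fun w => X w + Y w).
Proof.
move=> [mX [C hC]] [mY [D hD]]; split; first exact: measurable_funD.
by exists (C + D) => w; rewrite (le_trans (ler_normD _ _))// lerD.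
Qed.

Lemma bmeasM X Y : bmeas X -> bmeas Y -> bmeas (fun w => X w * Y w).
Proof.
move=> [mX [C hC]] [mY [D hD]]; split; first exact: measurable_funM.
by exists (C * D) => w; rewrite normrM ler_pM.
Qed.

Lemma bmeasZ c X : bmeas X -> bmeas (fun w => c * X w).
Proof. by move=> bX; exact: bmeasM (bmeas_cst c) bX. Qed.

Lemma bmeasN X : bmeas X -> bmeas (fun w => - X w).
Proof.
move=> /(bmeasZ (-1)); congr bmeas; apply/funext => w; exact: mulN1r.
Qed.

Lemma bmeasB X Y : bmeas X -> bmeas Y -> bmeas (fun w => X w - Y w).
Proof. by move=> bX /bmeasN; exact: bmeasD. Qed.

Lemma bmeas_sum (I : Type) (s : seq I) (A : pred I) (X : I -> Om -> R) :
  (forall i, A i -> bmeas (X i)) -> bmeas (fun w => \sum_(i <- s | A i) X i w).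
Proof.
move=> bX; elim: s => [|i s IHs].
  by under eq_fun do rewrite big_nil; exact: bmeas_cst.
case: (boolP (A i)) => Ai.
  by under eq_fun do rewrite big_cons Ai; apply: bmeasD => //; exact: bX.
by under eq_fun do rewrite big_cons (negbTE Ai).
Qed.

Lemma bmeas_comp (f : R -> R) X : continuous f -> bmeas X ->
  bmeas (fun w => f (X w)).
Proof.
move=> cf [mX [C hC]]; split.
  apply: measurableT_comp => //; exact: continuous_measurable_fun.
have C0 : 0 <= C by apply: le_trans (hC point).
have CC : - C <= C by rewrite ge0_cp.
have cfw : {within `[- C, C], continuous f}.
  by apply: continuous_subspaceT => x; exact: cf.
have [c1 _ h1] := EVT_max CC cfw; have [c2 _ h2] := EVT_min CC cfw.
exists (Num.max `|f c1| `|f c2|) => w.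
have wC : X w \in `[- C, C] by rewrite in_itv /= -ler_norml.
have := h1 _ wC; have := h2 _ wC => l2 l1.
have := ler_norm (f c1); have := ler_norm (- f c2); rewrite normrN => m1 m2.
rewrite le_max; case: (lerP 0 (f (X w))) => h.
  by rewrite ger0_norm// (le_trans l1 m2).
by apply/orP; right; rewrite ltr0_norm// (le_trans _ m1)// lerN2.
Qed.

Lemma bmeas_norm X : bmeas X -> bmeas (fun w => `|X w|).
Proof. by apply: bmeas_comp; exact: norm_continuous. Qed.

Lemma bmeas_expR X : bmeas X -> bmeas (fun w => expR (X w)).
Proof. by apply: bmeas_comp; exact: continuous_expR. Qed.

Lemma bmeas_max X Y : bmeas X -> bmeas Y ->
  bmeas (fun w => Num.max (X w) (Y w)).
Proof.
move=> [mX [C hC]] [mY [D hD]]; split; first exact: measurable_maxr.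
exists (Num.max C D) => w; case: (leP (X w) (Y w)) => _.
  by rewrite le_max hD orbT.
by rewrite le_max hC.
Qed.

Lemma bmeas_indic (A : set Om) : measurable A -> bmeas (\1_A).
Proof.
move=> mA; split; first exact: measurable_indic.
by exists 1 => w; rewrite indicE; case: (_ \in _); rewrite ?normr0 ?normr1.
Qed.

Lemma Ex_cst c : Ex (fun=> c) = c.
Proof. by rewrite /Ex expectation_cst. Qed.

Lemma ExD X Y : bmeas X -> bmeas Y -> Ex (fun w => X w + Y w) = Ex X + Ex Y.
Proof.
by move=> bX bY; rewrite !ExE RintegralD//; exact: bmeas_integrable.
Qed.

Lemma ExZ c X : bmeas X -> Ex (fun w => c * X w) = c * Ex X.
Proof.
by move=> bX; rewrite !ExE RintegralZl//; exact: bmeas_integrable.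
Qed.

Lemma ExN X : bmeas X -> Ex (fun w => - X w) = - Ex X.
Proof.
by move=> bX; rewrite -mulN1r -ExZ//; congr Ex; apply/funext => w; rewrite mulN1r.
Qed.

Lemma ExB X Y : bmeas X -> bmeas Y -> Ex (fun w => X w - Y w) = Ex X - Ex Y.
Proof. by move=> bX bY; rewrite ExD ?ExN//; exact: bmeasN. Qed.

Lemma Ex_sum (I : Type) (s : seq I) (A : pred I) (X : I -> Om -> R) :
  (forall i, A i -> bmeas (X i)) ->
  Ex (fun w => \sum_(i <- s | A i) X i w) = \sum_(i <- s | A i) Ex (X i).
Proof.
move=> bX; elim: s => [|i s IHs].
  by rewrite big_nil -[RHS]Ex_cst; congr Ex; apply/funext => w; rewrite big_nil.
rewrite big_cons; case: (boolP (A i)) => Ai.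
  rewrite -IHs -ExD//; [|exact: bX|exact: bmeas_sum].
  by congr Ex; apply/funext => w; rewrite big_cons Ai.
by rewrite -IHs; congr Ex; apply/funext => w; rewrite big_cons (negbTE Ai).
Qed.

Lemma le_Ex X Y : bmeas X -> bmeas Y -> (forall w, X w <= Y w) -> Ex X <= Ex Y.
Proof.
by move=> bX bY XY; rewrite !ExE le_Rintegral//; exact: bmeas_integrable.
Qed.

Lemma Ex_ge0 X : (forall w, 0 <= X w) -> 0 <= Ex X.
Proof. by move=> X0; rewrite ExE; apply: Rintegral_ge0. Qed.

Lemma Ex_le X c : bmeas X -> (forall w, X w <= c) -> Ex X <= c.
Proof. by move=> bX Xc; rewrite -[leRHS]Ex_cst; apply: le_Ex => //; exact: bmeas_cst. Qed.

Lemma Ex_norm X : bmeas X -> `|Ex X| <= Ex (fun w => `|X w|).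
Proof.
move=> bX; rewrite ler_norml -ExN; last exact: bmeas_norm.
apply/andP; split; apply: le_Ex => //; do ?exact/bmeasN/bmeas_norm; do ?exact: bmeas_norm.
- by move=> w; rewrite lerNl -normrN ler_norm.
- by move=> w; exact: ler_norm.
Qed.

Lemma Ex_indic A : measurable A -> Ex (\1_A) = fine (P A).
Proof. by move=> mA; rewrite /Ex expectation_indic. Qed.

Lemma ae_eq_Ex X Y : bmeas X -> bmeas Y -> {ae P, forall w, X w = Y w} ->
  Ex X = Ex Y.
Proof.
move=> [mX _] [mY _] XY; rewrite !ExE; congr fine; apply: ae_eq_integral => //; do ?exact/measurable_EFinP.
by apply: filterS XY => w /= -> _.
Qed.

Lemma measurable_superlevel (X : Om -> R) t : measurable_fun setT X ->
  measurable [set w | t <= X w].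
Proof.
move=> mX; rewrite -[Y in measurable Y]setTI.
have := mX measurableT _ (measurable_itv `[t, +oo[).
by congr (measurable (_ `&` _)); apply/seteqP; split=> w /=; rewrite in_itv /= andbT.
Qed.

Lemma bmeas_tail (Y : Om -> R) (c : R) : bmeas Y ->
  bmeas (fun w => (c < `|Y w|)%R%:R * (Y w * Y w)).
Proof.
move=> bY; apply: bmeasM; last exact: bmeasM.
have -> : (fun w => (c < `|Y w|)%R%:R) = \1_[set w | c < `|Y w|] :> (Om -> R).
  by apply/funext => w; rewrite indicE; congr _%:R; congr nat_of_bool; apply/idP/idP; rewrite inE.
apply: bmeas_indic; have [mY _] := bmeas_norm bY.
rewrite -[X in measurable X]setTI.
have := mY measurableT _ (measurable_itv `]c, +oo[).
by congr (measurable (_ `&` _)); apply/seteqP; split=> w /=; rewrite in_itv /= andbT.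
Qed.

End bounded_measurable.

Ltac bm := repeat first [assumption | match goal with
  | |- bmeas (fun=> _) => exact: bmeas_cst
  | |- bmeas (fun w => - _) => apply: bmeasN
  | |- bmeas (fun w => _ + _) => apply: bmeasD
  | |- bmeas (fun w => _ * _) => apply: bmeasM
  | |- bmeas (fun w => `|_|) => apply: bmeas_norm
  | |- bmeas (fun w => expR _) => apply: bmeas_expR
  | |- bmeas (fun w => Num.max _ _) => apply: bmeas_max
  | |- bmeas (fun w => \sum_(_ <- _ | _) _) => apply: bmeas_sum => ? ?
  end].

(** * Covariance bounds by truncation *)

Section covariance_bounds.
Context (R : realType) (dO : measure_display) (Om : measurableType dO)
  (P : probability Om R).
Implicit Types (X Y Z U V : Om -> R) (c al T x y s t : R).

Local Notation Ex := (Ex P).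

Definition cov X Y : R := Ex (fun w => X w * Y w) - Ex X * Ex Y.

Lemma covC X Y : cov X Y = cov Y X.
Proof.
rewrite /cov mulrC; congr (Ex _ - _).
by apply/funext => w; rewrite mulrC.
Qed.

Lemma covDl X U Y : bmeas X -> bmeas U -> bmeas Y ->
  cov (fun w => X w + U w) Y = cov X Y + cov U Y.
Proof.
move=> bX bU bY; rewrite /cov ExD//.
under [in LHS]eq_fun do rewrite mulrDl.
by rewrite ExD; [ring|exact: bmeasM..].
Qed.

Lemma covZl c X Y : bmeas X -> bmeas Y -> cov (fun w => c * X w) Y = c * cov X Y.
Proof.
move=> bX bY; rewrite /cov ExZ//.
under [in LHS]eq_fun do rewrite -mulrA.
by rewrite ExZ; [ring|exact: bmeasM].
Qed.

Lemma cov_cstl c Y : bmeas Y -> cov (fun=> c) Y = 0.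
Proof. by move=> bY; rewrite /cov ExZ// Ex_cst subrr. Qed.

Lemma cov_suml (I : Type) (s : seq I) (A : pred I) (X : I -> Om -> R) Y :
  (forall i, A i -> bmeas (X i)) -> bmeas Y ->
  cov (fun w => \sum_(i <- s | A i) X i w) Y = \sum_(i <- s | A i) cov (X i) Y.
Proof.
move=> bX bY; rewrite /cov Ex_sum// sumrB mulr_suml -Ex_sum.
  by congr (Ex _ - _); apply/funext => w; rewrite mulr_suml.
by move=> i Ai; apply: bmeasM => //; exact: bX.
Qed.

Lemma cov_center X Y : bmeas X -> bmeas Y ->
  Ex (fun w => (X w - Ex X) * (Y w - Ex Y)) = cov X Y.
Proof.
move=> bX bY.
have -> : (fun w => (X w - Ex X) * (Y w - Ex Y)) =
  (fun w => X w * Y w + (- Ex Y) * X w + ((- Ex X) * Y w + Ex X * Ex Y)).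
  by apply/funext => w; ring.
rewrite !ExD ?ExZ ?Ex_cst; try by bm.
by rewrite /cov; ring.
Qed.

(** Expanding the squares of [(X - Ex X) - e * (Y - Ex Y)] for [e = 1] and [e = -1] bounds twice the
    covariance by the sum of the variances, hence of the second moments. *)
Lemma cov_le_sqr X Y : bmeas X -> bmeas Y ->
  `|cov X Y| <= (Ex (fun w => X w * X w) + Ex (fun w => Y w * Y w)) / 2.
Proof.
move=> bX bY.
have bcen Z : bmeas Z -> bmeas (fun w => Z w - Ex Z).
  by move=> bZ; apply: bmeasB => //; exact: bmeas_cst.
have var_le Z : bmeas Z ->
    Ex (fun w => (Z w - Ex Z) * (Z w - Ex Z)) <= Ex (fun w => Z w * Z w).
  by move=> bZ; rewrite cov_center// /cov lerBlDr lerDl -expr2 sqr_ge0.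
have h (e : R) : e = 1 \/ e = -1 ->
    2 * e * cov X Y <= Ex (fun w => X w * X w) + Ex (fun w => Y w * Y w).
  move=> he; apply: le_trans (lerD (var_le _ bX) (var_le _ bY)).
  rewrite -cov_center// -ExZ; last by apply: bmeasM; exact: bcen.
  rewrite -ExD; try by apply: bmeasM; exact: bcen.
  apply: le_Ex.
  - by apply: bmeasZ; apply: bmeasM; exact: bcen.
  - by apply: bmeasD; apply: bmeasM; exact: bcen.
  move=> w; have := sqr_ge0 ((X w - Ex X) - e * (Y w - Ex Y)).
  by case: he => ->; nra.
have h1 := h 1 (or_introl erefl); have h2 := h (-1) (or_intror erefl).
rewrite ler_norml; apply/andP; split; lra.
Qed.

Lemma cov_le_bounds X Y x y : bmeas X -> bmeas Y ->
  (forall w, `|X w| <= x) -> (forall w, `|Y w| <= y) ->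
  `|cov X Y| <= 2 * x * y.
Proof.
move=> bX bY hx hy; rewrite /cov (le_trans (ler_normB _ _))//.
rewrite mulrDl mulrDl !mul1r lerD//.
  rewrite (le_trans (Ex_norm _ _)) ?Ex_le//.
  - exact: bmeasM.
  - exact/bmeas_norm/bmeasM.
  - by move=> w; rewrite normrM ler_pM.
have nE Z z : bmeas Z -> (forall w, `|Z w| <= z) -> `|Ex Z| <= z.
  move=> bZ hz; rewrite (le_trans (Ex_norm _ _)) ?Ex_le//.
  exact: bmeas_norm.
by rewrite normrM ler_pM// nE.
Qed.

(** Counting the thresholds [1, ..., m] below [y] rounds down the truncation of [y] to [[0, m]]. The
    last clause is what carries the induction: when [y] reaches [m], all earlier thresholds are
    already counted. *)
Lemma clamp_sum (y : R) (m : nat) : let s := \sum_(k < m) ((k.+1)%:R <= y)%R%:R in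
  [/\ s <= Num.max 0 (Num.min y m%:R), Num.max 0 (Num.min y m%:R) <= s + 1
    & m%:R <= y -> s = m%:R].
Proof.
elim: m => [|m [IH1 IH2 IH3]] /=.
  rewrite big_ord0; case: (leP y 0) => y0; split=> //; rewrite ?maxxx ?ler01 ?max_l//; lra.
rewrite big_ord_recr /= -natr1; case: (leP (m%:R + 1) y) => ym.
  have my : m%:R <= y by lra.
  rewrite IH3// max_r ?addr_ge0//; split => //=; lra.
rewrite /= addr0; split => //.
- apply: le_trans IH1 _.
  rewrite ge_max; apply/andP; split; first by rewrite le_max lexx.
  by rewrite le_max; apply/orP; right; rewrite ge_min lexx.
- case: (lerP m%:R y) => h.
    by rewrite IH3// ge_max (ltW ym) andbT addr_ge0.
  by apply: le_trans IH2; rewrite min_l// ltW.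
Qed.

Definition clamp (c x : R) : R := Num.max (- c) (Num.min x c).

Lemma clamp_norm c x : 0 <= c -> `|clamp c x| <= c.
Proof.
move=> c0; rewrite ler_norml /clamp le_max lexx /= ge_max ge_min lexx orbT andbT.
lra.
Qed.

Lemma bmeas_clamp c X : bmeas X -> bmeas (fun w => clamp c (X w)).
Proof.
move=> bX; apply: bmeas_max; first exact: bmeas_cst.
have -> : (fun w => Num.min (X w) c) = (fun w => - Num.max (- X w) (- c)).
  by apply/funext => w; rewrite -oppr_min opprK.
apply: bmeasN; apply: bmeas_max; first exact: bmeasN.
exact: bmeas_cst.
Qed.

(** Rounding of [clamp c X] down to a grid of mesh [2 * c / m], in layer-cake form. *)
Definition step_clamp (c : R) (m : nat) (X : Om -> R) (w : Om) : R :=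
  - c + \sum_(k < m) 2 * c / m%:R *
     \1_[set w | - c + 2 * c / m%:R * (k.+1)%:R <= X w] w.

Lemma step_clampP c m X w : 0 < c -> (0 < m)%N ->
  `|clamp c (X w) - step_clamp c m X w| <= 2 * c / m%:R.
Proof.
move=> c0 m0; have m0' : 0 < m%:R :> R by rewrite ltr0n.
set d := 2 * c / m%:R.
have d0 : 0 < d by rewrite divr_gt0// mulr_gt0.
have dm : d * m%:R = 2 * c by rewrite /d divfK ?gt_eqF.
set y := (X w + c) / d.
have [h1 h2 _] := clamp_sum y m.
have -> : step_clamp c m X w = - c + d * \sum_(k < m) ((k.+1)%:R <= y)%R%:R.
  rewrite /step_clamp mulr_sumr; congr (_ + _); apply: eq_bigr => k _.
  rewrite indicE -/d; congr (_ * _%:R); congr nat_of_bool.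
  apply/idP/idP; rewrite inE /=.
    by rewrite /y ler_pdivlMr//; lra.
  by rewrite /y ler_pdivlMr//; lra.
have -> : clamp c (X w) = - c + d * Num.max 0 (Num.min y m%:R).
  rewrite maxr_pMr ?ltW// minr_pMr ?ltW// mulr0 dm /clamp addr_maxr addr0 addr_minr.
  by congr (Num.max _ (Num.min _ _)); [rewrite /y mulrCA divff ?gt_eqF//|]; ring.
rewrite ler_norml; apply/andP; split; nra.
Qed.

(* The clamped variables are uniform limits of sums of indicators of half-lines,
   whose pairwise covariances are what [al] controls. *)
Lemma cov_clamp c al X Y : 0 < c -> bmeas X -> bmeas Y ->
  (forall s t, `|fine (P [set w | t <= X w /\ s <= Y w])
       - fine (P [set w | t <= X w]) * fine (P [set w | s <= Y w])| <= al / 2) ->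
  `|cov (fun w => clamp c (X w)) (fun w => clamp c (Y w))| <= 2 * al * c ^+ 2.
Proof.
move=> c0 bX bY hal.
have mge Z t : bmeas Z -> measurable [set w | t <= Z w].
  by move=> [mZ _]; exact: measurable_superlevel.
have bstep m Z : bmeas Z -> bmeas (step_clamp c m Z).
  move=> bZ; apply: bmeasD; first exact: bmeas_cst.
  apply: bmeas_sum => k _; apply: bmeasZ; apply: bmeas_indic; exact: mge.
have covi s t : `|cov \1_[set w | t <= X w] \1_[set w | s <= Y w]| <= al / 2.
  rewrite /cov !Ex_indic; [|exact: mge..].
  rewrite (_ : Ex _ = fine (P [set w | t <= X w /\ s <= Y w])); first exact: hal.
  rewrite -Ex_indic; last by apply: measurableI; exact: mge.
  by congr Ex; rewrite -[LHS]/(_ \* _)%R -indicI.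
have al0 : 0 <= al by have := covi 0 0; have := normr_ge0 (cov \1_[set w | 0 <= X w] \1_[set w | 0 <= Y w]); lra.
(* There are [m ^ 2] pairs of half-lines, each contributing at most [(2 * c / m) ^ 2 * al / 2]: the
   mesh cancels. *)
have covs m : (0 < m)%N -> `|cov (step_clamp c m X) (step_clamp c m Y)| <= 2 * al * c ^+ 2.
  move=> m0; have m0' : 0 < m%:R :> R by rewrite ltr0n.
  rewrite /step_clamp.
  rewrite covDl ?cov_cstl ?add0r; [|by [exact: bmeas_cst|exact: bstep|
    apply: bmeas_sum => k _; apply: bmeasZ; apply: bmeas_indic; exact: mge]..].
  rewrite covC covDl ?cov_cstl ?add0r; [|by [exact: bmeas_cst|exact: bstep|
    apply: bmeas_sum => k _; apply: bmeasZ; apply: bmeas_indic; exact: mge]..].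
  have bs Z k : bmeas Z -> bmeas (fun w => 2 * c / m%:R *
     \1_[set w | - c + 2 * c / m%:R * k <= Z w] w).
    by move=> bZ; apply: bmeasZ; apply: bmeas_indic; exact: mge.
  rewrite cov_suml; [|by move=> k _; exact: bs|by apply: bmeas_sum => k _; exact: bs].
  apply: le_trans (ler_norm_sum _ _ _) _.
  have -> : 2 * al * c ^+ 2 = \sum_(k < m) (2 * al * c ^+ 2 / m%:R).
    by rewrite sumr_const card_ord -[RHS]mulr_natr divfK ?gt_eqF.
  apply: ler_sum => k _.
  rewrite covC cov_suml; [|by move=> i _; exact: bs|exact: bs].
  apply: le_trans (ler_norm_sum _ _ _) _.
  have -> : 2 * al * c ^+ 2 / m%:R = \sum_(k < m) (2 * al * c ^+ 2 / m%:R / m%:R).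
    by rewrite sumr_const card_ord -[RHS]mulr_natr divfK ?gt_eqF.
  apply: ler_sum => i _.
  rewrite covZl; [|by apply: bmeas_indic; exact: mge|exact: bs].
  rewrite covC covZl; [|by apply: bmeas_indic; exact: mge..].
  rewrite covC.
  have -> : 2 * al * c ^+ 2 / m%:R / m%:R = 2 * c / m%:R * (2 * c / m%:R * (al / 2)).
    by field; rewrite gt_eqF.
  have : 0 <= 2 * c / m%:R by rewrite divr_ge0// ltW// mulr_gt0.
  move: (2 * c / m%:R) => dd dd0.
  by rewrite 2!normrM !(ger0_norm dd0) !ler_wpM2l.
apply/ler_addgt0Pr => e e0.
(* Replacing either clamp by its step version costs [2 * d * c] with [d = 2 * c / m]; more than
   [8 * c ^+ 2 / e] steps bring the two errors together below [e]. *)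
pose m := (Num.truncn (8 * c ^+ 2 / e + 8)).+1.
have mlt : 8 * c ^+ 2 / e + 8 < m%:R by rewrite /m truncnS_gt.
have ce0 : 0 <= c ^+ 2 / e by rewrite divr_ge0// ?ltW// exprn_gt0.
have m0' : 0 < m%:R :> R by rewrite ltr0n.
set d := 2 * c / m%:R.
have d0 : 0 < d by rewrite divr_gt0// mulr_gt0.
have dm : d * m%:R = 2 * c by rewrite /d divfK ?gt_eqF.
have hd : 4 * d * c <= e.
  have : 8 * c ^+ 2 <= m%:R * e by rewrite -ler_pdivrMr//; lra.
  rewrite /d => h8; rewrite -(ler_pM2r m0').
  rewrite (_ : 4 * (2 * c / m%:R) * c * m%:R = 8 * c ^+ 2); first lra.
  by field; rewrite gt_eqF.
have hdc : d <= c by rewrite -(ler_pM2r m0') dm mulrC ler_pM2l//; lra.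
have -> : cov (fun w => clamp c (X w)) (fun w => clamp c (Y w)) =
   cov (step_clamp c m X) (step_clamp c m Y) +
   (cov (fun w => clamp c (X w) - step_clamp c m X w) (fun w => clamp c (Y w))
   + cov (fun w => clamp c (Y w) - step_clamp c m Y w) (step_clamp c m X)).
  have bcl Z : bmeas Z -> bmeas (fun w => clamp c (Z w)) by move=> ?; exact: bmeas_clamp.
  rewrite (covDl (bcl _ bX) (bmeasN (bstep m _ bX)) (bcl _ bY)).
  rewrite (covDl (bcl _ bY) (bmeasN (bstep m _ bY)) (bstep m _ bX)).
  have N Z Z' : bmeas Z -> bmeas Z' -> cov (fun w => - Z w) Z' = - cov Z Z'.
    move=> bZ bZ'; rewrite -mulN1r -covZl//; congr cov; apply/funext => w.
    by rewrite mulN1r.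
  rewrite !N//; [|exact: bstep|exact: bstep|exact: bstep|exact: bcl].
  rewrite (covC (step_clamp _ _ Y)) (covC (step_clamp _ _ X) (fun w => clamp c (Y w))).
  ring.
apply: le_trans (ler_normD _ _) _; apply: lerD; first exact: covs.
apply: le_trans (ler_normD _ _) _; apply: le_trans hd.
rewrite (_ : 4 * d * c = 2 * d * c + 2 * d * c); last by ring.
apply: lerD.
- apply: cov_le_bounds.
  + by apply: bmeasB; [exact: bmeas_clamp|exact: bstep].
  + exact: bmeas_clamp.
  + by move=> w; exact: step_clampP.
  + by move=> w; apply: clamp_norm; exact: ltW.
- rewrite covC (_ : 2 * d * c = 2 * c * d); last by ring.
  apply: cov_le_bounds.
  + exact: bstep.
  + by apply: bmeasB; [exact: bmeas_clamp|exact: bstep].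
  + move=> w; rewrite /step_clamp ler_norml.
    have /andP[s0 sm] : 0 <= \sum_(k < m) d * \1_[set w0 | - c + d * (k.+1)%:R <= X w0] w <= 2 * c.
      apply/andP; split.
        by apply: sumr_ge0 => k _; apply: mulr_ge0; [exact: ltW|rewrite indicE ler0n].
      rewrite -dm mulr_natr -[in leRHS](card_ord m) -sumr_const.
      by apply: ler_sum => k _; rewrite ger_pMr// indicE lern1 leq_b1.
    by apply/andP; split; lra.
  + by move=> w; exact: step_clampP.
Qed.

(** Each variable is its clamp [L] plus a remainder [H], which vanishes unless the variable exceeds
    [c] in absolute value. Hence both [c * |H|] and [H ^ 2] lie below the tail square: the two mixed
    covariances cost [2 * T] each and the covariance of the remainders costs [T]. *)
Lemma cov_truncation c al T X Y : 0 < c -> bmeas X -> bmeas Y ->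
  (forall s t, `|fine (P [set w | t <= X w /\ s <= Y w])
       - fine (P [set w | t <= X w]) * fine (P [set w | s <= Y w])| <= al / 2) ->
  Ex (fun w => (c < `|X w|)%R%:R * (X w * X w)) <= T ->
  Ex (fun w => (c < `|Y w|)%R%:R * (Y w * Y w)) <= T ->
  `|cov X Y| <= 2 * al * c ^+ 2 + 5 * T.
Proof.
move=> c0 bX bY hal hX hY.
pose L Z w := clamp c (Z w); pose H Z w := Z w - clamp c (Z w).
have bL Z : bmeas Z -> bmeas (L Z) by move=> ?; exact: bmeas_clamp.
have bH Z : bmeas Z -> bmeas (H Z) by move=> bZ; apply: bmeasB => //; exact: bL.
have LH Z : Z = (fun w => L Z w + H Z w) by apply/funext => w; rewrite /L /H; ring.
have Hle Z w : `|H Z w| <= (c < `|Z w|)%R%:R * `|Z w|.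
  rewrite /H /clamp; case: (ltP c `|Z w|) => h; rewrite ?mul1r ?mul0r.
    move: h; case: (ltP (Z w) 0) => z0.
      rewrite (ltr0_norm z0) => h; rewrite min_l ?max_l; try lra.
      by rewrite ler_norml; apply/andP; split; lra.
    rewrite (ger0_norm z0) => h; rewrite min_r ?max_r; try lra.
    by rewrite ler_norml; apply/andP; split; lra.
  move: h; rewrite ler_norml => /andP[h1 h2].
  by rewrite min_l// max_r// subrr normr0.
have H2 Z : bmeas Z -> Ex (fun w => H Z w * H Z w) <= Ex (fun w => (c < `|Z w|)%R%:R * (Z w * Z w)).
  move=> bZ; apply: le_Ex; [by apply: bmeasM; exact: bH|exact: bmeas_tail|] => w.
  rewrite -[leLHS]ger0_norm; last by rewrite -expr2 sqr_ge0.
  rewrite normrM; apply: le_trans (ler_pM _ _ (Hle Z w) (Hle Z w)) _ => //.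
  case: (c < _); rewrite ?mul1r ?mul0r// -normrM ger0_norm//.
  by rewrite -expr2 sqr_ge0.
have H1 Z : bmeas Z -> c * Ex (fun w => `|H Z w|) <= Ex (fun w => (c < `|Z w|)%R%:R * (Z w * Z w)).
  move=> bZ; rewrite -ExZ; last exact/bmeas_norm/bH.
  apply: le_Ex; [exact/bmeasZ/bmeas_norm/bH|exact: bmeas_tail|] => w.
  have := Hle Z w; case: (ltP c `|Z w|) => h; rewrite ?mul1r ?mul0r => hl.
    rewrite -[leRHS]ger0_norm; last by rewrite -expr2 sqr_ge0.
    by rewrite normrM ler_pM// ltW.
  by rewrite pmulr_rle0.
have mix Z Z' : bmeas Z -> bmeas Z' -> Ex (fun w => (c < `|Z' w|)%R%:R * (Z' w * Z' w)) <= T -> `|cov (L Z) (H Z')| <= 2 * T.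
  move=> bZ bZ' hZ'.
  have LZ w : `|L Z w| <= c by apply: clamp_norm; exact: ltW.
  have E1 : Ex (fun w => `|L Z w * H Z' w|) <= c * Ex (fun w => `|H Z' w|).
    rewrite -ExZ; last exact/bmeas_norm/bH.
    apply: le_Ex; [by apply: bmeas_norm; apply: bmeasM; [exact: bL|exact: bH]|exact/bmeasZ/bmeas_norm/bH|].
    by move=> w; rewrite normrM ler_wpM2r.
  rewrite /cov (le_trans (ler_normB _ _))//.
  have h1 := H1 _ bZ'.
  have t1 : `|Ex (fun w => L Z w * H Z' w)| <= T.
    rewrite (le_trans (Ex_norm P _))//; last by rewrite (le_trans E1)// (le_trans h1).
    by apply: bmeasM; [exact: bL|exact: bH].
  have t2 : `|Ex (L Z) * Ex (H Z')| <= T.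
    rewrite normrM; apply: le_trans (_ : c * Ex (fun w => `|H Z' w|) <= _); last by rewrite (le_trans h1).
    apply: ler_pM => //; last by apply: Ex_norm; exact: bH.
    rewrite (le_trans (Ex_norm P _))//; [exact: bL|].
    by apply: Ex_le => //; exact/bmeas_norm/bL.
  lra.
have -> : cov X Y = cov (L X) (L Y) + (cov (L X) (H Y) + cov (L Y) (H X) + cov (H X) (H Y)).
  rewrite {1}(LH X) {1}(LH Y) covDl; [|exact: bL|exact: bH|by rewrite -LH].
  have LHc Z : bmeas Z -> cov Z (fun w => L Y w + H Y w) = cov Z (L Y) + cov Z (H Y).
    move=> bZ; rewrite covC covDl ?(covC Z)//; [exact: bL|exact: bH].
  rewrite !LHc; [|exact: bH|exact: bL].
  by rewrite (covC (L Y) (H X)); ring.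
have h1 := cov_clamp c0 bX bY hal.
have h2 := mix _ _ bX bY hY; have h3 := mix _ _ bY bX hX.
have h4 := cov_le_sqr (bH _ bX) (bH _ bY).
have h5 := H2 _ bX; have h6 := H2 _ bY.
apply: le_trans (ler_normD _ _) _; apply: lerD => //.
apply: le_trans (ler_normD _ _) _; apply: le_trans (lerD (ler_normD _ _) (lexx _)) _.
lra.
Qed.

End covariance_bounds.

(** * Block partitions of doubling graphs *)

Section graph_distance.
Context (R : realType) (N : finType) (e : rel N).
Local Notation gdist := (gdist R e).

Lemma gdist_ge0 i j : (0 <= gdist i j)%E.
Proof. by apply: le_ereal_inf_tmp => _ [s _ <-]; rewrite lee_fin. Qed.

Lemma gdist_walk i j s : path e i s -> last i s = j ->
  (gdist i j <= (size s)%:R%:E)%E.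
Proof. by move=> es sj; apply: ereal_inf_lbound; exists s. Qed.

(** Walk lengths are natural numbers, so the infimum is attained. Finite distances are thus
    integers, which is what allows sums over spheres of integer radius. *)
Lemma gdist_nat i j : gdist i j = +oo%E \/
  exists s, [/\ path e i s, last i s = j & gdist i j = (size s)%:R%:E].
Proof.
have [[s0 s0P]|no] := pselect (exists s, path e i s /\ last i s = j); last first.
  left; rewrite /gdist (_ : [set _ | _ in _] = set0) ?ereal_inf0//.
  by rewrite -subset0 => y [s sP _]; apply: no; exists s.
right.
have ex : exists k, `[< exists s, [/\ path e i s, last i s = j & size s = k] >].
  by exists (size s0); apply/asboolP; exists s0; case: s0P.
case: (ex_minnP ex) => k /asboolP[s [es sj sk]] kmin; exists s; split => //.
apply/eqP; rewrite eq_le gdist_walk//=.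
apply: le_ereal_inf_tmp => _ [s' [es' s'j] <-]; rewrite lee_fin ler_nat sk kmin//.
by apply/asboolP; exists s'.
Qed.

Lemma gdistxx i : gdist i i = 0%E.
Proof.
by apply/eqP; rewrite eq_le gdist_ge0 andbT (@gdist_walk i i [::]).
Qed.

Lemma gdist_eq0 i j : gdist i j = 0%E -> i = j.
Proof.
case: (gdist_nat i j) => [->//|[s [_ <- ->]]] [] /eqP.
by rewrite pnatr_eq0 size_eq0 => /eqP ->.
Qed.

Lemma gdist_sym i j : symmetric e -> gdist i j = gdist j i.
Proof.
move=> esym.
suff h x y : (gdist x y <= gdist y x)%E by apply/eqP; rewrite eq_le !h.
case: (gdist_nat y x) => [->|[s [es sx ->]]]; first exact: leey.
have := @gdist_walk x y (rev (belast y s)).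
rewrite size_rev size_belast; apply.
  by rewrite -sx rev_path (eq_path (e' := e))// => a b; rewrite esym.
case: s es sx => [/= _ ->//|a s /= _ _].
by rewrite rev_cons last_rcons.
Qed.

Lemma gdist_triangle i j k : (gdist i k <= gdist i j + gdist j k)%E.
Proof.
case: (gdist_nat i j) => [->|[s [es sj ->]]].
  by rewrite addye ?leey// gt_eqF// (lt_le_trans _ (gdist_ge0 _ _)).
case: (gdist_nat j k) => [->|[t [et tk ->]]]; first by rewrite addey ?leey.
rewrite -EFinD -natrD -size_cat; apply: gdist_walk.
  by rewrite cat_path es sj.
by rewrite last_cat sj.
Qed.

End graph_distance.

Section greedy_coloring.

Lemma greedy_coloring (M D : nat) (cf : rel 'I_M) : symmetric cf ->
  (forall m, (#|[set m' : 'I_M | cf m m']%SET| <= D)%N) ->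
  exists c : 'I_M -> 'I_D.+1, forall m m', m != m' -> cf m m' -> c m != c m'.
Proof.
move=> cfs hD.
suff h k : exists c : 'I_M -> 'I_D.+1, forall m m' : 'I_M, (m < k)%N -> (m' < k)%N ->
    m != m' -> cf m m' -> c m != c m'.
  by have [c hc] := h M; exists c => m m'; apply: hc.
elim: k => [|k [c hc]]; first by exists (fun=> ord0).
have [kM|Mk] := ltnP k M; last first.
  by exists c => m m' _ _; apply: hc; apply: leq_trans Mk.
pose x := Ordinal kM.
(* Colors of neighbors not yet treated are excluded as well; this is harmless, since [D] bounds the
   total number of neighbors. *)
pose used := (c @: [set m' : 'I_M | cf x m'])%SET.
have [col hcol] : exists col : 'I_D.+1, col \notin used.
  apply/existsP; rewrite -negb_forall; apply/negP => /forallP all.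
  have : (#|'I_D.+1| <= #|used|)%N by apply: subset_leq_card; apply/fintype.subsetP.
  rewrite card_ord => le; have := leq_trans le (leq_trans (leq_imset_card _ _) (hD x)).
  by rewrite ltnn.
exists (fun m => if m == x then col else c m) => m m'.
rewrite !ltnS leq_eqVlt [(m' <= k)%N]leq_eqVlt => /orP mk /orP m'k mm'.
have mx (y : 'I_M) : (y == k :> nat) = (y == x) by [].
case: ifP => [/eqP mE|mx']; case: ifP => [/eqP m'E|m'x'] cfm.
- by rewrite mE m'E eqxx in mm'.
- rewrite mE in cfm; apply: contra hcol => /eqP ->.
  by apply/imsetP; exists m' => //; rewrite inE.
- rewrite m'E cfs in cfm; rewrite eq_sym; apply: contra hcol => /eqP ->.
  by apply/imsetP; exists m => //; rewrite inE.
- by case: mk => [|mk]; [rewrite mx mx'|case: m'k => [|m'k]; [rewrite mx m'x'|exact: hc]].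
Qed.

End greedy_coloring.

Section doubling.
Context (R : realType) (N : finType) (e : rel N) (Cdbl : nat).
Hypothesis e_sym : symmetric e.
Hypothesis dbl : forall (x : N) (r : R), 0 < r ->
  exists c : 'I_Cdbl -> N,
    gball e x r \subset (\bigcup_(k < Cdbl) gball e (c k) (r / 2))%SET.
Local Notation gdist := (gdist R e).

Lemma doubling_iter (k : nat) x (r : R) : 0 < r ->
  exists c : 'I_(Cdbl ^ k) -> N,
    gball e x r \subset
      (\bigcup_(j < Cdbl ^ k) gball e (c j) (r / 2 ^+ k : R))%SET.
Proof.
move=> r0; elim: k => [|k [c hc]].
  exists (fun=> x); rewrite expn0 big_ord1 expr0 divr1; exact: subxx.
have rk0 : 0 < r / 2 ^+ k by rewrite divr_gt0// exprn_gt0.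
have [f hf] := choice (fun j => dbl (c j) rk0).
have cE : #|{: 'I_(Cdbl ^ k) * 'I_Cdbl}| = (Cdbl ^ k.+1)%N.
  by rewrite card_prod !card_ord expnSr.
exists (fun j => let u := enum_val (cast_ord (esym cE) j) in f u.1 u.2).
apply/fintype.subsetP => y /(fintype.subsetP hc) /bigcupP[j _] /(fintype.subsetP (hf j)).
move=> /bigcupP[i _ yi]; apply/bigcupP.
exists (cast_ord cE (enum_rank (j, i))) => //.
by rewrite cast_ordK enum_rankK /= exprSr invfM mulrA.
Qed.

(** Pigeonhole: a covering ball of radius [r / 2 ^+ k] has diameter at most twice that, hence
    contains at most one point of [D]. *)
Lemma separated_card (D : {set N}) (k : nat) x (r : R) : 0 < r ->
  (forall y z, y \in D -> z \in D -> y != z -> ((2 * (r / 2 ^+ k))%:E < gdist y z)%E) ->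
  (#|D :&: gball e x r| <= Cdbl ^ k)%N.
Proof.
move=> r0 sep; have [c hc] := doubling_iter k x r0.
have cov y : y \in (D :&: gball e x r)%SET -> exists j, y \in gball e (c j) (r / 2 ^+ k).
  by rewrite inE => /andP[_] /(fintype.subsetP hc)/bigcupP[j _ ?]; exists j.
have [f hf] := choice (fun y : {y | y \in (D :&: gball e x r)%SET} => cov (val y) (valP y)).
have finj : injective f.
  move=> y z fyz; apply: val_inj; apply/eqP/negP => /negP yz.
  have := valP y; have := valP z; rewrite !inE => /andP[zD _] /andP[yD _].
  have := sep _ _ yD zD yz; apply/negP; rewrite -leNgt.
  have := hf y; have := hf z; rewrite -fyz !inE => hz hy.
  apply: le_trans (gdist_triangle R e _ (c (f y)) _) _.
  rewrite mulrDl mul1r EFinD leeD// gdist_sym//.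
have := leq_card f finj.
by rewrite card_ord card_sig.
Qed.

End doubling.

Section ball_size.
Context (R : realType) (N : finType) (e : rel N).

Lemma gball_card (C d r : R) x : 1 <= d -> 1 <= r ->
  (forall s : R, 1 <= s -> #|gsphere e x s|%:R <= C * s `^ (d - 1)) ->
  #|gball e x r|%:R <= (1 + `|C|) * r `^ d.
Proof.
move=> d1 r1 hs; have r0 : 0 <= r by lra.
pose L := Num.truncn r.
have sub : gball e x r \subset (x |: \bigcup_(k < L) gsphere e x ((k.+1)%:R : R))%SET.
  apply/fintype.subsetP => y; rewrite !inE.
  case: (gdist_nat R e x y) => [->//|[s [_ sy dE]]].
  rewrite dE lee_fin => sr.
  case: s => [|a s] in sy dE sr *; first by rewrite -sy eqxx.
  apply/orP; right; apply/bigcupP.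
  have sL : (size s < L)%N by rewrite /L -[(size s < _)%N]/((size (a :: s)) <= _)%N truncn_ge_nat.
  by exists (Ordinal sL) => //; rewrite inE dE.
have rd1 : 1 <= r `^ d.
  have d0 : 0 <= d by lra.
  by have /(_ 1 r) := ge0_ler_powR d0; rewrite !nnegrE powR1; apply.
have card1 : (#|gball e x r| <= 1 + \sum_(k < L) #|gsphere e x ((k.+1)%:R : R)|)%N.
  apply: leq_trans (subset_leq_card sub) _.
  apply: leq_trans (leq_card_setU _ _) _; rewrite cards1 leq_add2l.
  elim/big_rec2: _ => [|k A B _ h]; first by rewrite cards0.
  by apply: leq_trans (leq_card_setU _ _) _; rewrite leq_add2l.
apply: le_trans (_ : (1 + \sum_(k < L) #|gsphere e x ((k.+1)%:R : R)|)%:R <= _).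
  by rewrite ler_nat.
rewrite natrD natr_sum mulrDl mul1r lerD//.
apply: le_trans (_ : \sum_(k < L) `|C| * r `^ (d - 1) <= _).
  apply: ler_sum => k _; apply: le_trans (hs _ _) _; first by rewrite ler1n.
  apply: le_trans (_ : `|C| * (k.+1)%:R `^ (d - 1) <= _).
    by rewrite ler_wpM2r ?powR_ge0// ler_norm.
  rewrite ler_wpM2l// ge0_ler_powR ?nnegrE//; first lra.
  by rewrite -truncn_ge_nat// ltn_ord.
rewrite sumr_const card_ord -[leLHS]mulr_natr -mulrA ler_wpM2l//.
have -> : r `^ d = r `^ (d - 1) * r.
  rewrite -[in LHS](subrK 1 d) [LHS]powRD ?powRr1//.
  by apply/implyP => _; rewrite gt_eqF; lra.
by rewrite ler_wpM2l ?powR_ge0// truncn_le.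
Qed.

End ball_size.

(** * Voronoi blocks and the number of colors *)

Section blocks.
Context (R : realType) (N : finType) (e : rel N) (Cdbl : nat) (Cgr d : R).
Hypothesis e_sym : symmetric e.
Hypothesis dbl : forall (x : N) (r : R), 0 < r ->
  exists c : 'I_Cdbl -> N,
    gball e x r \subset (\bigcup_(k < Cdbl) gball e (c k) (r / 2))%SET.
Hypothesis growth : forall (x : N) (s : R), 1 <= s ->
  #|gsphere e x s|%:R <= Cgr * s `^ (d - 1).
Hypothesis d1 : 1 <= d.
Local Notation gdist := (gdist R e).

Lemma separated_net (r : R) : 0 <= r -> exists D : {set N},
  (forall y z, y \in D -> z \in D -> y != z -> (r%:E < gdist y z)%E) /\
  forall y, exists2 x, x \in D & (gdist x y <= r%:E)%E.
Proof.
move=> r0.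
pose sep (D : {set N}) := [forall y in D, forall z in D, (y != z) ==> (r%:E < gdist y z)%E].
have sep0 : sep finset.set0 by apply/forall_inP => y; rewrite inE.
have [D /maxsetP[sD maxD] _] := maxset_exists sep0.
have sepD y z : y \in D -> z \in D -> y != z -> (r%:E < gdist y z)%E.
  by move=> yD zD yz; have /forall_inP/(_ y yD)/forall_inP/(_ z zD)/implyP/(_ yz) := sD.
exists D; split => // y.
have [yD|yD] := boolP (y \in D); first by exists y; rewrite // gdistxx lee_fin.
apply: contrapT => no.
have far x : x \in D -> (r%:E < gdist x y)%E.
  by move=> xD; rewrite ltNge; apply/negP => h; apply: no; exists x.
have /maxD DE : sep (y |: D)%SET.
  apply/forall_inP => u; rewrite !inE => uD; apply/forall_inP => v; rewrite !inE => vD.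
  apply/implyP => uv.
  case/orP: uD => [/eqP uE|uD]; case/orP: vD => [/eqP vE|vD].
  - by rewrite uE vE eqxx in uv.
  - by rewrite uE gdist_sym// far.
  - by rewrite vE far.
  - exact: sepD.
by move: yD; rewrite -(DE (finset.subsetUr _ _)) !inE eqxx.
Qed.

Lemma coloring_number_le (M K : nat) (B : 'I_M -> {set N}) (r : R) (c : 'I_M -> 'I_K) :
  proper_coloring e B r c -> (coloring_number e B r <= K)%N.
Proof.
move=> hc; rewrite /coloring_number; case: ex_minnP => k _ kmin.
have := kmin (size (undup (codom (fun m => nat_of_ord (c m))))).
move=> /(_ _)/leq_trans; apply.
  apply/asboolP; exists (fun m => nat_of_ord (c m)); split=> // m m' /val_inj.
  exact: hc.
rewrite -[X in (_ <= X)%N](size_iota 0); apply: uniq_leq_size; first exact: undup_uniq.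
by move=> x; rewrite mem_undup => /codomP[m ->]; rewrite mem_iota/= ltn_ord.
Qed.

Lemma block_partition (r : R) : 1 <= r ->
  exists (M : nat) (B : 'I_M -> {set N}),
    [/\ is_partition B,
        forall m i j, i \in B m -> j \in B m -> (gdist i j <= (2 * r)%:E)%E,
        forall m, #|B m|%:R <= (1 + `|Cgr|) * r `^ d
      & (coloring_number e B r <= (Cdbl ^ 3).+1)%N].
Proof.
move=> r1; have r0 : 0 <= r by lra.
have [D [sepD netD]] := separated_net r0.
have /choice[f hf] : forall y, exists x, x \in D /\ (gdist x y <= r%:E)%E.
  by move=> y; have [x xD xy] := netD y; exists x.
(* Any other net point is farther than [r], so a net point is its own centre; this makes the cells
   nonempty and distinct. *)
have fD y : y \in D -> f y = y.
  move=> yD; apply: contrapT => /eqP fy; have [fyD] := hf y.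
  by apply/negP; rewrite -ltNge sepD.
exists #|D|, (fun m => [set y | f y == enum_val m]%SET).
set B := fun m => _.
have evB m : enum_val m \in B m by rewrite inE fD// enum_valP.
have Binj : injective B.
  move=> m m' BE; have := evB m; rewrite BE inE fD ?enum_valP//.
  by move=> /eqP/enum_val_inj.
have ballB m i : i \in B m -> (gdist (enum_val m) i <= r%:E)%E.
  by rewrite inE => /eqP <-; have [] := hf i.
split.
- split => //; apply/and3P; split.
  + apply/eqP/setP => y; rewrite inE; apply/bigcupP.
    have [fyD _] := hf y.
    exists (B (enum_rank_in fyD (f y))); last by rewrite inE enum_rankK_in.
    exact: imset_f.
  + apply/finset.trivIsetP => _ _ /imsetP[m _ ->] /imsetP[m' _ ->] mm'.
    rewrite -setI_eq0; apply/eqP/setP => y; rewrite !inE; apply/negbTE.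
    apply: contra mm' => /andP[/eqP -> /eqP/enum_val_inj ->].
    exact: eqxx.
  + apply/imsetP => -[m _ /setP/(_ (enum_val m))]; rewrite evB inE.
    by [].
- move=> m i j im jm; rewrite mulrDl mul1r EFinD.
  apply: le_trans (gdist_triangle R e _ (enum_val m) _) _.
  by rewrite leeD ?ballB// gdist_sym// ballB.
- move=> m; have := gball_card d1 r1 (growth (enum_val m)); apply: le_trans.
  by rewrite ler_nat subset_leq_card//; apply/fintype.subsetP => y /ballB; rewrite inE.
(* Blocks within [r] of each other have centres within [r + 2 * r + r]. Halving the radius [4 * r]
   three times gives [r / 2], the scale at which a ball holds at most one centre; this is the
   exponent 3. *)
- pose cf m m' := (gdist (@enum_val _ (mem D) m) (@enum_val _ (mem D) m') <= (4 * r)%:E)%E.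
  have cfs : symmetric cf by move=> m m'; rewrite /cf gdist_sym.
  have deg m : (#|[set m' : 'I_#|D| | cf m m']%SET| <= Cdbl ^ 3)%N.
    have sep' y z : y \in D -> z \in D -> y != z -> ((2 * (4 * r / 2 ^+ 3))%:E < gdist y z)%E.
      rewrite (_ : 2 * _ = r); first exact: sepD.
      by field.
    have r40 : 0 < 4 * r by lra.
    apply: leq_trans (separated_card e_sym dbl (enum_val m) r40 sep').
    rewrite -(card_imset _ enum_val_inj); apply: subset_leq_card.
    apply/fintype.subsetP => _ /imsetP[m' + ->]; rewrite !inE /cf => ->.
    by rewrite enum_valP.
  have [c hc] := greedy_coloring cfs deg.
  apply: (@coloring_number_le _ _ _ _ c) => m m' cE mm'.
  rewrite ltNge; apply/negP => near.
  (* The distance between blocks is an infimum: relaxing [r] to a strict bound by [2 * r] yields an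
     actual pair of vertices. *)
  have : (gdist_set R e (B m) (B m') < (2 * r)%:E)%E.
    by apply: le_lt_trans near _; rewrite lte_fin; lra.
  move=> /ereal_inf_lt[_ [i im [j jm <-]] ij].
  move: (hc _ _ mm'); rewrite cE eqxx => /(_ _)/notF; apply; rewrite /cf.
  rewrite (_ : 4 * r = r + (2 * r + r)); last by ring.
  rewrite !EFinD.
  apply: le_trans (gdist_triangle R e _ i _) _; rewrite leeD ?ballB//.
  apply: le_trans (gdist_triangle R e _ j _) _; rewrite leeD ?(ltW ij)//.
  by rewrite gdist_sym// ballB.
Qed.

End blocks.

(** * Essential suprema and conditional expectations *)

Section integral_monotone.
Context (R : realType) (dO : measure_display) (Om : measurableType dO)
  (mu : {measure set Om -> \bar R}).
Local Open Scope ereal_scope.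

(* [f] and [g] need not be measurable: the integral of a nonnegative function is
   a supremum over the simple functions below it. *)
Lemma ge0_le_integralT (f g : Om -> \bar R) :
  (forall x, 0 <= f x) -> (forall x, f x <= g x) ->
  \int[mu]_x f x <= \int[mu]_x g x.
Proof.
move=> f0 fg; have g0 x : 0 <= g x by apply: le_trans (f0 x) (fg x).
rewrite !ge0_integralTE//; apply: ereal_sup_le => _ [h hf <-].
by exists h => // x; apply: le_trans (hf x) (fg x).
Qed.

Lemma le_LnormT (p : \bar R) (f g : Om -> \bar R) : 0 <= p ->
  (forall x, `|f x| <= `|g x|) -> 'N[mu]_p[f] <= 'N[mu]_p[g].
Proof.
case: p => [r|_|//] => [|fg]; last first.
  rewrite unlock /Lnorm; case: ifPn => // _; apply: le_ess_sup.
  by apply: nearW => x; exact: fg.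
rewrite lee_fin => r0 fg; rewrite unlock /Lnorm.
have I0 h : \int[mu]_x `|h x| `^ r \in `[0, +oo].
  by rewrite in_itv/= leey andbT; apply: integral_ge0 => x _; exact: poweR_ge0.
apply: gt0_ler_poweR; rewrite ?invr_ge0//.
apply: ge0_le_integralT => x; first exact: poweR_ge0.
by apply: gt0_ler_poweR; rewrite ?in_itv/= ?leey ?abse_ge0.
Qed.

End integral_monotone.

Section essential_supremum_of_family.
Context (R : realType) (dO : measure_display) (Om : measurableType dO)
  (P : probability Om R).
Local Open Scope ereal_scope.

(** Exhaustion: the largest probability of a countable union is attained, because countably many
    nearly optimal families merge into one. Adjoining [A i] to an optimal union cannot increase its
    probability. *)
Lemma essential_union (I : Type) (i0 : I) (A : I -> set Om) :
  (forall i, measurable (A i)) ->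
  exists f : nat -> I, forall i, P (A i `\` \bigcup_k A (f k)) = 0.
Proof.
move=> mA; pose U (f : nat -> I) := \bigcup_k A (f k).
have mU f : measurable (U f) by exact: bigcupT_measurable.
pose s := ereal_sup [set P (U f) | f in setT].
have sfin : s \is a fin_num.
  rewrite fin_real//; apply/andP; split.
    apply: lt_le_trans (ltNyr 0%R) _; apply: le_ereal_sup_tmp.
    by exists (P (U (fun=> i0))); [exists (fun=> i0)|].
  apply: le_lt_trans (ltry 1%R); apply: ge_ereal_sup => _ [f _ <-].
  exact: probability_le1.
have /choice[F hF] : forall n : nat, exists f, s - n.+1%:R^-1%:E < P (U f).
  move=> n; have n0 : (0 < n.+1%:R^-1 :> R)%R by rewrite invr_gt0.
  by have [_ [f _ <-] lt] := ub_ereal_sup_adherent n0 sfin; exists f.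
pose f k := if unpickle k is Some (n, l) then F n l else i0.
have FU n : U (F n) `<=` U f.
  move=> w [l _ Al]; exists (pickle (n, l)) => //.
  by rewrite /f pickleK.
have sU : P (U f) = s.
  apply/eqP; rewrite eq_le; apply/andP; split.
    by apply: ereal_sup_ubound; exists f.
  apply/lee_addgt0Pr => e e0.
  have [n ne] : exists n : nat, (n.+1%:R^-1 <= e)%R.
    exists (Num.truncn e^-1); rewrite invf_ple ?posrE//.
    by rewrite ltW// truncnS_gt.
  rewrite -leeBlDr//; apply: le_trans (_ : s - n.+1%:R^-1%:E <= _).
    by rewrite leeB// lee_fin.
  by apply: le_trans (ltW (hF n)) _; rewrite le_measure ?inE.
exists f => i.
pose g k := if k is k'.+1 then f k' else i.
have Ug : U g = U f `|` (A i `\` U f).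
  apply/seteqP; split => w.
    move=> [[|k] _ Ak]; last by left; exists k.
    by have [Uw|Uw] := pselect (U f w); [left|right].
  by move=> [[k _ Ak]|[Ai _]]; [exists k.+1|exists 0%N].
have : P (U g) <= s by apply: ereal_sup_ubound; exists g.
rewrite Ug measureU//; last 2 first.
- exact: measurableD.
- by rewrite setIDA setIC -setIDA setDv setI0.
rewrite [X in X + _]sU => h.
apply/eqP; rewrite eq_le measure_ge0 andbT.
by move: h; rewrite -[leRHS]adde0 leeD2lE.
Qed.

Lemma lt_ratr_between (x y : \bar R) : x < y -> exists q : rat, x < (ratr q)%:E < y.
Proof.
move=> xy.
have [a [b [xa ab bY]]] : exists a b : R, [/\ x <= a%:E, (a < b)%R & b%:E <= y].
  case: x y xy => [x| |] [y| |]//= xy.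
  - by exists x, y; split=> //; rewrite -lte_fin.
  - by exists x, (x + 1)%R; split => //; rewrite ?leey// ltrDl.
  - by exists (y - 1)%R, y; split; rewrite ?leNye// ltrBlDr ltrDl.
  - by exists 0%R, 1%R; split; rewrite ?leey ?leNye.
have [q /itvP qab] := rat_in_itvoo ab; exists q.
by rewrite (le_lt_trans xa) ?lte_fin ?qab//= (lt_le_trans _ bY)// lte_fin qab.
Qed.

(** [essential_union], applied to the superlevel sets at each rational level, selects a countable
    subfamily with pointwise supremum [U]. If a member exceeds [U] at a point, a rational in between
    places that point in one of countably many null sets. *)
Lemma as_sup_exists (H : set (Om -> \bar R)) :
  (forall h, H h -> measurable_fun setT h) -> exists U, is_as_sup P H U.
Proof.
move=> mH.
have [H0|/set0P[h0 Hh0]] := eqVneq H set0.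
  exists (cst -oo); split => [|h|V mV _]; first exact: measurable_cst.
    by rewrite H0.
  by apply: nearW => w; rewrite leNye.
pose I := {h | H h}; pose i0 : I := exist _ h0 Hh0.
pose A (q : rat) (i : I) := [set w | (ratr q)%:E < sval i w].
have mA q i : measurable (A q i).
  rewrite /A -[X in measurable X]setTI.
  by apply: emeasurable_fun_o_infty => //; apply: mH; exact: (svalP i).
have /choice[f hf] : forall q, exists f : nat -> I, forall i, P (A q i `\` \bigcup_k A q (f k)) = 0.
  by move=> q; apply: essential_union (mA q).
pose u k : I := if unpickle k is Some (q, l) then f q l else i0.
have uE q l : u (pickle (q, l)) = f q l by rewrite /u pickleK.
pose U w := esups (fun k => sval (u k) w) 0%N.
have leU k w : sval (u k) w <= U w.
  by apply: ereal_sup_ubound; exists k.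
exists U; split.
- apply: measurable_fun_esups => k; apply: mH; exact: (svalP (u k)).
- move=> h Hh; pose i : I := exist _ h Hh.
  pose B k := if unpickle k is Some q then A q i `\` \bigcup_l A q (f q l) else set0.
  have : P.-negligible (\bigcup_k B k).
    apply: negligible_bigcup => k; rewrite /B; case: unpickle => [q|]; last exact: negligible_set0.
    apply/negligibleP; last exact: hf.
    by apply: measurableD => //; exact: bigcupT_measurable.
  apply: negligibleS => w /= /negP; rewrite -ltNge => /lt_ratr_between[q /andP[Uq qh]].
  have Bq : B (pickle q) w.
    rewrite /B (@pickleK rat); split; first exact: qh.
    move=> [l _]; rewrite /A /= -uE => /lt_le_trans/(_ (leU _ _)) h'.
    by have := lt_trans h' Uq; rewrite ltxx.
  exact: (ex_intro2 _ _ (pickle q) Logic.I Bq).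
- move=> V mV hV.
  have : {ae P, forall w, forall k, sval (u k) w <= V w}.
    by apply: ae_foralln => k; apply: hV; exact: (svalP (u k)).
  apply: filterS => w hw; apply: ge_ereal_sup => _ [k _ <-]; exact: hw.
Qed.

Lemma as_supP (H : set (Om -> \bar R)) :
  (forall h, H h -> measurable_fun setT h) -> is_as_sup P H (as_sup P H).
Proof. by move=> /as_sup_exists[U HU]; rewrite /as_sup; case: xgetP => [V -> //|/(_ U)]. Qed.

End essential_supremum_of_family.

Section conditional_expectation.
Context (R : realType) (dO : measure_display) (Om : measurableType dO)
  (P : probability Om R) (G : set (set Om)).
Hypothesis mG : G `<=` measurable.

Lemma sub_sigma_measurable : <<s G >> `<=` measurable.
Proof. by apply: smallest_sub => //; exact: sigma_algebra_measurable. Qed.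

Local Notation T' := (g_sigma_algebraType G).

Lemma measurable_sub_id : measurable_fun [set: Om] (fun w : Om => (w : T')).
Proof. by move=> _ A /sub_sigma_measurable mA; rewrite setTI. Qed.

(** The identity from [Om] to [Om] with the smaller sigma-field pushes [P] forward to its
    restriction [Q]. The Radon-Nikodym density of the charge [E |-> E[Y 1_E]] with respect to [Q] is
    then measurable for the smaller sigma-field by construction. *)
Lemma is_cond_exp_exists (Y : Om -> R) : bmeas Y ->
  exists h, is_cond_exp P <<s G >> Y h /\ measurable_fun [set: Om] h.
Proof.
move=> bY; have iY := bmeas_integrable P bY.
pose idm : {mfun Om >-> T'} :=
  HB.pack (fun w : Om => (w : T')) (isMeasurableFun.Build _ _ _ _ _ measurable_sub_id).
pose Q := distribution P idm.
pose nuf (E : set T') := (\int[P]_(w in (E : set Om)) (Y w)%:E)%E.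
have nu0 : nuf set0 = 0%E by rewrite /nuf integral_set0.
have nufin E : measurable E -> nuf E \is a fin_num.
  by move=> /sub_sigma_measurable mE; apply: (fin_num_measure (induced_charge iY)).
have nusig : semi_sigma_additive nuf.
  move=> F mF tF mUF.
  have mF' i : measurable (F i : set Om) by exact: sub_sigma_measurable (mF i).
  have mUF' : measurable (\bigcup_i F i : set Om) by exact: sub_sigma_measurable mUF.
  pose nuc : {charge set Om -> \bar R} := induced_charge iY.
  have := @charge_semi_sigma_additive _ _ _ nuc F mF' tF mUF'.
  exact.
pose nu : {charge set T' -> \bar R} := HB.pack nuf (isCharge.Build _ _ _ nuf nu0 nufin nusig).
have nuQ : nu `<< Q.
  apply/null_content_dominatesP => E mE QE.
  rewrite /= /nuf; apply: null_set_integral => //.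
  - exact: sub_sigma_measurable mE.
  - by apply: measurable_funTS; apply/measurable_EFinP; case: bY.
pose f := Radon_Nikodym nu Q.
have ffin x : f x \is a fin_num by exact: Radon_Nikodym_fin_num.
have fint : Q.-integrable setT f by exact: Radon_Nikodym_integrable.
have mf : measurable_fun [set: T'] f by exact: measurable_int fint.
have fE : EFin \o (fine \o f) = f by apply/funext => x /=; rewrite fineK.
have mh : measurable_fun [set: T'] (fine \o f).
  by apply/measurable_EFinP; rewrite fE.
have mh' : measurable_fun [set: Om] (fine \o f).
  exact: (measurableT_comp mh measurable_sub_id).
have Pf : P.-integrable [set: Om] (f \o idm).
  have /integrableP[_ fi] := fint; apply/integrableP; split.
    rewrite /= -fE; exact/measurable_EFinP.
  move: fi; rewrite /Q ge0_integral_distribution//.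
  exact: measurableT_comp.
exists (fine \o f); split => //; split.
- exact: iY.
- by rewrite [EFin \o _]fE.
- by move=> S mS; have := mh measurableT S mS; rewrite setTI.
- move=> E GE.
  have mE : measurable (E : set T') by exact: GE.
  transitivity (\int[Q]_(w in E) f w)%E; last first.
    by rewrite -[RHS]/(nu E); symmetry; apply: Radon_Nikodym_integral.
  rewrite integral_pushforward//.
  - by apply: eq_integral => w _ /=; rewrite fineK.
  - by apply: integrableS Pf => //; exact: sub_sigma_measurable mE.
Qed.

End conditional_expectation.

(** * The tau-coefficient and decoupling *)

Section tau_lower_bound.
Context (R : realType) (dO dX : measure_display) (Om : measurableType dO)
  (P : probability Om R) (X : measurableType dX) (dist : X -> X -> \bar R)
  (G : set (set Om)) (xi : Om -> X).
Hypothesis mG : G `<=` measurable.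
Local Notation Ex := (Ex P).

Lemma Rintegral_in_indic (E : set Om) (f : Om -> R) :
  \int[P]_(w in E) f w = \int[P]_w (\1_E w * f w).
Proof.
rewrite Rintegral_mkcond; apply: eq_Rintegral => w _.
by rewrite /patch indicE; case: (w \in E); rewrite ?mul1r ?mul0r.
Qed.

Lemma measurable_tau_family (u : Om -> \bar R) :
  [set u | exists g h, [/\ measurable_fun setT g, lipschitz1 dist g,
                           is_cond_exp P <<s G >> (fun w => g (xi w)) h
    & u = (fun w => `|(h w)%:E - 'E_P[fun w' => g (xi w')]|%E)]] u ->
  measurable_fun setT u.
Proof.
move=> [g [h [_ _ [_ ih _ _] ->]]].
apply: measurableT_comp => //; apply: emeasurable_funB => //.
exact: measurable_int ih.
Qed.

(** The supremum in tau is taken inside the expectation, so the test function may be chosen at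
    random, provided that the choice [kap] is known to the conditioning sigma-field. Finiteness of
    [K] lets the almost sure bounds hold for all choices at once. *)
Lemma tau_ge_sum (K : finType) (kap : Om -> K) (g : K -> X -> R) :
  (forall k, <<s G >> (kap @^-1` [set k])) ->
  (forall k, measurable_fun setT (g k)) ->
  (forall k, lipschitz1 dist (g k)) ->
  (forall k, bmeas (fun w => g k (xi w))) ->
  ((\sum_k (Ex (fun w => \1_(kap @^-1` [set k]) w * g k (xi w))
      - fine (P (kap @^-1` [set k])) * Ex (fun w => g k (xi w))))%:E
    <= tau P dist <<s G >> xi)%E.
Proof.
move=> mkap mg lg bg.
have mk k : measurable (kap @^-1` [set k]) by exact: sub_sigma_measurable (mkap k).
have /choice[h hh] : forall k, exists h, is_cond_exp P <<s G >> (fun w => g k (xi w)) h /\ measurable_fun [set: Om] h.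
  by move=> k; exact: is_cond_exp_exists.
rewrite /tau; set H := (X in as_sup P X).
have [mU ubU _] : is_as_sup P H (as_sup P H).
  by apply: as_supP => u; exact: measurable_tau_family.
set U := as_sup P H in mU ubU *.
pose D k w := h k w - Ex (fun w => g k (xi w)).
have DU : {ae P, forall w, forall k, (`|(D k w)%:E| <= U w)%E}.
  apply: filter_forall => k; have [hk _] := hh k.
  apply: (@filterS _ _ _ (fun w => (`|(h k w)%:E - 'E_P[fun w' => g k (xi w')]| <= U w)%E)).
    by move=> w; rewrite bmeas_ExE// -EFinB.
  by apply: ubU; exists (g k), (h k); split.
have ih k : P.-integrable setT (EFin \o h k) by have [[]] := hh k.
have mh k : measurable_fun setT (h k) by have [] := hh k.
have mD k : measurable_fun setT (D k) by apply: measurable_funB.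
have mind k : measurable_fun setT (\1_(kap @^-1` [set k]) : Om -> R).
  exact: measurable_indic.
have iD k : P.-integrable setT (EFin \o D k).
  rewrite (_ : _ \o _ = (EFin \o h k) \+ (EFin \o (cst (- Ex (fun w => g k (xi w)))%R)))%E.
    apply: integrableD => //; apply: bmeas_integrable; exact: bmeas_cst.
  by apply/funext => w.
have iind k (f : Om -> R) : measurable_fun setT f -> P.-integrable setT (EFin \o f) ->
    P.-integrable setT (EFin \o (fun w => \1_(kap @^-1` [set k]) w * f w)).
  move=> mf fi; apply: (le_integrable measurableT _ _ fi).
    by apply/measurable_EFinP; exact: measurable_funM.
  move=> w _ /=; rewrite lee_fin normrM ler_piMl//.
  by rewrite indicE; case: (_ \in _); rewrite ?normr1 ?normr0.
pose S w := \sum_k \1_(kap @^-1` [set k]) w * D k w.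
(* The level sets of [kap] partition [Om], so a single term survives at each [w] and [S] is
   dominated by [U] itself, without a factor depending on [K]. *)
have SE w : S w = D (kap w) w.
  rewrite /S (bigD1 (kap w))//= big1 ?addr0; last first.
    move=> k kw; rewrite indicE memNset ?mul0r// /= => h'.
    by rewrite h' eqxx in kw.
  by rewrite indicE mem_set// mul1r.
have mS : measurable_fun setT S.
  by apply: measurable_sum => k; exact: measurable_funM.
have -> : \sum_k (Ex (fun w => \1_(kap @^-1` [set k]) w * g k (xi w))
      - fine (P (kap @^-1` [set k])) * Ex (fun w => g k (xi w))) =
   \int[P]_w S w.
  rewrite /S.
  rewrite /Rintegral (eq_integral (fun w => \sum_k (\1_(kap @^-1` [set k]) w * D k w)%:E)%E); last first.
    by move=> w _; rewrite sumEFin.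
  rewrite integral_sum//; last by move=> k; exact: iind.
  rewrite -sum_fine; last first.
    by move=> k _; apply: integrable_fin_num => //; exact: iind.
  apply: eq_bigr => k _.
  rewrite -[RHS]/(\int[P]_w (\1_(kap @^-1` [set k]) w * D k w)) -Rintegral_in_indic.
  have sub E : measurable E -> P.-integrable E (EFin \o h k).
    by move=> mE; apply: integrableS (ih k).
  rewrite RintegralB//; last 2 first.
  - exact: sub.
  - apply: (@integrableS _ _ _ _ setT) => //; apply: bmeas_integrable; exact: bmeas_cst.
  congr (_ - _); last by rewrite Rintegral_cst// mulrC.
  rewrite ExE -Rintegral_in_indic /Rintegral; have [[_ _ _ hE] _] := hh k.
  by rewrite hE.
rewrite Lnorm1.
have iS : P.-integrable setT (EFin \o S).
  rewrite (_ : _ \o _ = (fun w => \sum_k (\1_(kap @^-1` [set k]) w * D k w)%:E)%E).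
    by apply: integrable_sum => // k _; exact: iind.
  by apply/funext => w /=; rewrite sumEFin.
rewrite /Rintegral fineK; last exact: integrable_fin_num.
apply: le_trans (lee_abs _) _.
apply: le_trans (le_abse_integral _ _ _) _ => //; first exact/measurable_EFinP.
apply: ae_ge0_le_integral => //.
- by apply/measurableT_comp => //; exact/measurable_EFinP.
- exact: measurableT_comp.
apply: filterS DU => w Dw _; rewrite SE; apply: le_trans (Dw (kap w)) _.
exact: lee_abs.
Qed.

End tau_lower_bound.

Section quantization.
Context (R : realType) (dO : measure_display) (Om : measurableType dO)
  (J : finType) (G : set (set Om)).

(** Rounds every coordinate down to a grid of mesh [dl], finite because [V] is bounded; a level set
    is a finite intersection of preimages of half-open intervals. *)
Lemma finite_valued_approximation (V : Om -> J -> R) (C dl : R) : 0 < dl ->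
  (forall w j, `|V w j| <= C) ->
  (forall j S, measurable S -> <<s G >> ((fun w => V w j) @^-1` S)) ->
  exists (K : finType) (kap : Om -> K) (v : K -> J -> R),
    (forall k, <<s G >> (kap @^-1` [set k])) /\
    forall w j, `|V w j - v (kap w) j| <= dl.
Proof.
move=> dl0 VC mV.
pose q w j := Num.truncn ((V w j + C) / dl).
pose B := Num.truncn (2 * C / dl).
have q0 w j : 0 <= (V w j + C) / dl.
  by rewrite divr_ge0 ?(ltW dl0)//; have := VC w j; rewrite ler_norml; lra.
have qB w j : (q w j < B.+1)%N.
  rewrite ltnS /q /B; apply: le_truncn.
  rewrite ler_pM2r ?invr_gt0//; have := VC w j; rewrite ler_norml; lra.
pose kap w : {ffun J -> 'I_B.+1} := [ffun j => inord (q w j)].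
have kapE w j : kap w j = q w j :> nat by rewrite ffunE inordK.
have qE w j : dl * (q w j)%:R - C <= V w j < dl * (q w j).+1%:R - C.
  have /andP[h1 h2] := truncn_itv (q0 w j).
  apply/andP; split.
    by move: h1; rewrite ler_pdivlMr// mulrC; rewrite -/(q w j); lra.
  by move: h2; rewrite ltr_pdivrMr// mulrC -/(q w j); lra.
exists {ffun J -> 'I_B.+1}, kap, (fun (k : {ffun J -> 'I_B.+1}) j => dl * (k j)%:R - C); split; last first.
  move=> w j; rewrite kapE; have := qE w j; rewrite -natr1 => /andP[h1 h2].
  by rewrite ler_norml; apply/andP; split; lra.
move=> k.
have -> : kap @^-1` [set k] = \bigcap_(j in [set: J])
    ((fun w => V w j) @^-1` `[dl * (k j)%:R - C, dl * (k j).+1%:R - C[%classic).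
  apply/seteqP; split=> w /=.
    by move=> <- j _ /=; rewrite kapE in_itv/= qE.
  move=> h; apply/ffunP => j; apply/val_inj; rewrite /= kapE.
  have := h j Logic.I; rewrite /= in_itv/= => /andP[h1 h2].
  apply/eqP; rewrite -(eqr_nat R).
  have e : (V w j + C) / dl * dl = V w j + C by rewrite divfK// gt_eqF.
  apply/eqP; congr (_%:R); apply/eqP.
  rewrite /q truncn_eq//; apply/andP; split.
    by rewrite ler_pdivlMr// mulrC; lra.
  by rewrite ltr_pdivrMr// mulrC; lra.
have := @fin_bigcap_measurable _ (g_sigma_algebraType G) J [set: J]; apply.
- exact: finite_finset.
- by move=> j _; exact: mV.
Qed.

End quantization.

Section decoupling.
Context (R : realType) (dO : measure_display) (Om : measurableType dO)
  (P : probability Om R) (J T : finType).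
Local Notation Ex := (Ex P).

(* Replacing one block at a time by an independent copy, and integrating the
   copies out of an exponential upper bound of [Psi], avoids any coupling. *)
Lemma decoupling_bound (Psi : (J -> R) -> R) (X : nat -> Om -> J -> R)
    (G : nat -> set (set Om)) (tau : nat -> R)
    (c0 : R) (c lam : T -> R) (j1 j2 : T -> J) (mu : T -> nat -> R) (n : nat) :
  (forall v v' dl, 0 <= dl -> (forall j, `|v j - v' j| <= dl) -> Psi v <= Psi v' + 2 * dl) ->
  (forall Y : Om -> J -> R, (forall j, bmeas (fun w => Y w j)) ->
     bmeas (fun w => Psi (Y w))) ->
  (forall v, Psi v <= c0 + \sum_t c t * expR (lam t * (v (j1 t) - v (j2 t)))) ->
  (forall t, 0 <= c t) ->
  (forall i j, bmeas (fun w => X i w j)) ->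
  (forall i t, (i < n)%N ->
     Ex (fun w => expR (lam t * (X i w (j1 t) - X i w (j2 t)))) <= mu t i) ->
  (forall i, (i < n)%N -> G i `<=` measurable) ->
  (forall l i j S, (l < i)%N -> (i < n)%N -> measurable S ->
     <<s G i >> ((fun w => X l w j) @^-1` S)) ->
  (forall i, (i < n)%N -> forall (K : finType) (kap : Om -> K) (v : K -> J -> R),
     (forall k, <<s G i >> (kap @^-1` [set k])) ->
     \sum_k (Ex (fun w => \1_(kap @^-1` [set k]) w * Psi (fun j => v k j + X i w j))
       - fine (P (kap @^-1` [set k])) * Ex (fun w => Psi (fun j => v k j + X i w j)))
     <= tau i) ->
  forall v0, Ex (fun w => Psi (fun j => v0 j + \sum_(i < n) X i w j)) <=
    c0 + \sum_t c t * (\prod_(i < n) mu t i) * expR (lam t * (v0 (j1 t) - v0 (j2 t)))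
    + \sum_(i < n) tau i.
Proof.
move=> lipPsi bPsi leexp cge0 bX.
elim: n => [|n IHn] hmu mG mX htau v0.
  rewrite big_ord0 addr0 (_ : (fun w => _) = fun=> Psi v0); last first.
    by apply/funext => w; congr Psi; apply/funext => j; rewrite big_ord0 addr0.
  rewrite Ex_cst; apply: le_trans (leexp v0) _; rewrite lerD2l.
  by apply: ler_sum => t _; rewrite big_ord0 mulr1.
(* The offset [v0] stays general, so that a frozen value of the last block can later be absorbed
   into it. *)
have {}IHn := IHn (fun i t h => hmu i t (ltnW h)) (fun i h => mG i (ltnW h))
  (fun l i j S h1 h2 => mX l i j S h1 (ltnW h2)) (fun i h => htau i (ltnW h)).
pose V w j := \sum_(i < n) X i w j.
have bV j : bmeas (fun w => V w j) by apply: bmeas_sum => i _; exact: bX.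
have [C hC] : exists C, forall w j, `|V w j| <= C.
  have /choice[D hD] : forall j, exists C, forall w, `|V w j| <= C.
    by move=> j; have [_ [C hC]] := bV j; exists C.
  exists (\big[Num.max/0]_j D j) => w j; apply: le_trans (hD j w) _.
  exact: le_bigmax.
have mV j S : measurable S -> <<s G n >> ((fun w => V w j) @^-1` S).
  move=> mS.
  have mVj : measurable_fun [set: g_sigma_algebraType (G n)] (fun w => V w j).
    apply: measurable_sum => i _ A mA; rewrite setTI.
    exact: (mX i n j A (ltn_ord i) (ltnSn n)).
  by have := mVj measurableT S mS; rewrite setTI.
apply/ler_addgt0Pr => e e0.
have dl0 : 0 < e / 4 by rewrite divr_gt0.
have e2 : e / 2 = 2 * (e / 4) by field.
(* A coordinate error of [e / 4] moves [Psi] by at most [e / 2]. This is paid twice: in [step1] to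
   make the past finite-valued, in [Fups] to restore the true past. *)
have [K [kap [v [mkap hv]]]] := finite_valued_approximation dl0 hC mV.
have mk k : measurable (kap @^-1` [set k]).
  by apply: sub_sigma_measurable (mkap k); exact: mG.
pose Phi k w := Psi (fun j => (v0 j + v k j) + X n w j).
have bPhi k : bmeas (Phi k).
  by apply: bPsi => j; apply: bmeasD => //; exact: bmeas_cst.
have sum_kap (f : K -> R) w : \sum_k \1_(kap @^-1` [set k]) w * f k = f (kap w).
  rewrite (bigD1 (kap w))//= big1 ?addr0; last first.
    move=> k kw; rewrite indicE memNset ?mul0r// /= => h'.
    by rewrite h' eqxx in kw.
  by rewrite indicE mem_set// mul1r.
have b1 k : bmeas (\1_(kap @^-1` [set k]) : Om -> R) by exact: bmeas_indic.
have step1 : Ex (fun w => Psi (fun j => v0 j + \sum_(i < n.+1) X i w j)) <=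
    \sum_k Ex (fun w => \1_(kap @^-1` [set k]) w * Phi k w) + e / 2.
  rewrite -Ex_sum; last by move=> k _; exact: bmeasM.
  rewrite -[X in _ + X](Ex_cst P) -ExD; last 2 first.
  - by apply: bmeas_sum => k _; exact: bmeasM.
  - exact: bmeas_cst.
  apply: le_Ex.
  - apply: bPsi => j; apply: bmeasD; first exact: bmeas_cst.
    by apply: bmeas_sum => i _; exact: bX.
  - apply: bmeasD; last exact: bmeas_cst.
    by apply: bmeas_sum => k _; exact: bmeasM.
  move=> w; rewrite (sum_kap (fun k => Phi k w)) e2; apply: lipPsi; [exact: ltW|move=> j].
  rewrite big_ord_recr /=; have := hv w j; rewrite /V; congr (`|_| <= _); ring.
have step2 := htau n (ltnSn n) K kap (fun k j => v0 j + v k j) mkap.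
rewrite sumrB in step2.
pose F w := \sum_k fine (P (kap @^-1` [set k])) * Phi k w.
have bF : bmeas F by apply: bmeas_sum => k _; exact: bmeasZ.
have step3 : \sum_k fine (P (kap @^-1` [set k])) * Ex (Phi k) = Ex F.
  by rewrite Ex_sum; [apply: eq_bigr => k _; rewrite ExZ|move=> k _; exact: bmeasZ].
(* The last block is frozen at [w'] while the past is averaged over [w]: the independent copy is
   just a second variable, without a product space. The induction hypothesis applies at fixed [w'],
   and its exponential bound is then integrated over [w']. *)
have FE w' : F w' = Ex (fun w => Phi (kap w) w').
  rewrite (_ : (fun w => _) = fun w => \sum_k Phi k w' * \1_(kap @^-1` [set k]) w).
    rewrite Ex_sum; last by move=> k _; exact: bmeasZ.
    by apply: eq_bigr => k _; rewrite ExZ// Ex_indic// mulrC.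
  apply/funext => w; rewrite -(sum_kap (fun k => Phi k w')).
  by apply: eq_bigr => k _; rewrite mulrC.
pose Q t := \prod_(i < n) mu t i.
pose ups w' := c0 + \sum_t c t * Q t *
   expR (lam t * ((v0 (j1 t) + X n w' (j1 t)) - (v0 (j2 t) + X n w' (j2 t))))
   + \sum_(i < n) tau i + e / 2.
have Fups w' : F w' <= ups w'.
  rewrite FE; apply: le_trans (_ : Ex (fun w => Psi (fun j => (v0 j + X n w' j) + V w j)) + e / 2 <= _); last first.
    by rewrite lerD2r; exact: (IHn (fun j => v0 j + X n w' j)).
  have bb : bmeas (fun w => Psi (fun j => (v0 j + X n w' j) + V w j)).
    by apply: bPsi => j; apply: bmeasD => //; exact: bmeas_cst.
  rewrite -[X in _ + X](Ex_cst P) -ExD//; last exact: bmeas_cst.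
  apply: le_Ex.
  - rewrite (_ : (fun w => _) = fun w => \sum_k Phi k w' * \1_(kap @^-1` [set k]) w).
      by apply: bmeas_sum => k _; exact: bmeasZ.
    apply/funext => w; rewrite -(sum_kap (fun k => Phi k w')).
    by apply: eq_bigr => k _; rewrite mulrC.
  - by apply: bmeasD => //; exact: bmeas_cst.
  move=> w; rewrite e2; apply: lipPsi; [exact: ltW|move=> j].
  rewrite -normrN; have := hv w j; congr (`|_| <= _); ring.
pose W t w := expR (lam t * (X n w (j1 t) - X n w (j2 t))).
have bW t : bmeas (W t).
  apply: bmeas_expR; apply: bmeasZ; apply: bmeasB; exact: bX.
have upsE w' : ups w' = (c0 + \sum_(i < n) tau i + e / 2) +
   \sum_t (c t * Q t * expR (lam t * (v0 (j1 t) - v0 (j2 t)))) * W t w'.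
  rewrite /ups -!addrA; congr (_ + _); rewrite addrCA; congr (_ + _).
  rewrite addrC; congr (_ + _); apply: eq_bigr => t _.
  by rewrite /W -[RHS]mulrA -expRD; congr (_ * expR _); ring.
have bups : bmeas ups.
  rewrite (_ : ups = fun w' => (c0 + \sum_(i < n) tau i + e / 2) +
   \sum_t (c t * Q t * expR (lam t * (v0 (j1 t) - v0 (j2 t)))) * W t w').
    apply: bmeasD; first exact: bmeas_cst.
    by apply: bmeas_sum => t _; exact: bmeasZ.
  by apply/funext => w; exact: upsE.
have Q0 t : 0 <= Q t.
  apply: prodr_ge0 => i _; apply: le_trans (hmu i t (ltnW (ltn_ord i))).
  by apply: Ex_ge0 => w; exact: expR_ge0.
have step4 : Ex F <= c0 + \sum_(i < n) tau i + e / 2 +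
   \sum_t c t * \prod_(i < n.+1) mu t i * expR (lam t * (v0 (j1 t) - v0 (j2 t))).
  apply: le_trans (le_Ex _ bF bups Fups) _.
  rewrite (_ : ups = fun w' => (c0 + \sum_(i < n) tau i + e / 2) +
   \sum_t (c t * Q t * expR (lam t * (v0 (j1 t) - v0 (j2 t)))) * W t w'); last first.
    by apply/funext => w; exact: upsE.
  rewrite ExD; [|exact: bmeas_cst|by apply: bmeas_sum => t _; exact: bmeasZ].
  rewrite Ex_cst lerD2l Ex_sum; last by move=> t _; exact: bmeasZ.
  apply: ler_sum => t _; rewrite ExZ// big_ord_recr /= -/(Q t).
  rewrite -mulrA [expR _ * _]mulrC !mulrA ler_wpM2r ?expR_ge0//.
  rewrite ler_wpM2l// ?mulr_ge0//.
  exact: (hmu n t (ltnSn n)).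
rewrite big_ord_recr /=.
move: step1 step2 step4; rewrite -step3 /Phi; lra.
Qed.

End decoupling.

(** * Chaining *)

Section mgf.
Context (R : realType) (dO : measure_display) (Om : measurableType dO)
  (P : probability Om R).
Local Notation Ex := (Ex P).

(** Squaring [expR (x / 2) * (1 - x / 2) <= 1] reduces the claim to a polynomial inequality, whose
    defect factors as [x ^+ 2 / 4 * ((1 - x) * (5 - 2 * x))]. *)
Lemma expR_le_quadratic (x : R) : x <= 1 -> expR x <= 1 + x + 2 * x ^+ 2.
Proof.
move=> x1.
have h : expR x * (1 - x / 2) ^+ 2 <= 1.
  rewrite [in expR x](_ : x = x / 2 + x / 2); last by field.
  rewrite expRD -expr2 -exprMn.
  have : expR (x / 2) * (1 - x / 2) <= 1.
    rewrite -[leRHS](expRxMexpNx_1 (x / 2)) ler_wpM2l ?expR_ge0//.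
    exact: expR_ge1Dx.
  have : 0 <= expR (x / 2) * (1 - x / 2) by rewrite mulr_ge0 ?expR_ge0//; lra.
  by move=> ? ?; rewrite exprn_ile1.
have d0 : 0 < (1 - x / 2) ^+ 2 by rewrite exprn_gt0//; lra.
rewrite -(ler_pM2r d0); apply: le_trans h _.
rewrite -subr_ge0 (_ : _ - _ = x ^+ 2 / 4 * ((1 - x) * (5 - 2 * x))); last by field.
by rewrite mulr_ge0 ?divr_ge0 ?sqr_ge0// mulr_ge0//; lra.
Qed.

Lemma mgf_le (Y : Om -> R) (b lam : R) : bmeas Y -> Ex Y = 0 ->
  (forall w, `|Y w| <= b) -> `|lam| * b <= 1 ->
  Ex (fun w => expR (lam * Y w)) <= expR (2 * lam ^+ 2 * Ex (fun w => Y w ^+ 2)).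
Proof.
move=> bY EY Yb lb.
have bY2 : bmeas (fun w => Y w ^+ 2) by exact: bmeasM.
apply: le_trans (_ : Ex (fun w => 1 + (lam * Y w + 2 * lam ^+ 2 * Y w ^+ 2)) <= _).
  apply: le_Ex.
  - by apply: bmeas_expR; exact: bmeasZ.
  - apply: bmeasD; first exact: bmeas_cst.
    by apply: bmeasD; exact: bmeasZ.
  move=> w; apply: le_trans (expR_le_quadratic _) _.
    rewrite (le_trans (ler_norm _))// normrM (le_trans _ lb)// ler_wpM2l//.
  by rewrite exprMn addrA mulrA.
rewrite ExD; [|exact: bmeas_cst|by apply: bmeasD; exact: bmeasZ].
rewrite ExD; [|exact: bmeasZ..].
rewrite Ex_cst !ExZ// EY mulr0 add0r; exact: expR_ge1Dx.
Qed.

Lemma bmeas_bigmax (I : finType) (A : pred I) (Y : I -> Om -> R) :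
  (forall i, bmeas (Y i)) -> bmeas (fun w => \big[Num.max/0]_(i | A i) Y i w).
Proof.
move=> bY; elim: (index_enum I) => [|i s IHs].
  by under eq_fun do rewrite big_nil; exact: bmeas_cst.
case: (boolP (A i)) => Ai.
  by under eq_fun do rewrite big_cons Ai; exact: bmeas_max.
by under eq_fun do rewrite big_cons (negbTE Ai).
Qed.

End mgf.

(** * Maxima over finite families of chains *)

Section chaining.
Context (R : realType) (L Q : nat).
Local Notation J := ('I_L.+1 * 'I_Q)%type.
Implicit Types v : J -> R.

Definition lower (l : 'I_L) (k : 'I_Q) : J := (widen_ord (leqnSn L) l, k).
Definition upper (l : 'I_L) (k : 'I_Q) : J := (lift ord0 l, k).

(** Only the two endpoints enter, although a chain records all levels: the intermediate ones matter
    for the exponential majorant alone. *)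
Definition chain_max (A : pred {ffun 'I_L.+1 -> 'I_Q}) v : R :=
  \big[Num.max/0]_(ch | A ch) `|v (ord_max, ch ord_max) - v (ord0, ch ord0)|.

Lemma chain_max_lip A v v' (dl : R) : 0 <= dl ->
  (forall j, `|v j - v' j| <= dl) ->
  chain_max A v <= chain_max A v' + 2 * dl.
Proof.
move=> dl0 hdl.
have cm0 : 0 <= chain_max A v' by exact: bigmax_ge_id.
apply: bigmax_le => [|ch Ach]; first by rewrite addr_ge0// mulr_ge0.
have := @le_bigmax_cond _ _ _ 0 ch A
  (fun ch => `|v' (ord_max, ch ord_max) - v' (ord0, ch ord0)|) Ach.
rewrite -/(chain_max A v') => h; apply: le_trans (lerD h (lexx _)).
have h1 := hdl (ord_max, ch ord_max); have h2 := hdl (ord0, ch ord0).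
have -> : v (ord_max, ch ord_max) - v (ord0, ch ord0) =
  (v' (ord_max, ch ord_max) - v' (ord0, ch ord0)) +
  ((v (ord_max, ch ord_max) - v' (ord_max, ch ord_max)) -
   (v (ord0, ch ord0) - v' (ord0, ch ord0))) by ring.
apply: le_trans (ler_normD _ _) _; rewrite lerD2l.
apply: le_trans (ler_normB _ _) _; rewrite mulrDl mul1r; exact: lerD.
Qed.

Definition low_idx (ch : {ffun 'I_L.+1 -> 'I_Q}) (l : 'I_L) : 'I_Q :=
  ch (widen_ord (leqnSn L) l).
Definition up_idx (ch : {ffun 'I_L.+1 -> 'I_Q}) (l : 'I_L) : 'I_Q :=
  ch (lift ord0 l).

Lemma chain_telescope v (ch : {ffun 'I_L.+1 -> 'I_Q}) :
  v (ord_max, ch ord_max) - v (ord0, ch ord0) =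
  \sum_(l < L) (v (upper l (up_idx ch l)) - v (lower l (low_idx ch l))).
Proof.
pose u (l : nat) := v (inord l, ch (inord l)).
have -> : ord_max = inord L :> 'I_L.+1 by apply/val_inj; rewrite /= inordK.
have -> : ord0 = inord 0 :> 'I_L.+1 by apply/val_inj; rewrite /= inordK.
rewrite -/(u L) -/(u 0%N) -(telescope_sumr u (leq0n L)) big_mkord.
apply: eq_bigr => l _; rewrite /u /upper /lower /up_idx /low_idx.
have -> : lift ord0 l = inord l.+1 :> 'I_L.+1.
  by apply/val_inj; rewrite /= inordK// ltnS ltn_ord.
have -> : widen_ord (leqnSn L) l = inord l :> 'I_L.+1.
  by apply/val_inj; rewrite /= inordK// ltnW// ltnS ltn_ord.
by [].
Qed.

Variables (nn : nat -> nat) (wt : 'I_L -> 'I_Q -> 'I_Q -> R) (S : R).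
Hypothesis wt0 : forall l k k', 0 < wt l k k'.
Hypothesis S0 : 0 <= S.

Definition valid (l : 'I_L) (k k' : 'I_Q) := (k < nn l)%N && (k' < nn l.+1)%N.

Local Notation T := ('I_L * ('I_Q * 'I_Q) * bool)%type.

Definition link_lo (t : T) : J := lower t.1.1 t.1.2.1.
Definition link_up (t : T) : J := upper t.1.1 t.1.2.2.
Definition link_rate (t : T) : R :=
  (-1) ^+ t.2 * (2 ^+ t.1.1 / wt t.1.1 t.1.2.1 t.1.2.2).
(** The exponent 8 splits as 1 + 7: the moment generating functions of a link multiply to at most
    [expR (2 ^+ l)], and the pairs of cells at level [l] number at most [2 ^ (6 * 2 ^ l)], which is
    below [expR (7 * 2 ^+ l)]. The factor [2 ^- l] makes the levels summable. *)
Definition link_coef (t : T) : R :=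
  if valid t.1.1 t.1.2.1 t.1.2.2
  then S * (2 ^- t.1.1 * expR (- (8 * 2 ^+ t.1.1))) else 0.

Lemma link_coef_ge0 t : 0 <= link_coef t.
Proof.
rewrite /link_coef; case: ifP => // _.
by rewrite mulr_ge0// mulr_ge0 ?expR_ge0// invr_ge0 exprn_ge0.
Qed.

(* Each normalised increment is at most [8] plus an exponential moment, which
   makes the maximum over all chains a sum of exponentials of linear forms. *)
Lemma chain_max_le_exp (A : pred {ffun 'I_L.+1 -> 'I_Q}) v :
  (forall ch, A ch -> forall l, (ch l < nn l)%N) ->
  (forall ch, A ch -> \sum_l wt l (low_idx ch l) (up_idx ch l) <= S) ->
  chain_max A v <=
    8 * S + \sum_t link_coef t * expR (link_rate t * (v (link_up t) - v (link_lo t))).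
Proof.
move=> Ann AS.
pose E := \sum_(t : T | valid t.1.1 t.1.2.1 t.1.2.2)
  2 ^- t.1.1 * expR (- (8 * 2 ^+ t.1.1)) *
  expR (link_rate t * (v (link_up t) - v (link_lo t))).
have term0 (t : T) : 0 <= 2 ^- t.1.1 * expR (- (8 * 2 ^+ t.1.1)) *
  expR (link_rate t * (v (link_up t) - v (link_lo t))) :> R.
  by rewrite !mulr_ge0 ?expR_ge0// invr_ge0 exprn_ge0.
have E0 : 0 <= E by exact: sumr_ge0.
have -> : \sum_t link_coef t * expR (link_rate t * (v (link_up t) - v (link_lo t))) = S * E.
  rewrite /E mulr_sumr [RHS]big_mkcond /=; apply: eq_bigr => t _.
  by rewrite /link_coef; case: ifP; rewrite ?mul0r// -mulrA.
rewrite (mulrC 8) -mulrDr.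
apply: bigmax_le => [|ch Ach]; first by rewrite mulr_ge0// addr_ge0.
rewrite chain_telescope; apply: le_trans (ler_norm_sum _ _ _) _.
apply: le_trans (_ : \sum_l wt l (low_idx ch l) (up_idx ch l) * (8 + E) <= _); last first.
  by rewrite -mulr_suml ler_wpM2r ?addr_ge0// AS.
apply: ler_sum => l _.
set k := low_idx ch l; set k' := up_idx ch l; set D := v _ - v _.
have w0 := wt0 l k k'.
rewrite -ler_pdivrMl// mulrC.
set x := `|D| / wt l k k'.
(* The boolean selects the sign for which the exponent is the absolute increment. *)
pose t : T := (l, (k, k'), D < 0).
have vt : valid l k k'.
  by apply/andP; split; [exact: (Ann ch Ach (widen_ord (leqnSn L) l))|exact: (Ann ch Ach (lift ord0 l))].
have p0 : 0 < 2 ^+ l :> R by exact: exprn_gt0.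
have tE : 2 ^- l * expR (- (8 * 2 ^+ l)) * expR (link_rate t * (v (link_up t) - v (link_lo t)))
    = 2 ^- l * expR (2 ^+ l * (x - 8)).
  rewrite -mulrA -expRD; congr (_ * expR _).
  rewrite /link_rate /link_up /link_lo /= -/D /x.
  rewrite normrEsign.
  by field; rewrite gt_eqF.
have : 2 ^- l * expR (2 ^+ l * (x - 8)) <= E.
  rewrite -tE /E (bigD1 t)//= lerDl; exact: sumr_ge0.
move=> h; apply: le_trans (_ : 8 + 2 ^- l * expR (2 ^+ l * (x - 8)) <= _); last by rewrite lerD2l.
(* This is [1 + y <= expR y] at [y = 2 ^+ l * (x - 8)], valid whatever the size of [x]. *)
rewrite -lerBlDl -(ler_pM2l p0) mulrA divff ?gt_eqF// mul1r.
by apply: le_trans (expR_ge1Dx _); rewrite lerDr.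
Qed.

End chaining.

Section chaining_expectation.
Context (R : realType) (dO : measure_display) (Om : measurableType dO)
  (P : probability Om R) (L Q : nat).
Local Notation Ex := (Ex P).
Local Notation J := ('I_L.+1 * 'I_Q)%type.

Lemma card_ord_lt (m : nat) : (#|[pred k : 'I_Q | (k < m)%N]| <= m)%N.
Proof.
rewrite cardE -(size_map val) -[X in (_ <= X)%N](size_iota 0).
apply: uniq_leq_size; first by rewrite (map_inj_uniq val_inj) enum_uniq.
by move=> x /mapP[k]; rewrite mem_enum inE => km ->; rewrite mem_iota.
Qed.

Lemma sum_ord_lt (m : nat) (a : R) : 0 <= a ->
  \sum_(k < Q) (if (k < m)%N then a else 0) <= m%:R * a.
Proof.
move=> a0; rewrite -big_mkcond /= sumr_const -[leLHS]mulr_natl ler_wpM2r// ler_nat.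
exact: card_ord_lt.
Qed.

Lemma exp2_le_expR (k : nat) : 2 ^+ k <= expR k%:R :> R.
Proof.
rewrite -[k%:R]mulr1 expRM_natl lerXn2r ?nnegrE ?expR_ge0//.
by apply: le_trans (expR_ge1Dx 1); lra.
Qed.

Lemma geometric_half_sum (n : nat) : \sum_(l < n) 2 ^- l <= 2 :> R.
Proof.
suff -> : \sum_(l < n) 2 ^- l = 2 - 2 * 2 ^- n :> R.
  by rewrite gerBl mulr_ge0// invr_ge0 exprn_ge0.
elim: n => [|n IHn]; first by rewrite big_ord0 expr0 invr1; ring.
by rewrite big_ord_recr /= IHn exprS invfM; field.
Qed.

(** The two parts of [wt] calibrate the rate [2 ^+ l / wt]: the part in [b] keeps the rate times the
    increment below 1, the range of [mgf_le], and the part in [sg] keeps the accumulated variance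
    exponent below [2 ^+ l]. *)
Lemma chain_expectation (X : nat -> Om -> J -> R) (G : nat -> set (set Om))
    (tau : nat -> R) (n : nat) (nn : nat -> nat) (sg b : 'I_L -> 'I_Q -> 'I_Q -> R)
    (S : R) (A : pred {ffun 'I_L.+1 -> 'I_Q}) :
  let wt (l : 'I_L) (k k' : 'I_Q) : R := 2 * 2 `^ (l%:R / 2) * sg l k k' + 2 ^+ l * b l k k' in
  0 <= S ->
  (forall l k k', 0 < b l k k') -> (forall l k k', 0 <= sg l k k') ->
  (forall l, (nn l)%:R <= 2 ^+ (2 ^ l.+1) :> R) ->
  (forall ch, A ch -> forall l, (ch l < nn l)%N) ->
  (forall ch, A ch -> \sum_(l < L) wt l (low_idx ch l) (up_idx ch l) <= S) ->
  (forall i j, bmeas (fun w => X i w j)) ->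
  (forall i j, Ex (fun w => X i w j) = 0) ->
  (forall i l k k' w, (i < n)%N -> valid nn l k k' ->
     `|X i w (upper l k') - X i w (lower l k)| <= b l k k') ->
  (forall l k k', valid nn l k k' ->
     \sum_(i < n) Ex (fun w => (X i w (upper l k') - X i w (lower l k)) ^+ 2)
       <= sg l k k' ^+ 2) ->
  (forall i, (i < n)%N -> G i `<=` measurable) ->
  (forall l i j U, (l < i)%N -> (i < n)%N -> measurable U ->
     <<s G i >> ((fun w => X l w j) @^-1` U)) ->
  (forall i, (i < n)%N -> forall (K : finType) (kap : Om -> K) (v : K -> J -> R),
     (forall k, <<s G i >> (kap @^-1` [set k])) ->
     \sum_k (Ex (fun w => \1_(kap @^-1` [set k]) w *
                            chain_max A (fun j => v k j + X i w j))
       - fine (P (kap @^-1` [set k])) * Ex (fun w => chain_max A (fun j => v k j + X i w j)))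
     <= tau i) ->
  Ex (fun w => chain_max A (fun j => \sum_(i < n) X i w j)) <=
    12 * S + \sum_(i < n) tau i.
Proof.
move=> wt S0 b0 sg0 hnn Ann AS bX cX hb hvar mG mX htau.
have pw l : 0 <= 2 `^ (l%:R / 2) :> R by exact: powR_ge0.
have w0 l k k' : 0 < wt l k k'.
  by rewrite /wt ltr_wpDl// ?mulr_ge0// mulr_gt0// exprn_gt0.
have bPsi (Y : Om -> J -> R) : (forall j, bmeas (fun w => Y w j)) ->
    bmeas (fun w => chain_max A (Y w)).
  by move=> bY; apply: bmeas_bigmax => ch; apply: bmeas_norm; exact: bmeasB.
pose mu t i := Ex (fun w => expR (link_rate wt t * (X i w (link_up t) - X i w (link_lo t)))).
have := @decoupling_bound R dO Om P J _ (chain_max A) X G tau (8 * S)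
  (link_coef nn S) (link_rate wt) (@link_up L Q) (@link_lo L Q) mu n
  (chain_max_lip A) bPsi (fun v => chain_max_le_exp w0 S0 v Ann AS)
  (link_coef_ge0 nn S0) bX (fun i t _ => lexx _) mG mX htau (fun=> 0).
under eq_fun => w do under [X in chain_max A X]eq_fun => j do rewrite add0r.
move=> h; apply: le_trans h _; rewrite lerD2r.
(* 8 is the deterministic part of [chain_max_le_exp]; of the factors 2, one counts the signs and the
   other bounds the sum of the [2 ^- l]. *)
rewrite (_ : 12 * S = 8 * S + S * 2 * 2); last by ring.
rewrite lerD2l.
pose al (l : 'I_L) : R := S * (2 ^- l * expR (- (7 * 2 ^+ l))).
have al0 l : 0 <= al l by rewrite !mulr_ge0 ?expR_ge0// invr_ge0 exprn_ge0.
apply: le_trans (_ : \sum_(t : 'I_L * ('I_Q * 'I_Q) * bool)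
   (if valid nn t.1.1 t.1.2.1 t.1.2.2 then al t.1.1 else 0) <= _).
  apply: ler_sum => -[[l [k k']] s] _; rewrite subrr mulr0 expR0 mulr1.
  rewrite /link_coef /=; case: ifP => [vl|_]; last by rewrite mul0r.
  set la : R := 2 ^+ l / wt l k k'.
  have la0 : 0 <= la by rewrite divr_ge0 ?exprn_ge0// ltW.
  have muE i : (i < n)%N -> mu (l, (k, k'), s) i <=
      expR (2 * la ^+ 2 * Ex (fun w => (X i w (upper l k') - X i w (lower l k)) ^+ 2)).
    move=> ilt; rewrite /mu /link_rate /link_up /link_lo /= -/la.
    have -> : la ^+ 2 = ((-1) ^+ s * la) ^+ 2 by rewrite [RHS]exprMn sqrr_sign mul1r.
    apply: (@mgf_le _ _ _ _ _ (b l k k')).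
    - exact: bmeasB.
    - by rewrite ExB// !cX subrr.
    - by move=> w; exact: hb.
    - rewrite normrM normr_sign mul1r ger0_norm// /la mulrAC ler_pdivrMr// mul1r.
      by rewrite /wt lerDr !mulr_ge0.
  have prodE : \prod_(i < n) mu (l, (k, k'), s) i <= expR (2 ^+ l).
    apply: le_trans (_ : \prod_(i < n) expR (2 * la ^+ 2 * Ex (fun w => (X i w (upper l k') - X i w (lower l k)) ^+ 2)) <= _).
      apply: ler_prod => i _; rewrite muE// andbT.
      by apply: Ex_ge0 => w; exact: expR_ge0.
    rewrite -expR_sum ler_expR -mulr_sumr.
    apply: le_trans (ler_wpM2l _ (hvar _ _ _ vl)) _; first by rewrite mulr_ge0// sqr_ge0.
    have sgla : 2 * 2 `^ (l%:R / 2) * sg l k k' * la <= 2 ^+ l.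
      rewrite /la mulrA ler_pdivrMr// mulrC ler_wpM2l ?exprn_ge0//.
      by rewrite /wt lerDl mulr_ge0 ?exprn_ge0// ltW.
    have pp : 2 `^ (l%:R / 2) ^+ 2 = 2 ^+ l :> R.
      by rewrite -powR_mulrn// -powRrM divfK// powR_mulrn.
    have sg1 : 0 <= 2 * 2 `^ (l%:R / 2) * sg l k k' by rewrite !mulr_ge0.
    have sg2 : 0 <= 2 * 2 `^ (l%:R / 2) * sg l k k' * la by exact: mulr_ge0.
    have := ler_pM sg2 sg2 sgla sgla.
    move: la la0 {sgla sg2 muE} => la la0.
    have -> (u : R) : u * u = u ^+ 2 by [].
    rewrite !exprMn.
    rewrite pp.
    have p0 : 0 < 2 ^+ l :> R by exact: exprn_gt0.
    move=> h1; rewrite -(ler_pM2l p0); apply: le_trans h1.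
    have : 0 <= 2 ^+ l * (la ^+ 2 * sg l k k' ^+ 2) by rewrite !mulr_ge0 ?sqr_ge0// ltW.
    nra.
  rewrite /al -!mulrA ler_wpM2l// ler_wpM2l ?invr_ge0 ?exprn_ge0//.
  apply: le_trans (ler_wpM2l (expR_ge0 _) prodE) _.
  rewrite -expRD ler_expR; lra.
rewrite -(pair_bigA _ (fun p s => if valid nn p.1 p.2.1 p.2.2 then al p.1 else 0)) /=.
rewrite -(pair_bigA _ (fun l q => \sum_(s : bool) if valid nn l q.1 q.2 then al l else 0)) /=.
apply: le_trans (_ : \sum_(l < L) S * 2 * 2 ^- l <= _); last first.
  by rewrite -mulr_sumr ler_wpM2l ?mulr_ge0// geometric_half_sum.
apply: ler_sum => l _.
rewrite -(pair_bigA _ (fun k k' => \sum_(s : bool) if valid nn l k k' then al l else 0)) /=.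
apply: le_trans (_ : \sum_(k < Q) (if (k < nn l)%N then (nn l.+1)%:R * (2 * al l) else 0) <= _).
  apply: ler_sum => k _; rewrite /valid.
  case: ltnP => _ /=; last by rewrite big1// => k' _; rewrite big1.
  apply: le_trans (sum_ord_lt (nn l.+1) _); last by rewrite mulr_ge0.
  apply: ler_sum => k' _; rewrite big_bool /=; case: (k' < _)%N; lra.
apply: le_trans (sum_ord_lt (nn l) _) _; first by rewrite !mulr_ge0.
rewrite mulrA -natrM.
have nn2 : (nn l * nn l.+1)%:R <= expR (7 * 2 ^+ l) :> R.
  rewrite natrM; apply: le_trans (ler_pM _ _ (hnn l) (hnn l.+1)) _ => //.
  rewrite -exprD; apply: le_trans (exp2_le_expR _) _; rewrite ler_expR.
  rewrite natrD !natrX !exprS.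
  have : 0 <= 2 ^+ l :> R by rewrite exprn_ge0.
  lra.
rewrite /al (_ : _ * _ = (nn l * nn l.+1)%:R * expR (- (7 * 2 ^+ l)) * (S * 2 * 2 ^- l)); last by ring.
rewrite ler_piMl ?mulr_ge0// ?invr_ge0 ?exprn_ge0//.
by rewrite expRN ler_pdivrMr ?expR_gt0// mul1r.
Qed.

End chaining_expectation.

(** * Mixing and block variances *)

Section lambda_comparison.
Context (R : realType).

Definition holder_exp (p : \bar R) : R := if p is r%:E then 1 - r^-1 else 1.

Lemma Lambda_sum_le_sharp (p : \bar R) (d : R) (q : nat) (al : \bar R -> R) :
  (1 < p)%E -> 1 <= d -> (0 < q)%N -> (forall rho, 0 <= al rho <= 2) ->
  Lambda_sum p d q al <= 8 * Lambda_sharp p d q al.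
Proof.
move=> p1 d1 q0 hal; rewrite /Lambda_sum /Lambda_sharp.
set L := (Num.truncn _).+1.
rewrite -/(holder_exp p).
set e1 := (if p is r%:E then (1 + r) / r else 1).
set e2 := (if p is r%:E then r / (r - 1) else 1).
have q1 : 1 <= q%:R :> R by rewrite ler1n.
have [e30 e31 e11 e20] : [/\ 0 <= holder_exp p, holder_exp p <= 1, 1 <= e1 & 0 <= e2].
  rewrite /holder_exp /e1 /e2 {e1 e2}; case: p p1 => [r|_|//]; last by split; lra.
  rewrite lte_fin => r1.
  have r0 : 0 < r by lra.
  have rV0 : 0 < r^-1 by rewrite invr_gt0.
  have rV1 : r^-1 <= 1 by rewrite invf_le1//; lra.
  split; [lra|lra| |].
    by rewrite ler_pdivlMr//; lra.
  by rewrite divr_ge0//; lra.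
pose S (u : R) : R := \sum_(0 <= rho < L.+1) (u <= al rho%:R%:E)%R%:R.
pose I := \int[lebesgue_measure]_(u in `[0, 1]%classic) (S u `^ e2).
have S0 u : 0 <= S u by apply: sumr_ge0.
have SL u : S u <= L.+1%:R.
  rewrite /S big_mkord.
  rewrite -[X in _ <= X%:R](card_ord L.+1) -sum1_card natr_sum.
  by apply: ler_sum => i _; rewrite lern1 leq_b1.
have mS : measurable_fun setT S.
  rewrite /S; under eq_fun do rewrite big_mkord.
  apply: measurable_sum => i.
  rewrite (_ : (fun u => _) = \1_[set u : R | u <= al (i : nat)%:R%:E]); last first.
    apply/funext => u; rewrite indicE; congr _%:R; congr nat_of_bool.
    by apply/idP/idP; rewrite inE.
  apply: measurable_indic.
  have := measurable_itv `]-oo, al (i : nat)%:R%:E]; congr (measurable _).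
have fin0 (a : R) : (lebesgue_measure (`[0%R, a]%classic : set R) < +oo)%E.
  by rewrite lebesgue_measure_itv/=; case: ifP => _; rewrite -?EFinB ltry.
have iS : lebesgue_measure.-integrable `[0, 1]%classic (EFin \o (fun u => S u `^ e2)).
  apply: measurable_bounded_integrable => //.
  - exact: fin0.
  - apply: measurable_funTS; apply: (@measurableT_comp _ _ _ _ _ _ (fun x => x `^ e2)) => //.
  exists (L.+1%:R `^ e2); split; first exact: num_real.
  move=> x Cx u _ /=; apply: le_trans (ltW Cx).
  by rewrite ger0_norm ?powR_ge0// ge0_ler_powR ?nnegrE.
(* Only the term of index [rho] of the inner sum is kept; it is at least 1 on
   [0, al rho / 2], which lies in [0, 1] because [al rho <= 2]. *)
have Ige (rho : nat) : (rho < L.+1)%N -> al rho%:R%:E / 2 <= I.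
  move=> rL; set a := al _ / 2.
  have /andP[a0 a2] := hal rho%:R%:E.
  have aa0 : 0 <= a by rewrite divr_ge0.
  have aa1 : a <= 1 by rewrite /a; lra.
  have sub : (`[0, a]%classic : set R) `<=` `[0, 1]%classic.
    by move=> u /=; rewrite !in_itv/= => /andP[-> ua]; exact: le_trans aa1.
  have -> : a = \int[lebesgue_measure]_(u in `[0, a]%classic) (1 : R).
    have mu_itv : fine (lebesgue_measure (`[0%R, a]%classic : set R)) = a.
      rewrite lebesgue_measure_itv/= lte_fin.
      case: ltP => h; first by rewrite oppr0 adde0.
      by apply/eqP; rewrite eq_le aa0 h.
    by rewrite Rintegral_cst// mul1r; exact: esym mu_itv.
  apply: le_trans (_ : \int[lebesgue_measure]_(u in `[0, a]%classic) (S u `^ e2) <= _).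
    apply: le_Rintegral => //.
    - apply: measurable_bounded_integrable => //.
        exact: fin0.
      exists 1; split; first exact: num_real.
      by move=> x Cx u _ /=; rewrite normr1 ltW.
    - by apply: integrableS iS.
    move=> u; rewrite /= in_itv/= => /andP[u0 ua].
    have S1 : 1 <= S u.
      rewrite /S big_mkord (bigD1 (Ordinal rL))//= (_ : u <= _); last first.
        by apply: le_trans ua _; rewrite /a; lra.
      by rewrite lerDl; exact: sumr_ge0.
    have /(_ 1 (S u)) := ge0_ler_powR e20; rewrite !nnegrE powR1.
    by apply.
  rewrite /I /Rintegral; apply: fine_le.
  - by apply: integrable_fin_num => //; apply: integrableS iS.
  - exact: integrable_fin_num.
  apply: ge0_subset_integral => //.
  - by move/integrableP : iS => [].
  - by move=> u _; rewrite lee_fin powR_ge0.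
have I0 : 0 <= I by apply: le_trans (Ige 0%N isT); rewrite divr_ge0//; have /andP[] := hal 0%:R%:E.
have term (rho : nat) : (rho < L.+1)%N -> al rho%:R%:E `^ holder_exp p <= 2 * I `^ holder_exp p.
  move=> rL; have /andP[a0 a2] := hal rho%:R%:E.
  apply: le_trans (_ : (2 * I) `^ holder_exp p <= _).
    rewrite ge0_ler_powR ?nnegrE ?mulr_ge0//.
    by have := Ige _ rL; lra.
  rewrite powRM// ler_wpM2r ?powR_ge0//.
  by rewrite -[leRHS]powRr1// ler_powR//; lra.
apply: le_trans (_ : \sum_(0 <= rho < L.+1) 2 * I `^ holder_exp p <= _).
  by rewrite !big_mkord; apply: ler_sum => i _; exact: term.
rewrite sumr_const_nat subn0 -[leLHS]mulr_natl.
have L4 : L.+1%:R <= 4 * q%:R `^ e1 :> R.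
  have qd : q%:R `^ d^-1 <= q%:R `^ e1.
    rewrite ler_powR//; apply: le_trans e11; rewrite invf_le1//; lra.
  have qe1 : 1 <= q%:R `^ e1.
    by rewrite -[leLHS](powRr0 q%:R) ler_powR//; lra.
  have tr : (Num.truncn (2 * q%:R `^ d^-1))%:R <= 2 * q%:R `^ d^-1.
    by rewrite truncn_le// mulr_ge0 ?powR_ge0.
  have -> : L.+1%:R = (Num.truncn (2 * q%:R `^ d^-1))%:R + 2 :> R.
    by rewrite -natrD addn2.
  lra.
have I'0 : 0 <= I `^ holder_exp p by exact: powR_ge0.
rewrite -/I; nra.
Qed.

End lambda_comparison.

(** * Moments and covariances from the norms of order 2p *)

Section truncated_moments.
Context (R : realType) (dO dZ : measure_display) (Om : measurableType dO)
  (P : probability Om R) (Zs : measurableType dZ) (Z : {RV P >-> Zs})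
  (h : Zs -> R).
Hypothesis mh : measurable_fun setT h.
Hypothesis bh : bmeas (fun w => h (Z w)).
Local Notation Ex := (Ex P).

Lemma Lnorm_moment (r N : R) : 0 < r -> 0 < N ->
  ('N[distribution P Z]_r%:E[EFin \o h] <= N%:E)%E ->
  bmeas (fun w => `|h (Z w)| `^ r) /\ Ex (fun w => `|h (Z w)| `^ r) <= N `^ r.
Proof.
move=> r0 N0 hN.
have br : bmeas (fun w => `|h (Z w)| `^ r).
  have [mY [C hC]] := bmeas_norm bh; split.
    apply: (@measurableT_comp _ _ _ _ _ _ (fun x => x `^ r)) => //.
  exists (C `^ r) => w; rewrite ger0_norm ?powR_ge0//.
  have := hC w; rewrite normr_id => hw.
  by rewrite ge0_ler_powR ?nnegrE ?(ltW r0)// (le_trans _ hw).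
split => //; rewrite -lee_fin -bmeas_ExE// unlock.
have : ('N[distribution P Z]_r%:E[EFin \o h] `^ r <= (N `^ r)%:E)%E.
  have r0' := ltW r0.
  rewrite -poweR_EFin gt0_ler_poweR//.
  - by rewrite in_itv/= leey Lnorm_ge0.
  - by rewrite in_itv/= leey lee_fin ltW.
rewrite poweR_Lnorm ?gt_eqF// ge0_integral_distribution.
- by apply: le_trans; rewrite le_eqVlt; apply/orP; left; apply/eqP/eq_integral.
- apply: (@measurableT_comp _ _ _ _ _ _ (fun x => poweR x r)).
    exact: measurable_poweR.
  by apply: measurableT_comp => //; exact/measurable_EFinP.
- by move=> y; exact: poweR_ge0.
Qed.

(** Where [|Y| > c], the square of [Y] is at most [|Y|]^ (2 * r) * c [^ (2 - 2 * r)]. For [p = +oo]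
    the tail is almost surely zero once [c] reaches the essential bound [N]. *)
Lemma tail_moment (p : \bar R) (c N T : R) : (1 <= p)%E -> 0 < c -> 0 < N ->
  ('N[distribution P Z]_(2%:E * p)[EFin \o h] <= N%:E)%E ->
  (if p is r%:E then N `^ (2 * r) <= T * c `^ (2 * r - 2) else N <= c) ->
  0 <= T ->
  Ex (fun w => (c < `|h (Z w)|)%R%:R * (h (Z w) * h (Z w))) <= T.
Proof.
case: p => [r|_|//]; last first.
  move=> c0 N0; rewrite gt0_muley// => hN Nc T0.
  have Yae : {ae P, forall w, `|h (Z w)| <= N}.
    have P1 : (0 < distribution P Z [set: Zs])%E.
      by rewrite [X in (_ < X)%E](_ : _ = 1%E)//; exact: (probability_setT (distribution P Z)).
    move: hN; rewrite unlock /Lnorm; case: ifPn => [_ /ess_supP|/negP/(_ P1)//].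
    move=> [A [mA A0 hA]]; exists (Z @^-1` A); split.
    - by rewrite -[X in measurable X]setTI; exact: measurable_funPT.
    - by rewrite -A0.
    - by move=> w hw; apply: hA => /=; move: hw => /=; rewrite lee_fin.
  suff -> : Ex (fun w => (c < `|h (Z w)|)%R%:R * (h (Z w) * h (Z w))) = Ex (fun=> 0).
    by rewrite Ex_cst.
  apply: ae_eq_Ex; [exact: bmeas_tail|exact: bmeas_cst|].
  apply: filterS Yae => w hw.
  by rewrite ltNge (le_trans hw Nc) mul0r.
rewrite lee_fin => r1 c0 N0; rewrite -EFinM => hN NT T0.
have r20 : 0 < 2 * r by lra.
have [br hr] := Lnorm_moment r20 N0 hN.
have cp : 0 < c `^ (2 * r - 2) by exact: powR_gt0.
rewrite -(ler_pM2r cp); apply: le_trans (le_trans hr NT).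
rewrite mulrC -ExZ; last exact: bmeas_tail.
apply: le_Ex => //; first by apply: bmeasZ; exact: bmeas_tail.
move=> w; case: ltP => hc; last by rewrite mul0r mulr0 powR_ge0.
rewrite mul1r.
have -> : h (Z w) * h (Z w) = `|h (Z w)| `^ 2.
  by rewrite powR_mulrn// -normrX ger0_norm ?sqr_ge0// expr2.
rewrite -[X in _ <= _ `^ X](subrK 2 (2 * r)) [leRHS]powRD; last first.
  by apply/implyP => _; rewrite gt_eqF// (lt_trans c0).
have hc' := ltW hc; have c0' := ltW c0.
rewrite ler_wpM2r ?powR_ge0// ge0_ler_powR ?nnegrE//; lra.
Qed.

(** Cutting at the level [N] itself costs a factor 2 and replaces the comparison of the norms of
    orders 2 and 2p. *)
Lemma second_moment (p : \bar R) (N : R) : (1 <= p)%E -> 0 < N ->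
  ('N[distribution P Z]_(2%:E * p)[EFin \o h] <= N%:E)%E ->
  Ex (fun w => h (Z w) * h (Z w)) <= 2 * N ^+ 2.
Proof.
move=> p1 N0 hN.
have hT : Ex (fun w => (N < `|h (Z w)|)%R%:R * (h (Z w) * h (Z w))) <= N ^+ 2.
  apply: (tail_moment p1 N0 N0 hN); last by rewrite sqr_ge0.
  have N0' := ltW N0.
  case: (p) => // r; rewrite -powR_mulrn// -powRD.
    by rewrite addrC subrK.
  by apply/implyP => _; rewrite gt_eqF.
rewrite mulr_natl mulr2n -[X in X + _](Ex_cst P) in hT *.
apply: le_trans (lerD (lexx _) hT).
rewrite -ExD; [|exact: bmeas_cst|exact: bmeas_tail].
apply: le_Ex; [exact: bmeasM|apply: bmeasD; [exact: bmeas_cst|exact: bmeas_tail]|].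
move=> w; case: ltP => hc; first by rewrite mul1r lerDr sqr_ge0.
rewrite mul0r addr0 -expr2 -real_normK ?num_real// lerXn2r ?nnegrE// ltW//.
Qed.

End truncated_moments.

Section pair_covariance.
Context (R : realType) (dO dZ : measure_display) (Om : measurableType dO)
  (P : probability Om R) (Zs : measurableType dZ) (Z Z' : {RV P >-> Zs})
  (h : Zs -> R) (p : \bar R) (N : R).
Hypothesis mh : measurable_fun setT h.
Hypothesis bh : bmeas (fun w => h (Z w)).
Hypothesis bh' : bmeas (fun w => h (Z' w)).
Hypothesis p1 : (1 <= p)%E.
Hypothesis N0 : 0 < N.
Hypothesis hN : ('N[distribution P Z]_(2%:E * p)[EFin \o h] <= N%:E)%E.
Hypothesis hN' : ('N[distribution P Z']_(2%:E * p)[EFin \o h] <= N%:E)%E.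
Local Notation X := (fun w => h (Z w)).
Local Notation Y := (fun w => h (Z' w)).

Lemma cov_le_moment : `|cov P X Y| <= 2 * N ^+ 2.
Proof.
apply: le_trans (cov_le_sqr _ _ _) _ => //.
have := second_moment mh bh p1 N0 hN; have := second_moment mh bh' p1 N0 hN'.
lra.
Qed.

Lemma cov_le_mixing (al : R) : (1 < p)%E -> 0 <= al ->
  (forall s t, `|fine (P [set w | t <= X w /\ s <= Y w])
       - fine (P [set w | t <= X w]) * fine (P [set w | s <= Y w])| <= al / 2) ->
  `|cov P X Y| <= 7 * (al `^ holder_exp p * N ^+ 2).
Proof.
move=> p1' al0 hal.
(* Tails bounded by [T = al * c ^+ 2] turn [2 * al * c ^+ 2 + 5 * T] into the factor 7. *)
have main c : 0 < c ->
  (if p is r%:E then N `^ (2 * r) <= (al * c ^+ 2) * c `^ (2 * r - 2) else N <= c) ->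
  `|cov P X Y| <= 7 * (al * c ^+ 2).
  move=> c0 hc.
  have T0 : 0 <= al * c ^+ 2 by rewrite mulr_ge0// sqr_ge0.
  have := cov_truncation c0 bh bh' hal (tail_moment mh bh p1 c0 N0 hN hc T0)
    (tail_moment mh bh' p1 c0 N0 hN' hc T0).
  rewrite mulrA; lra.
(* The balancing level would be infinite for [al = 0] and finite [p]. Any level above the bounds of
   both variables then has zero tails and shows that the covariance vanishes. *)
have [al_eq0|aln0] := eqVneq al 0.
  have [_ [C hC]] := bh; have [_ [C' hC']] := bh'.
  pose c := Num.max 1 (Num.max C C').
  have c0 : 0 < c by rewrite lt_max ltr01.
  have tail0 (W : Om -> R) : (forall w, `|W w| <= c) ->
      Ex P (fun w => (c < `|W w|)%R%:R * (W w * W w)) <= 0.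
    move=> hW; rewrite (_ : (fun w => _) = fun=> 0) ?Ex_cst//.
    by apply/funext => w; rewrite ltNge hW mul0r.
  have hX : Ex P (fun w => (c < `|X w|)%R%:R * (X w * X w)) <= 0.
    by apply: tail0 => w; rewrite (le_trans (hC w))// !le_max lexx orbT.
  have hY : Ex P (fun w => (c < `|Y w|)%R%:R * (Y w * Y w)) <= 0.
    by apply: tail0 => w; rewrite (le_trans (hC' w))// !le_max lexx !orbT.
  have := cov_truncation c0 bh bh' hal hX hY.
  rewrite al_eq0 !mulr0 mul0r addr0 => /le_trans; apply.
  by rewrite mulr_ge0// mulr_ge0 ?powR_ge0// sqr_ge0.
have al_gt0 : 0 < al by rewrite lt_neqAle eq_sym aln0.
case pE : p => [r| |]; last 2 first.
- have := main N N0; rewrite pE => /(_ (lexx _)).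
  by rewrite /holder_exp powRr1.
- by move: p1; rewrite pE.
have r1 : 1 < r by move: p1'; rewrite pE lte_fin.
have r0 : 0 < r by lra.
(* This [c] balances [al * c ^+ 2] against the tail moment
   [N `^ (2 * r) * c `^ (2 - 2 * r)], with constants that do not depend on [r]. *)
pose c := N * al `^ (- (2 * r)^-1).
have c0 : 0 < c by rewrite mulr_gt0 ?powR_gt0.
have alc : al * c ^+ 2 = al `^ holder_exp r%:E * N ^+ 2.
  rewrite /c exprMn mulrCA mulrC; congr (_ * _).
  rewrite -powR_mulrn ?powR_ge0// -powRrM -{1}(powRr1 al0) -powRD.
    by rewrite /holder_exp; congr (_ `^ _); field; rewrite gt_eqF.
  by apply/implyP => _; rewrite gt_eqF.
rewrite -alc; apply: main => //; rewrite pE.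
have N0' := ltW N0; have c0' := ltW c0.
rewrite -mulrA -powR_mulrn// -powRD; last by apply/implyP => _; rewrite gt_eqF.
rewrite addrC subrK /c powRM ?powR_ge0// -powRrM.
rewrite mulNr mulVf ?gt_eqF//; last by rewrite mulr_gt0.
by rewrite powR_inv1// mulrCA divff// mulr1.
Qed.

End pair_covariance.

Section mixing_coefficients.
Context (R : realType) (dO dZ : measure_display) (Om : measurableType dO)
  (P : probability Om R) (Zs : measurableType dZ) (N : finType) (e : rel N)
  (Z : N -> {RV P >-> Zs}) (F : set (Zs -> R)).

Let dep (X Y : Om -> R) (s t : R) : R :=
  `| fine (P [set w | t <= X w /\ s <= Y w])
     - fine (P [set w | t <= X w]) * fine (P [set w | s <= Y w])|.

Lemma fine_probability_itv (A : set Om) : measurable A -> 0 <= fine (P A) <= 1.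
Proof.
move=> mA; rewrite fine_ge0//= -lee_fin fineK ?probability_le1//.
exact: fin_num_measure.
Qed.

Let dep_le1 (X Y : Om -> R) s t : measurable_fun setT X -> measurable_fun setT Y ->
  dep X Y s t <= 1.
Proof.
move=> mX mY.
have mXt := measurable_superlevel t mX; have mYs := measurable_superlevel s mY.
have /andP[a0 a1] := fine_probability_itv mXt.
have /andP[b0 b1] := fine_probability_itv mYs.
have /andP[c0 c1] := fine_probability_itv (measurableI _ _ mXt mYs).
rewrite /dep ler_norml; rewrite /setI /= in c0 c1.
by apply/andP; split; nra.
Qed.

Lemma alpha_mix_ub (X Y : Om -> R) s t : measurable_fun setT X -> measurable_fun setT Y ->
  dep X Y s t <= alpha_mix P X Y / 2.
Proof.
move=> mX mY; rewrite /alpha_mix mulrAC divff// mul1r.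
apply: sup_ubound; last by exists s => //; exists t.
by exists 1 => _ [s' _ [t' _ <-]]; exact: dep_le1.
Qed.

Lemma alpha_mix_itv (X Y : Om -> R) : measurable_fun setT X -> measurable_fun setT Y ->
  0 <= alpha_mix P X Y <= 2.
Proof.
move=> mX mY; have := alpha_mix_ub 0 0 mX mY.
have := normr_ge0 (fine (P [set w | 0 <= X w /\ 0 <= Y w])
     - fine (P [set w | 0 <= X w]) * fine (P [set w | 0 <= Y w])).
rewrite /dep => h1 h2; apply/andP; split; first lra.
rewrite /alpha_mix -[leRHS]mulr1 ler_wpM2l//.
apply: ge_sup; first by exists (dep X Y 0 0), 0 => //; exists 0.
by move=> _ [s' _ [t' _ <-]]; exact: dep_le1.
Qed.

Hypothesis mF : forall f, F f -> measurable_fun setT f.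

Lemma measurable_diff_class h : diff_class F h -> measurable_fun setT h.
Proof. by move=> [f Ff [g Fg <-]]; apply: measurable_funB; exact: mF. Qed.

Lemma measurable_diff_comp h i : diff_class F h ->
  measurable_fun setT (fun w => h (Z i w)).
Proof.
move=> /measurable_diff_class mh.
by apply: (measurableT_comp mh); exact: measurable_funP.
Qed.

Lemma alpha_class_itv (B : {set N}) (rho : \bar R) :
  0 <= alpha_class e Z F B rho <= 2.
Proof.
rewrite /alpha_class; case: ifP => _; first by rewrite ler01; lra.
case: ifP => _; first by rewrite lexx; lra.
set S := [set _ | _].
have S02 x : S x -> 0 <= x <= 2.
  by move=> [h [i [j [Fh _ _ _ ->]]]]; apply: alpha_mix_itv; exact: measurable_diff_comp.
have [->|/set0P[x Sx]] := eqVneq S set0; first by rewrite sup0 lexx; lra.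
have /andP[x0 _] := S02 x Sx.
apply/andP; split.
  apply: le_trans x0 _; apply: sup_ubound => //.
  by exists 2 => y /S02/andP[].
by apply: ge_sup; [exists x|move=> y /S02/andP[]].
Qed.

Lemma alpha_class_ub (B : {set N}) (rho : R) h i j : 0 < rho ->
  diff_class F h -> i \in B -> j \in B -> (rho%:E <= gdist R e i j)%E ->
  alpha_mix P (fun w => h (Z i w)) (fun w => h (Z j w)) <=
    alpha_class e Z F B rho%:E.
Proof.
move=> r0 Fh iB jB ij; rewrite /alpha_class eqe gt_eqF//=.
apply: sup_ubound; last by exists h, i, j.
exists 2 => _ [h' [i' [j' [Fh' _ _ _ ->]]]].
have mh k := measurable_diff_comp k Fh'.
by have /andP[] := alpha_mix_itv (mh i') (mh j').
Qed.

End mixing_coefficients.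

(** * Variance of a block sum *)

Section block_variance.
Context (R : realType) (dO dZ : measure_display) (Om : measurableType dO)
  (P : probability Om R) (Zs : measurableType dZ) (N : finType) (e : rel N)
  (Z : N -> {RV P >-> Zs}) (F : set (Zs -> R)) (Cgr d Kb : R) (p : \bar R) (q : nat)
  (B : {set N}).
Hypothesis mF : forall f, F f -> measurable_fun setT f.
Hypothesis d1 : 1 <= d.
Hypothesis q0 : (0 < q)%N.
Hypothesis p1 : (1 <= p)%E.
Hypothesis growth : forall (x : N) (s : R), 1 <= s ->
  #|gsphere e x s|%:R <= Cgr * s `^ (d - 1).
Hypothesis diamB : forall i j, i \in B -> j \in B ->
  (gdist R e i j <= (2 * q%:R `^ d^-1)%:E)%E.
Hypothesis cardB : #|B|%:R <= Kb * q%:R.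
Local Notation Ex := (Ex P).
Local Notation al := (alpha_class e Z F B).

(** Squared contribution of one block to [Lambda]; up to constants and the squared norm, it bounds
    the variance per vertex. *)
Definition Lambda_sq : R := if p == 1%E then q%:R else
  q%:R `^ (1 - d^-1) * Num.min (Lambda_sharp p d q al) (Lambda_sum p d q al).

(** If the set is nonempty, the diameter bound forces [rho <= 2 * q%:R]^ d^-1[, and the growth
    condition turns this radius into]q%:R [^ (1 - d^-1)]. The summand 1 in the constant is for
    [rho = 0]. *)
Lemma sphere_count i (rho : nat) : i \in B ->
  #|[set j in B | gdist R e i j == rho%:R%:E]%SET|%:R <=
    (1 + `|Cgr| * 2 `^ (d - 1)) * q%:R `^ (1 - d^-1).
Proof.
move=> iB; have q1 : 1 <= q%:R :> R by rewrite ler1n.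
have d1' := d1; have d0 : 0 < d by lra.
have dV : d^-1 <= 1 by rewrite invf_le1.
have Q1 : 1 <= q%:R `^ (1 - d^-1).
  by rewrite -[leLHS](powRr0 q%:R) ler_powR//; lra.
have pos : 0 <= `|Cgr| * 2 `^ (d - 1) by rewrite mulr_ge0// powR_ge0.
set A := [set j in B | _]%SET.
have [->|/set0Pn[j]] := eqVneq A finset.set0.
  by rewrite cards0 mulr_ge0 ?powR_ge0// addr_ge0.
rewrite inE => /andP[jB /eqP ij].
have rR : rho%:R <= 2 * q%:R `^ d^-1 by rewrite -lee_fin -ij diamB.
case: rho => [|rho] in A ij rR *.
  apply: le_trans (_ : 1 <= _).
    rewrite (_ : A = [set i]%SET) ?cards1//; apply/setP => k; rewrite !inE.
    apply/andP/eqP => [[_ /eqP/gdist_eq0 ->]//|->]; split=> //.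
    by rewrite gdistxx.
  by rewrite mulrDl mul1r; apply: le_trans Q1 _; rewrite lerDl mulr_ge0// powR_ge0.
apply: le_trans (_ : #|gsphere e i (rho.+1%:R : R)|%:R <= _).
  rewrite ler_nat subset_leq_card//; apply/fintype.subsetP => k.
  by rewrite !inE => /andP[].
apply: le_trans (growth _ _) _; first by rewrite ler1n.
apply: le_trans (_ : `|Cgr| * rho.+1%:R `^ (d - 1) <= _).
  by rewrite ler_wpM2r ?powR_ge0// ler_norm.
have dm : 0 <= d - 1 by lra.
have h2 : rho.+1%:R `^ (d - 1) <= 2 `^ (d - 1) * q%:R `^ (1 - d^-1).
  apply: le_trans (_ : (2 * q%:R `^ d^-1) `^ (d - 1) <= _).
    by rewrite ge0_ler_powR ?nnegrE// mulr_ge0 ?powR_ge0.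
  rewrite powRM ?powR_ge0// -powRrM.
  rewrite (_ : d^-1 * (d - 1) = 1 - d^-1)//.
  by rewrite mulrBr mulr1 mulVf ?gt_eqF.
apply: le_trans (ler_wpM2l (normr_ge0 _) h2) _.
by rewrite mulrA ler_wpM2r ?powR_ge0// lerDr.
Qed.

Variables (h : Zs -> R) (Nn : R).
Hypothesis Fh : diff_class F h.
Hypothesis bh : forall i, bmeas (fun w => h (Z i w)).
Hypothesis Nn0 : 0 < Nn.
Hypothesis hN : forall i, ('N[distribution P (Z i)]_(2%:E * p)[EFin \o h] <= Nn%:E)%E.
Local Notation X i := (fun w => h (Z i w)).

(** 56 is 7 times 8, from [cov_le_mixing] and [Lambda_sum_le_sharp]. The part [2 * Kb] serves
    [p = 1], where every covariance is bounded by moments alone and the block has at most [Kb * q]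
    vertices. *)
Lemma cov_row_sum i : i \in B ->
  \sum_(j in B) `|cov P (X i) (X j)| <=
    (56 * (1 + `|Cgr| * 2 `^ (d - 1)) + 2 * Kb) * (Lambda_sq * Nn ^+ 2).
Proof.
move=> iB; have mh : measurable_fun setT h by exact: measurable_diff_class mF _ Fh.
have K1 : 0 <= 1 + `|Cgr| * 2 `^ (d - 1).
  by rewrite addr_ge0// mulr_ge0// powR_ge0.
have q1 : 1 <= q%:R :> R by rewrite ler1n.
have Kb0 : 0 <= Kb.
  by rewrite -(pmulr_lge0 _ (_ : 0 < q%:R)) ?(lt_le_trans ltr01 q1)// (le_trans _ cardB).
have N2 : 0 <= Nn ^+ 2 by rewrite sqr_ge0.
have [p_eq1|pn1] := eqVneq p 1%E.
  rewrite /Lambda_sq p_eq1 eqxx.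
  apply: le_trans (_ : \sum_(j in B) 2 * Nn ^+ 2 <= _).
    by apply: ler_sum => j _; exact: (cov_le_moment mh (bh i) (bh j) p1 Nn0 (hN i) (hN j)).
  rewrite sumr_const -[leLHS]mulr_natl.
  apply: le_trans (ler_wpM2r _ cardB) _; first by rewrite mulr_ge0.
  rewrite mulrDl -subr_ge0 (_ : _ - _ = 56 * (1 + `|Cgr| * 2 `^ (d - 1)) * (q%:R * Nn ^+ 2)); last by ring.
  apply: mulr_ge0; first exact: mulr_ge0.
  by apply: mulr_ge0 => //; exact: ler0n.
have p1' : (1 < p)%E by rewrite lt_neqAle eq_sym pn1.
rewrite /Lambda_sq (negbTE pn1).
set L := (Num.truncn (2 * q%:R `^ d^-1)).+1.
have e30 : 0 <= holder_exp p.
  rewrite /holder_exp; case: (p) p1 => // r; rewrite lee_fin => r1.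
  have : r^-1 <= 1 by rewrite invf_le1//; lra.
  lra.
have pair j : j \in B -> `|cov P (X i) (X j)| <=
    7 * Nn ^+ 2 * \sum_(0 <= rho < L.+1) (gdist R e i j == rho%:R%:E)%:R * al rho%:R%:E `^ holder_exp p.
  move=> jB; case: (gdist_nat R e i j) => [ijE|[s [_ _ ijE]]].
    by have := diamB iB jB; rewrite ijE.
  have sL : (size s < L.+1)%N.
    have : (size s)%:R <= 2 * q%:R `^ d^-1 by rewrite -lee_fin -ijE diamB.
    by rewrite /L => sR; rewrite ltnS leqW// truncn_ge_nat// mulr_ge0 ?powR_ge0.
  have al0 rho : 0 <= al rho by have /andP[] := alpha_class_itv e Z mF B rho.
  rewrite big_mkord (bigD1 (Ordinal sL))//= ijE eqxx mul1r.
  apply: le_trans (_ : 7 * Nn ^+ 2 * al (size s)%:R%:E `^ holder_exp p <= _); last first.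
    apply: ler_wpM2l; first exact: mulr_ge0.
    rewrite lerDl; apply: sumr_ge0 => k _.
    by rewrite mulr_ge0 ?powR_ge0.
  rewrite -mulrA (mulrC (Nn ^+ 2)).
  (* The empty walk is the diagonal case: alpha at 0 is 1 by convention, so the moment bound with
     factor 2 fits under 7. *)
  case: s ijE {sL} => [|a s] ijE.
    apply: le_trans (cov_le_moment mh (bh i) (bh j) p1 Nn0 (hN i) (hN j)) _.
    rewrite /alpha_class /= eqxx powR1 mul1r; lra.
  apply: cov_le_mixing => // s' t.
  have mX k := measurable_diff_comp Z mF k Fh.
  apply: le_trans (alpha_mix_ub P s' t (mX i) (mX j)) _.
  rewrite ler_pM2r ?invr_gt0//; apply: alpha_class_ub => //.
  by rewrite ijE.
apply: le_trans (ler_sum _ (fun j jB => pair j jB)) _.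
rewrite -mulr_sumr exchange_big /=.
apply: le_trans (_ : 7 * Nn ^+ 2 * \sum_(0 <= rho < L.+1)
   ((1 + `|Cgr| * 2 `^ (d - 1)) * q%:R `^ (1 - d^-1)) * al rho%:R%:E `^ holder_exp p <= _).
  apply: ler_wpM2l; first exact: mulr_ge0.
  apply: ler_sum => rho _.
  rewrite -mulr_suml ler_wpM2r ?powR_ge0//.
  apply: le_trans (sphere_count rho iB).
  rewrite -sum1_card natr_sum big_mkcond [leRHS]big_mkcond.
  by apply: ler_sum => j _; rewrite !inE; case: (j \in B) => //=; case: (_ == _).
rewrite -mulr_sumr -[\sum_(0 <= rho < L.+1) _]/(Lambda_sum p d q al).
have cmp := Lambda_sum_le_sharp p1' d1 q0 (alpha_class_itv e Z mF B).
have sum0 : 0 <= Lambda_sum p d q al.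
  by apply: sumr_ge0 => rho _; exact: powR_ge0.
have hmin : Lambda_sum p d q al <= 8 * Num.min (Lambda_sharp p d q al) (Lambda_sum p d q al).
  by case: (leP (Lambda_sharp p d q al)) => _; [exact: cmp|rewrite ler_peMl// ler1n].
have min0 : 0 <= Num.min (Lambda_sharp p d q al) (Lambda_sum p d q al).
  by rewrite -(@pmulr_rge0 _ 8)// (le_trans sum0 hmin).
have Q0 : 0 <= q%:R `^ (1 - d^-1) by exact: powR_ge0.
move: (q%:R `^ (1 - d^-1)) Q0 (1 + _) K1 hmin min0 => Q Q0 K K0 hmin min0.
apply: le_trans (_ : 7 * Nn ^+ 2 * (K * Q * (8 * Num.min (Lambda_sharp p d q al) (Lambda_sum p d q al))) <= _).
  apply: ler_wpM2l; first exact: mulr_ge0.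
  by apply: ler_wpM2l => //; exact: mulr_ge0.
move: (Num.min _ _) {hmin} min0 => m m0.
rewrite -subr_ge0 (_ : _ - _ = 2 * Kb * (Q * m * Nn ^+ 2)); last by ring.
apply: mulr_ge0; first exact: mulr_ge0.
by apply: mulr_ge0 => //; exact: mulr_ge0.
Qed.

Lemma block_variance :
  Ex (fun w => (\sum_(i in B) (h (Z i w) - Ex (X i))) ^+ 2) <=
    #|B|%:R * ((56 * (1 + `|Cgr| * 2 `^ (d - 1)) + 2 * Kb) * (Lambda_sq * Nn ^+ 2)).
Proof.
have bc i : bmeas (fun w => h (Z i w) - Ex (X i)).
  by apply: bmeasB => //; exact: bmeas_cst.
rewrite (_ : (fun w => _) = fun w => \sum_(i in B) \sum_(j in B)
    (h (Z i w) - Ex (X i)) * (h (Z j w) - Ex (X j))); last first.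
  by apply/funext => w; rewrite expr2 big_distrlr.
rewrite Ex_sum; last by move=> i _; apply: bmeas_sum => j _; exact: bmeasM.
rewrite mulr_natl -sumr_const; apply: ler_sum => i iB.
rewrite Ex_sum; last by move=> j _; exact: bmeasM.
apply: le_trans (cov_row_sum iB).
by apply: ler_sum => j _; rewrite cov_center// ler_norm.
Qed.

End block_variance.

(** * Chains extracted from the Talagrand functionals *)

Section chains_of_partitions.
Context (R : realType) (T : Type).
Implicit Types (f g : T -> R) (F : set (T -> R)).

Lemma admissible_index (s : R) F Tl : 1 <= s -> admissible s F Tl ->
  exists (n : nat -> nat) (idx : nat -> (T -> R) -> nat),
    [/\ forall l, (n l)%:R <= 2 ^+ (2 ^ l) :> R,
        forall l f, F f -> (idx l f < n l)%N,
        forall l f g, F f -> F g -> idx l f = idx l g -> pblock (Tl l) id f g,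
        forall f g, F f -> F g -> idx 0%N f = idx 0%N g
      & forall l f g, F f -> pblock (Tl l.+1) id f g -> pblock (Tl l) id f g].
Proof.
move=> s1 [part nested T0 Tcard].
have blockP l f : F f -> Tl l (pblock (Tl l) id f) /\ pblock (Tl l) id f f.
  move=> Ff; have [cov _ _] := part l.
  have [A TA Af] : cover (Tl l) id f by rewrite cov.
  rewrite /pblock /pblock_index.
  by case: xgetP => [B -> //|/(_ A)]; case.
have block_uniq l f A : F f -> Tl l A -> A f -> A = pblock (Tl l) id f.
  move=> Ff TA Af; have [TB Bf] := blockP l f Ff.
  by have [_ triv _] := part l; apply: triv => //; exists f.
have /choice[n hn] : forall l, exists k, (Tl l #= `I_k)%card /\ k%:R <= 2 ^+ (2 ^ l) :> R.
  case=> [|l]; first by exists 1%N; rewrite expn0 expr1; split => //; lra.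
  have [k Tk kle] := Tcard l.+1 (ltn0Sn l).
  exists k; split => //; apply: le_trans kle _.
  rewrite -powR_mulrn// ler_powR ?ler1n//.
  rewrite natrX -powR_mulrn// ler_powR ?ler1n//.
  by rewrite ler_pdivrMr ?ler_peMr//; lra.
have /choice[phi hphi] : forall l, exists phi, set_bij (Tl l) `I_(n l) phi.
  by move=> l; apply/card_set_bijP; have [] := hn l.
exists n, (fun l f => phi l (pblock (Tl l) id f)); split.
- by move=> l; have [] := hn l.
- move=> l f Ff; have [TA _] := blockP l f Ff.
  by have [fun_phi _ _] := hphi l; exact: (fun_phi _ TA).
- move=> l f g Ff Fg e; have [TA _] := blockP l f Ff; have [TB Bg] := blockP l g Fg.
  have [_ inj_phi _] := hphi l.
  by rewrite (inj_phi _ _ _ _ e) ?inE.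
- move=> f g Ff Fg.
  have n0 : (n 0%N <= 1)%N.
    have [e0 _] := hn 0%N.
    have : (`I_1 #= `I_(n 0%N))%card by apply: card_eq_trans e0; rewrite card_eq_sym.
    by move=> /card_eq_II <-.
  have lt1 h : F h -> phi 0%N (pblock (Tl 0%N) id h) = 0%N.
    move=> Fh; have [TA _] := blockP 0%N h Fh.
    have [fun_phi _ _] := hphi 0%N; have := fun_phi _ TA.
    by rewrite /= => /leq_trans/(_ n0); case: (phi _ _).
  by rewrite !lt1.
- move=> l f g Ff; have [TA Af] := blockP l.+1 f Ff.
  have [A' TA' AA'] := nested l _ TA.
  by move=> /AA'; rewrite (block_uniq l f A' Ff TA' (AA' _ Af)).
Qed.

Lemma diam_fun_ge f g h Q z : pblock Q id f g -> pblock Q id f h ->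
  (`|(g z - h z)%:E| <= diam_fun f Q z)%E.
Proof. by move=> fg fh; apply: ereal_sup_ubound; exists g => //; exists h. Qed.

(** [fine] sends [+oo] to 0, hence can only lower a nonnegative term. *)
Lemma fine_sum_le (L : nat) (w : nat -> R) (x : nat -> \bar R) (G : R) :
  (forall l, 0 <= w l) -> (forall l, (0 <= x l)%E) ->
  (\sum_(0 <= l < L) (w l)%:E * x l <= G%:E)%E ->
  \sum_(0 <= l < L) w l * fine (x l) <= G.
Proof.
move=> w0 x0 h; rewrite -lee_fin; apply: le_trans h.
rewrite -sumEFin; apply: lee_sum => l _.
rewrite EFinM lee_wpmul2l ?lee_fin//.
by case: (x l) (x0 l) => [r| |] //= _; rewrite leey.
Qed.

Lemma gamma_witness (q s : R) F (dd : (T -> \bar R) -> \bar R) (G : R) :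
  (forall u, (0 <= dd u)%E) -> (talagrand_gamma q s F dd < G%:E)%E ->
  exists2 Tl, admissible s F Tl & forall f L, F f ->
    (\sum_(0 <= l < L) (2 `^ (l%:R / q))%:E * dd (diam_fun f (Tl l)) <= G%:E)%E.
Proof.
move=> dd0 /ereal_inf_lt[_ [Tl adm <-] lt].
exists Tl => // f L Ff; apply: le_trans (ltW lt); apply: le_ereal_sup_tmp.
exists (\sum_(0 <= l <oo) (2 `^ (l%:R / q))%:E * dd (diam_fun f (Tl l)))%E.
  by exists f.
by apply: nneseries_lim_ge => l _ _; rewrite mule_ge0// lee_fin powR_ge0.
Qed.

Lemma supnorm_ge0 (u : T -> \bar R) : (exists z : T, True) -> (0 <= supnorm u)%E.
Proof.
by move=> [z _]; apply: le_ereal_sup_tmp; exists `|u z|%E; [exists z|exact: abse_ge0].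
Qed.

Lemma supnorm_ub (u : T -> \bar R) z : (`|u z| <= supnorm u)%E.
Proof. by apply: ereal_sup_ubound; exists z. Qed.

Lemma supnorm_le (u v : T -> \bar R) : (forall z, `|u z| <= `|v z|)%E ->
  (supnorm u <= supnorm v)%E.
Proof.
move=> uv; apply: ge_ereal_sup => _ [z _ <-].
by apply: le_trans (uv z) _; exact: supnorm_ub.
Qed.

Definition link (rep : nat -> nat -> T -> R) (l k k' : nat) : T -> R :=
  fun z => rep l.+1 k' z - rep l k z.

(** The representatives of [f] at levels [l] and [l.+1] lie in the level-[l] cell of [f] for both
    partitions, so a link is bounded by both diameters and one chain serves both sums. Refining
    squares the number of cells, whence [2 ^ l.+1] in the exponent. *)
Lemma gamma_chains F (a b G1 G2 : R) (dd : (T -> \bar R) -> \bar R) (z0 : T) :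
  F (cst 0) -> 1 <= a -> 1 <= b ->
  (forall u, (0 <= dd u)%E) ->
  (forall u v, (forall z, `|u z| <= `|v z|)%E -> (dd u <= dd v)%E) ->
  (talagrand_gamma 2 a F dd < G2%:E)%E ->
  (talagrand_gamma 1 b F (@supnorm R T) < G1%:E)%E ->
  exists (nn : nat -> nat) (idx : nat -> (T -> R) -> nat) (rep : nat -> nat -> T -> R),
    [/\ [/\ forall l, (nn l)%:R <= 2 ^+ (2 ^ l.+1) :> R,
            forall l f, F f -> (idx l f < nn l)%N,
            forall l k, F (rep l k)
          & forall k, rep 0%N k = cst 0],
        forall f L, F f -> \sum_(0 <= l < L) 2 `^ (l%:R / 2) *
          fine (dd (EFin \o link rep l (idx l f) (idx l.+1 f))) <= G2,
        forall f L, F f -> \sum_(0 <= l < L) 2 ^+ l *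
          fine (supnorm (EFin \o link rep l (idx l f) (idx l.+1 f))) <= G1
      & forall l f z, F f -> `|f z - rep l (idx l f) z| <= 2 ^- l * G1].
Proof.
move=> F0 a1 b1 dd0 ddle g2 g1.
have sn0 u : (0 <= @supnorm R T u)%E by apply: supnorm_ge0; exists z0.
have [TA admA sumA] := gamma_witness dd0 g2.
have [TB admB sumB] := gamma_witness sn0 g1.
have [nA [iA [nA2 iAn cellA zeroA nestA]]] := admissible_index a1 admA.
have [nB [iB [nB2 iBn cellB zeroB nestB]]] := admissible_index b1 admB.
(* [idx l] numbers the cells of the common refinement of [TA l] and [TB l]. *)
pose idx l f := (iA l f * nB l + iB l f)%N.
have idx_inj l f g : F f -> F g -> idx l f = idx l g -> iA l f = iA l g /\ iB l f = iB l g.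
  move=> Ff Fg; rewrite /idx => e.
  have e1 := congr1 (fun x => x %% nB l)%N e.
  rewrite /= !modnMDl !modn_small ?iBn// in e1.
  have e2 := congr1 (fun x => x %/ nB l)%N e.
  have nB0 : (0 < nB l)%N by apply: leq_ltn_trans (iBn l f Ff).
  by rewrite /= !divnMDl// !divn_small ?iBn// !addn0 in e2.
pose attained l k f := F f /\ idx l f = k.
(* Starting every chain at 0 is possible because level 0 has one cell, which contains 0. The default
   for unattained indices keeps all representatives in [F]. *)
pose rep l k : T -> R := if l is 0%N then cst 0 else xget (cst 0) (attained l k).
have Frep l k : F (rep l k).
  by case: l => [//|l]; rewrite /rep; case: xgetP => [g -> []|].
have idx_rep l f : F f -> iA l (rep l (idx l f)) = iA l f /\ iB l (rep l (idx l f)) = iB l f.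
  move=> Ff; case: l => [|l].
    by split; [exact: zeroA|exact: zeroB].
  apply: idx_inj => //; rewrite /rep; case: xgetP => [g -> []//|/(_ f)]; case.
  by split.
have inA l f : F f -> pblock (TA l) id f (rep l (idx l f)).
  by move=> Ff; apply: cellA => //; have [-> _] := idx_rep l f Ff.
have inB l f : F f -> pblock (TB l) id f (rep l (idx l f)).
  by move=> Ff; apply: cellB => //; have [_ ->] := idx_rep l f Ff.
have linkA l f z : F f ->
    (`|(EFin \o link rep l (idx l f) (idx l.+1 f)) z| <= `|diam_fun f (TA l) z|)%E.
  move=> Ff; apply: le_trans (lee_abs _); apply: diam_fun_ge; last exact: inA.
  by apply: nestA => //; exact: inA.
have linkB l f z : F f ->
    (`|(EFin \o link rep l (idx l f) (idx l.+1 f)) z| <= `|diam_fun f (TB l) z|)%E.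
  move=> Ff; apply: le_trans (lee_abs _); apply: diam_fun_ge; last exact: inB.
  by apply: nestB => //; exact: inB.
exists (fun l => nA l * nB l)%N, idx, rep; split; first split => //.
- move=> l; rewrite natrM expnS mul2n -addnn exprD; apply: ler_pM => //.
- move=> l f Ff; rewrite /idx.
  have := iAn l f Ff; have := iBn l f Ff => h1 h2.
  apply: (@leq_trans (iA l f * nB l + nB l)); first by rewrite ltn_add2l.
  by rewrite addnC -mulSn leq_mul2r h2 orbT.
- move=> f L Ff; have w0 (l : nat) : 0 <= 2 `^ (l%:R / 2) :> R by exact: powR_ge0.
  apply: (fine_sum_le w0) => //.
  apply: le_trans (sumA f L Ff); apply: lee_sum => l _.
  rewrite lee_wpmul2l ?lee_fin ?powR_ge0//; apply: ddle => z; exact: linkA.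
- move=> f L Ff; have w0 (l : nat) : 0 <= 2 ^+ l :> R by exact: exprn_ge0.
  apply: (fine_sum_le w0) => //.
  apply: le_trans (sumB f L Ff); apply: lee_sum => l _.
  rewrite divr1 powR_mulrn// lee_wpmul2l ?lee_fin ?exprn_ge0//.
  by apply: supnorm_le => z; exact: linkB.
- move=> l f z Ff.
  (* The level-[l] term alone bounds [2 ^+ l] times the distance from [f] to its representative,
     since both lie in the same cell. *)
  have := sumB f l.+1 Ff; rewrite big_nat_recr//= => h.
  have {}h : ((2 ^+ l)%:E * supnorm (diam_fun f (TB l)) <= G1%:E)%E.
    apply: le_trans h; rewrite divr1 powR_mulrn// leeDr//.
    by apply: sume_ge0 => i _; rewrite mule_ge0// lee_fin powR_ge0.
  have p0 : 0 < 2 ^+ l :> R by exact: exprn_gt0.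
  rewrite mulrC ler_pdivlMr// mulrC -lee_fin EFinM; apply: le_trans h.
  rewrite lee_wpmul2l ?lee_fin ?(ltW p0)//.
  apply: le_trans (supnorm_ub _ z); apply: le_trans (lee_abs _).
  apply: diam_fun_ge; last exact: inB.
  by apply: cellB.
Qed.

End chains_of_partitions.

(** * Expectation bounds *)

Section color_class.
Context (R : realType) (dO dZ : measure_display) (Om : measurableType dO)
  (P : probability Om R) (Zs : measurableType dZ) (N : finType)
  (Z : N -> {RV P >-> Zs}) (F : set (Zs -> R)) (A0 : R)
  (rep : nat -> nat -> Zs -> R) (L Q : nat) (A : pred {ffun 'I_L.+1 -> 'I_Q}).
Hypothesis mF : forall f, F f -> measurable_fun setT f.
Hypothesis A0gt0 : 0 < A0.
Hypothesis FA0 : forall f z, F f -> `|f z| <= A0.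
Hypothesis Frep : forall l k, F (rep l k).
Hypothesis rep0 : forall k, rep 0%N k = cst 0.
Local Notation Ex := (Ex P).
Local Notation J := ('I_L.+1 * 'I_Q)%type.

Definition block_sum (B : {set N}) (w : Om) (j : J) : R :=
  \sum_(i in B) (rep j.1 j.2 (Z i w) - Ex (fun w' => rep j.1 j.2 (Z i w'))).

Lemma bmeas_rep l k i : bmeas (fun w => rep l k (Z i w)).
Proof.
split; last by exists A0 => w; exact: FA0.
by apply: (measurableT_comp (mF (Frep l k))); exact: measurable_funP.
Qed.

Lemma bmeas_block_sum B j : bmeas (fun w => block_sum B w j).
Proof.
apply: bmeas_sum => i _; apply: bmeasB; first exact: bmeas_rep.
exact: bmeas_cst.
Qed.

Lemma Ex_block_sum B j : Ex (fun w => block_sum B w j) = 0.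
Proof.
rewrite Ex_sum; last first.
  by move=> i _; apply: bmeasB; [exact: bmeas_rep|exact: bmeas_cst].
rewrite big1// => i _; rewrite ExB; [|exact: bmeas_rep|exact: bmeas_cst].
by rewrite Ex_cst subrr.
Qed.

Definition gens (U : {set N}) : set (set Om) :=
  \bigcup_(i in [set` U]) preimage_set_system setT (Z i) measurable.

Lemma gens_measurable U : gens U `<=` measurable.
Proof.
by move=> _ [i _ [S mS <-]]; rewrite setTI -[X in measurable X]setTI; exact: measurable_funP.
Qed.

Lemma block_sum_measurable (U B : {set N}) j S : B \subset U -> measurable S ->
  <<s gens U >> ((fun w => block_sum B w j) @^-1` S).
Proof.
move=> /fintype.subsetP BU mS.
have mX : measurable_fun [set: g_sigma_algebraType (gens U)] (fun w => block_sum B w j).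
  rewrite /block_sum.
  have -> : (fun w => \sum_(i in B) (rep j.1 j.2 (Z i w) - Ex (fun w' => rep j.1 j.2 (Z i w')))) =
    (fun w => \sum_i (if i \in B then rep j.1 j.2 (Z i w) - Ex (fun w' => rep j.1 j.2 (Z i w')) else 0)).
    by apply/funext => w; rewrite big_mkcond.
  apply: measurable_sum => i; case: (boolP (i \in B)) => iB; last exact: measurable_cst.
  apply: measurable_funB; last exact: measurable_cst.
  move=> _ S' mS'; rewrite setTI; apply: sub_sigma_algebra.
  exists i; first exact: BU.
  exists (rep j.1 j.2 @^-1` S'); last by rewrite setTI.
  by rewrite -[X in measurable X]setTI; exact: mF.
by have := mX measurableT S mS; rewrite setTI.
Qed.

(** The shifted block sum as a function of the values in the block instead of [w], the form in which
    tau can test it. *)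
Let vec (v : J -> R) (B : {set N}) (z : #|B|.-tuple Zs) (j : J) : R :=
  v j + \sum_(s < #|B|) (rep j.1 j.2 (tnth z s) -
      Ex (fun w' => rep j.1 j.2 (Z (enum_val s) w'))).

Lemma dist_cone_ge0 m (z z' : m.-tuple Zs) : (0 <= dist_class (cone F) z z')%E.
Proof.
apply: sume_ge0 => s _; apply: le_ereal_sup_tmp.
pose f0 x := 1 * rep 0%N 0%N x.
exists `|f0 (tnth z s) - f0 (tnth z' s)|%:E; last by rewrite lee_fin normr_ge0.
exists f0 => //; exists (rep 0%N 0%N), 1; split => //.
apply: ge_ereal_sup => _ [x _ <-].
by rewrite /= /f0 rep0 mulr0 normr0 lee_fin.
Qed.

(** The starting point of a chain contributes the same amount for [z] and [z'], so only the final
    representative [f] matters. As [|f| <= A0], the function [f / A0] belongs to [cone F], and each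
    coordinate moves by at most [A0] times its term in the distance. *)
Lemma block_lipschitz v (B : {set N}) :
  lipschitz1 (@dist_class R Zs (cone F) #|B|) (fun z : #|B|.-tuple Zs => A0^-1 * chain_max A (vec v z)).
Proof.
suff h (z z' : #|B|.-tuple Zs) (dl : R) : (dist_class (cone F) z z' <= dl%:E)%E ->
    chain_max A (vec v z) <= chain_max A (vec v z') + A0 * dl.
  move=> z z'.
  case dE : (dist_class (cone F) z z') => [dl| |]; last 2 first.
  - exact: leey.
  - have := dist_cone_ge0 z z'.
    by rewrite dE.
  rewrite -mulrBr normrM gtr0_norm ?invr_gt0// lee_fin ler_pdivrMl//.
  have sym : dist_class (cone F) z' z = dl%:E.
    rewrite -dE; apply: eq_bigr => s _; congr ereal_sup.
    by apply/seteqP; split=> _ [f Cf <-]; exists f => //; rewrite distrC.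
  have h1 : chain_max A (vec v z) <= chain_max A (vec v z') + A0 * dl.
    by apply: h; rewrite dE.
  have h2 : chain_max A (vec v z') <= chain_max A (vec v z) + A0 * dl.
    by apply: h; rewrite sym.
  by rewrite ler_norml; apply/andP; split; lra.
move=> hd.
have dl0 : 0 <= dl.
  by rewrite -lee_fin; apply: le_trans hd; exact: dist_cone_ge0.
apply: bigmax_le => [|ch Ach].
  by rewrite addr_ge0 ?mulr_ge0 ?(ltW A0gt0)//; exact: bigmax_ge_id.
have := @le_bigmax_cond _ _ _ 0 ch A
  (fun ch => `|vec v z' (ord_max, ch ord_max) - vec v z' (ord0, ch ord0)|) Ach.
rewrite -/(chain_max A _) => h; apply: le_trans (lerD h (lexx _)).
rewrite -lerBlDl; apply: le_trans (lerB_dist _ _) _.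
set f := rep L (ch ord_max).
have -> : vec v z (ord_max, ch ord_max) - vec v z (ord0, ch ord0) -
   (vec v z' (ord_max, ch ord_max) - vec v z' (ord0, ch ord0)) =
   \sum_(s < #|B|) (f (tnth z s) - f (tnth z' s)).
  rewrite /vec /= !rep0 -/f !sumrB; ring.
apply: le_trans (ler_norm_sum _ _ _) _.
rewrite -ler_pdivrMl// mulr_sumr -lee_fin -sumEFin; apply: le_trans hd.
apply: lee_sum => s _; apply: ereal_sup_ubound.
exists (fun x => A0^-1 * f x); last by rewrite -mulrBr normrM gtr0_norm ?invr_gt0.
exists f, A0^-1; split => //; [exact: Frep|by rewrite invr_gt0|].
apply: ge_ereal_sup => _ [x _ <-]; rewrite /= lee_fin normrM gtr0_norm ?invr_gt0//.
rewrite ler_pdivrMl// mulr1; apply: FA0; exact: Frep.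
Qed.

Lemma vec_subvec v (B : {set N}) w :
  vec v (subvec Z B w) = (fun j => v j + block_sum B w j).
Proof.
apply/funext => j; rewrite /vec /block_sum; congr (_ + _).
by rewrite [RHS]big_enum_val /=; apply: eq_bigr => s _; rewrite tnth_mktuple.
Qed.

Lemma measurable_chain_vec v (B : {set N}) :
  measurable_fun setT (fun z : #|B|.-tuple Zs => A0^-1 * chain_max A (vec v z)).
Proof.
apply: measurable_funM; first exact: measurable_cst.
have mvec j : measurable_fun setT (fun z : #|B|.-tuple Zs => vec v z j).
  apply: measurable_funD; first exact: measurable_cst.
  apply: measurable_sum => s; apply: measurable_funB; last exact: measurable_cst.
  by apply: (measurableT_comp (mF (Frep _ _))); exact: measurable_tnth.
rewrite /chain_max; elim: (index_enum _) => [|ch l IHl].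
  by under eq_fun do rewrite big_nil; exact: measurable_cst.
case: (boolP (A ch)) => Ach; last by under eq_fun do rewrite big_cons (negbTE Ach).
under eq_fun do rewrite big_cons Ach.
apply: measurable_maxr => //; apply: measurableT_comp => //.
exact: measurable_funB.
Qed.

Lemma block_tau (U B : {set N}) (t : R) :
  (tau P (@dist_class R Zs (cone F) #|B|) (sigma_gen Z U) (subvec Z B) <= t%:E)%E ->
  forall (K : finType) (kap : Om -> K) (v : K -> J -> R),
  (forall k, <<s gens U >> (kap @^-1` [set k])) ->
  \sum_k (Ex (fun w => \1_(kap @^-1` [set k]) w *
                         chain_max A (fun j => v k j + block_sum B w j))
    - fine (P (kap @^-1` [set k])) *
        Ex (fun w => chain_max A (fun j => v k j + block_sum B w j)))
  <= A0 * t.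
Proof.
move=> ht K kap v mkap.
have bcm k : bmeas (fun w => chain_max A (fun j => v k j + block_sum B w j)).
  apply: bmeas_bigmax => ch; apply: bmeas_norm; apply: bmeasB;
    by apply: bmeasD; [exact: bmeas_cst|exact: bmeas_block_sum].
have mk k : measurable (kap @^-1` [set k]).
  by apply: sub_sigma_measurable (mkap k); exact: gens_measurable.
pose g k (z : #|B|.-tuple Zs) := A0^-1 * chain_max A (vec (v k) z).
have mg k : measurable_fun setT (g k) by exact: measurable_chain_vec.
have lg k : lipschitz1 (@dist_class R Zs (cone F) #|B|) (g k) by exact: block_lipschitz.
have bg k : bmeas (fun w => g k (subvec Z B w)).
  rewrite /g (_ : (fun w => _) =
    (fun w => A0^-1 * chain_max A (fun j => v k j + block_sum B w j))).
    exact: bmeasZ.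
  by apply/funext => w; rewrite vec_subvec.
have h := tau_ge_sum P (@gens_measurable U) mkap mg lg bg.
rewrite mulrC -ler_pdivrMr// -lee_fin; apply: le_trans ht; apply: le_trans h.
rewrite lee_fin le_eqVlt; apply/orP; left; apply/eqP.
rewrite mulr_suml; apply: eq_bigr => k _.
have E1 : (fun w => A0^-1 * chain_max A (vec (v k) (subvec Z B w))) =
   (fun w => A0^-1 * chain_max A (fun j => v k j + block_sum B w j)).
  by apply/funext => w; rewrite vec_subvec.
rewrite E1 ExZ//.
have -> : (fun w => \1_(kap @^-1` [set k]) w * (A0^-1 * chain_max A (vec (v k) (subvec Z B w)))) =
   (fun w => A0^-1 * (\1_(kap @^-1` [set k]) w * chain_max A (fun j => v k j + block_sum B w j))).
  by apply/funext => w; rewrite vec_subvec mulrCA.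
rewrite ExZ; last by apply: bmeasM => //; exact: bmeas_indic.
ring.
Qed.

Lemma class_expectation (M : nat) (m0 : 'I_M) (B : 'I_M -> {set N}) (C : pred 'I_M)
    (t : 'I_M -> R) (nn : nat -> nat) (sg b vr : 'I_L -> 'I_Q -> 'I_Q -> R) (S : R) :
  0 <= S ->
  (forall l k k', 0 < b l k k') -> (forall l k k', 0 <= sg l k k') ->
  (forall l, (nn l)%:R <= 2 ^+ (2 ^ l.+1) :> R) ->
  (forall ch, A ch -> forall l, (ch l < nn l)%N) ->
  (forall ch, A ch -> \sum_(l < L) (2 * 2 `^ (l%:R / 2) * sg l (low_idx ch l) (up_idx ch l)
     + 2 ^+ l * b l (low_idx ch l) (up_idx ch l)) <= S) ->
  (forall m l k k' w,
     `|block_sum (B m) w (upper l k') - block_sum (B m) w (lower l k)| <= b l k k') ->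
  (forall m l k k',
     Ex (fun w => (block_sum (B m) w (upper l k') - block_sum (B m) w (lower l k)) ^+ 2)
       <= #|B m|%:R * vr l k k') ->
  (forall l k k', (\sum_(m | C m) #|B m|%:R) * vr l k k' <= sg l k k' ^+ 2) ->
  (forall m, C m -> (tau P (@dist_class R Zs (cone F) #|B m|)
     (sigma_gen Z (\bigcup_(m' < M | C m' && (m' < m)%N) B m')%SET)
     (subvec Z (B m)) <= (t m)%:E)%E) ->
  Ex (fun w => chain_max A (fun j => \sum_(m | C m) block_sum (B m) w j)) <=
    12 * S + A0 * \sum_(m | C m) t m.
Proof.
move=> S0 b0 sg0 hnn Ann AS hb hvr hsg ht.
(* Listing the class by increasing index makes every earlier block part of the union [U i] that
   generates the conditioning sigma-field. *)
pose s := [seq m <- enum 'I_M | C m].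
pose B' i := B (nth m0 s i).
pose U i := (\bigcup_(m' < M | C m' && (m' < nth m0 s i)%N) B m')%SET.
have sumE (V : zmodType) (f : 'I_M -> V) : \sum_(m | C m) f m = \sum_(i < size s) f (nth m0 s i).
  by rewrite -(big_mkord xpredT (fun i => f (nth m0 s i))) -(big_nth m0 xpredT f) /s big_filter big_enum_cond.
have sC i : (i < size s)%N -> C (nth m0 s i).
  by move=> /(mem_nth m0); rewrite mem_filter => /andP[].
have s_sorted : sorted (fun a b : 'I_M => (a < b)%N) s.
  apply: sorted_filter; first by move=> x y z; exact: ltn_trans.
  by have := iota_ltn_sorted 0 M; rewrite -val_enum_ord sorted_map.
have := @chain_expectation R dO Om P L Q (fun i => block_sum (B' i)) (fun i => gens (U i))
  (fun i => A0 * t (nth m0 s i)) (size s) nn sg b S A S0 b0 sg0 hnn Ann AS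
  (fun i j => bmeas_block_sum (B' i) j) (fun i j => Ex_block_sum (B' i) j)
  (fun i l k k' w _ _ => hb (nth m0 s i) l k k' w).
have hv l k k' : valid nn l k k' ->
    \sum_(i < size s) Ex (fun w => (block_sum (B' i) w (upper l k') - block_sum (B' i) w (lower l k)) ^+ 2)
      <= sg l k k' ^+ 2.
  move=> _; apply: le_trans (hsg l k k'); rewrite sumE mulr_suml.
  by apply: ler_sum => i _; exact: hvr.
move=> /(_ hv (fun i _ => @gens_measurable (U i))).
have hm l i j S' : (l < i)%N -> (i < size s)%N -> measurable S' ->
    <<s gens (U i) >> ((fun w => block_sum (B' l) w j) @^-1` S').
  move=> li iS mS'; apply: block_sum_measurable => //.
  have ls := ltn_trans li iS.
  have tr : transitive (fun a b : 'I_M => (a < b)%N) by move=> x y z; exact: ltn_trans.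
  have lt_li : (nth m0 s l < nth m0 s i)%N.
    by apply: (sorted_ltn_nth tr m0 s_sorted); rewrite ?inE.
  by apply: (finset.bigcup_sup (nth m0 s l)) => //; rewrite sC.
move=> /(_ hm (fun i iS => block_tau (ht _ (sC i iS)))).
rewrite -mulr_sumr -sumE.
rewrite (_ : (fun w => chain_max A (fun j => \sum_(i < size s) block_sum (B' i) w j)) =
  (fun w => chain_max A (fun j => \sum_(m | C m) block_sum (B m) w j)))//.
by apply/funext => w; congr chain_max; apply/funext => j; rewrite sumE.
Qed.

End color_class.

Section max_Lnorm_facts.
Context (R : realType) (dO dZ : measure_display) (Om : measurableType dO)
  (P : probability Om R) (Zs : measurableType dZ) (N : finType)
  (Z : N -> {RV P >-> Zs}).
Local Open Scope ereal_scope.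

Lemma max_Lnorm_ge0 p h : 0 <= max_Lnorm Z p h.
Proof. exact: bigmax_ge_id. Qed.

Lemma le_max_Lnorm p u v : 0 <= p -> (forall z, `|u z| <= `|v z|) ->
  max_Lnorm Z p u <= max_Lnorm Z p v.
Proof.
move=> p0 uv; apply: bigmax_le => [|i _]; first exact: max_Lnorm_ge0.
by apply: le_trans (le_LnormT _ p0 uv) _; exact: le_bigmax.
Qed.

Lemma Lnorm_bounded_lty (mu : probability Zs R) (p : \bar R) (h : Zs -> R) (C : R) :
  0 < p -> (forall z, `|h z| <= C)%R -> 'N[mu]_p[EFin \o h] < +oo.
Proof.
move=> p0 hC; have C0 : (0 <= C)%R by apply: le_trans (hC point).
have : 'N[mu]_p[EFin \o h] <= 'N[mu]_p[EFin \o cst C].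
    apply: le_LnormT (ltW p0) _ => z.
    by rewrite lee_fin /= (ger0_norm C0).
move=> /le_lt_trans; apply; rewrite unlock /Lnorm; case: p p0 => [r|_|//].
  rewrite lte_fin => r0.
  rewrite (eq_integral (fun=> (C `^ r)%:E)); last first.
    by move=> z _; rewrite /comp /cst abse_EFin (ger0_norm C0) poweR_EFin.
  rewrite integral_cst// [X in _ * X](_ : _ = 1); last exact: (probability_setT mu).
  by rewrite mule1 poweR_EFin ltry.
case: ifPn => _; last by rewrite ltry.
apply: (@le_lt_trans _ _ C%:E); last by rewrite ltry.
by apply/ess_supP; apply: nearW => z /=; rewrite ger0_norm.
Qed.

Lemma max_Lnorm_bounded_lty p (h : Zs -> R) (C : R) :
  0 < p -> (forall z, `|h z| <= C)%R -> max_Lnorm Z p (EFin \o h) < +oo.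
Proof.
move=> p0 hC; apply: bigmax_lt => // i _; exact: Lnorm_bounded_lty hC.
Qed.

Lemma Lnorm_le_max_Lnorm p h i : 'N[distribution P (Z i)]_p[h] <= max_Lnorm Z p h.
Proof. exact: le_bigmax. Qed.

End max_Lnorm_facts.

Lemma exists_small_dyadic (R : realType) (x e : R) : 0 < e ->
  exists L : nat, 2 ^- L * x <= e.
Proof.
move=> e0; pose L := (Num.truncn (`|x| / e)).+1; exists L.
have p0 : 0 < 2 ^+ L :> R by exact: exprn_gt0.
rewrite mulrC ler_pdivrMr//.
apply: le_trans (ler_norm x) _; rewrite mulrC -ler_pdivrMr//.
apply: le_trans (ltW (truncnS_gt _)) _.
by rewrite -natrX ler_nat; apply: ltnW; exact: ltn_expl.
Qed.

(** * Assembling the color classes *)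

Section core.
Context (R : realType) (dO dZ : measure_display) (Om : measurableType dO)
  (P : probability Om R) (Zs : measurableType dZ) (N : finType) (e : rel N)
  (Z : N -> {RV P >-> Zs}) (F : set (Zs -> R)) (Cgr d Kb A0 : R) (p : \bar R) (q : nat)
  (M : nat) (m0 : 'I_M) (B : 'I_M -> {set N}) (K : nat) (c : 'I_M -> 'I_K)
  (t : 'I_M -> R) (a b G1 G2 Lam : R).
Hypothesis mF : forall f, F f -> measurable_fun setT f.
Hypothesis F0 : F (cst 0).
Hypothesis A0gt0 : 0 < A0.
Hypothesis FA0 : forall f z, F f -> `|f z| <= A0.
Hypothesis d1 : 1 <= d.
Hypothesis q0 : (0 < q)%N.
Hypothesis p1 : (1 <= p)%E.
Hypothesis growth : forall (x : N) (s : R), 1 <= s ->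
  #|gsphere e x s|%:R <= Cgr * s `^ (d - 1).
Hypothesis partB : is_partition B.
Hypothesis diamB : forall m i j, i \in B m -> j \in B m ->
  (gdist R e i j <= (2 * q%:R `^ d^-1)%:E)%E.
Hypothesis cardB : forall m, #|B m|%:R <= Kb * q%:R.
Hypothesis ht : forall m, (tau P (@dist_class R Zs (cone F) #|B m|)
  (sigma_gen Z (\bigcup_(m' < M | (c m' == c m) && (m' < m)%N) B m')%SET)
  (subvec Z (B m)) <= (t m)%:E)%E.
Hypothesis a1 : 1 <= a.
Hypothesis b1 : 1 <= b.
Hypothesis g2 : (talagrand_gamma 2 a F (max_Lnorm Z (2%:E * p)) < G2%:E)%E.
Hypothesis g1 : (talagrand_gamma 1 b F (@supnorm R Zs) < G1%:E)%E.
Hypothesis Lam0 : 0 <= Lam.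
Hypothesis hLam : forall m, Lambda_sq e Z F d p q (B m) <= Lam ^+ 2.
Hypothesis Kb0 : 0 < Kb.
Local Notation Ex := (Ex P).

Let C1 : R := 56 * (1 + `|Cgr| * 2 `^ (d - 1)) + 2 * Kb.

Lemma sum_card_blocks : \sum_m #|B m|%:R = #|N|%:R :> R.
Proof.
case: partB => injB partP; have := finset.card_partition partP.
rewrite cardsT => ->; rewrite big_imset/=; last by move=> x y _ _; exact: injB.
by rewrite natr_sum.
Qed.

Lemma sum_over_blocks (f : N -> R) : \sum_i f i = \sum_m \sum_(i in B m) f i.
Proof.
case: partB => injB /and3P[/eqP cov triv _].
have -> : \sum_i f i = \sum_(i in finset.cover [set B m | m : 'I_M]%SET) f i.
  by apply: eq_bigl => i; rewrite cov inE.
rewrite finset.big_trivIset//= big_imset//=.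
by move=> x y _ _; exact: injB.
Qed.

Lemma empirical_bound (ep : R) : 0 < ep ->
  ('N[P]_1[(fun w => ereal_sup [set (empirical_process Z f w)%:E | f in F])]
   <= (ep + (Num.sqrt #|N|%:R)^-1 *
        \sum_(k < K) (12 * (2 * Num.sqrt (#|N|%:R * C1) * Lam * (G2 + ep)
                             + 2 * Kb * q%:R * (G1 + ep))
                      + A0 * \sum_(m | c m == k) t m))%:E)%E.
Proof.
move=> ep0.
have p20 : (0 < 2%:E * p)%E by rewrite mule_gt0// (lt_le_trans _ p1).
have [nn [idx [rep [[nn2 idxn Frep rep0] sumA sumB close]]]] :=
  gamma_chains (point : Zs) F0 a1 b1 (max_Lnorm_ge0 Z (2%:E * p))
    (fun u v => @le_max_Lnorm _ _ _ _ _ _ _ Z (2%:E * p) u v (ltW p20)) g2 g1.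
set n : R := #|N|%:R.
have n0 : 0 <= n by exact: ler0n.
have q1 : 1 <= q%:R :> R by rewrite ler1n.
have C10 : 0 <= C1.
  by rewrite /C1 addr_ge0 ?mulr_ge0 ?addr_ge0 ?mulr_ge0 ?powR_ge0// ltW.
(* Replacing [f] by its representative at level [L] changes each centred summand by at most
   [2 * (2 ^- L * G1)]; summing over [n] vertices and normalising gives the factor [Num.sqrt n]. *)
have [L hL] := exists_small_dyadic (2 * Num.sqrt n * G1) ep0.
pose Q := (\max_(l < L.+1) nn l).+1.
have idxQ (l : 'I_L.+1) f : F f -> (idx l f < Q)%N.
  move=> Ff; rewrite /Q ltnS ltnW//; apply: leq_trans (idxn l f Ff) _.
  exact: (bigop.leq_bigmax l).
pose A : pred {ffun 'I_L.+1 -> 'I_Q} := fun ch =>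
  `[< exists2 f, F f & forall l : 'I_L.+1, ch l = idx l f :> nat >].
(* Added to every norm, [eta] makes the bounds strictly positive, as the truncation levels and the
   weights require. Since the powers [2 ^+ l] below level [L] sum to at most [2 ^+ L], its total
   cost per chain stays below [ep]. *)
pose eta := ep / 2 ^+ L.
have p2L : 0 < 2 ^+ L :> R by exact: exprn_gt0.
have eta0 : 0 < eta by rewrite divr_gt0.
have linkF l k k' : diff_class F (link rep l k k').
  by exists (rep l.+1 k') => //; exists (rep l k).
have link_bd l k k' z : `|link rep l k k' z| <= 2 * A0.
  apply: le_trans (ler_normB _ _) _; rewrite mulrDl mul1r.
  by apply: lerD; exact: FA0.
pose Nn l k k' := fine (max_Lnorm Z (2%:E * p) (EFin \o link rep l k k')) + eta.
pose Bn l k k' := fine (supnorm (EFin \o link rep l k k')) + eta.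
have Nn0 l k k' : 0 < Nn l k k'.
  by rewrite ltr_wpDl// fine_ge0// max_Lnorm_ge0.
have sup_fin l k k' : supnorm (EFin \o link rep l k k') \is a fin_num.
  rewrite ge0_fin_numE; last by apply: supnorm_ge0; exists (point : Zs).
  apply: (@le_lt_trans _ _ (2 * A0)%:E); last by rewrite ltry.
  by apply: ge_ereal_sup => _ [z _ <-]; rewrite lee_fin.
have Bn0 l k k' : 0 < Bn l k k'.
  by rewrite ltr_wpDl// fine_ge0//; apply: supnorm_ge0; exists (point : Zs).
have hN l k k' i : ('N[distribution P (Z i)]_(2%:E * p)[EFin \o link rep l k k'] <= (Nn l k k')%:E)%E.
  apply: le_trans (Lnorm_le_max_Lnorm _ _ _ _) _.
  rewrite -[leLHS]fineK; last first.
    rewrite ge0_fin_numE ?max_Lnorm_ge0//.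
    exact: max_Lnorm_bounded_lty p20 (link_bd l k k').
  by rewrite lee_fin lerDl ltW.
pose bs m w j := @block_sum R dO dZ Om P Zs N Z rep L Q (B m) w j.
have bmrep l k i : bmeas (fun w => rep l k (Z i w)).
  exact: (bmeas_rep Z mF FA0 Frep).
have bs_link m w (l : 'I_L) (k k' : 'I_Q) :
    bs m w (upper l k') - bs m w (lower l k) =
    \sum_(i in B m) (link rep l k k' (Z i w) - Ex (fun w' => link rep l k k' (Z i w'))).
  rewrite /bs /block_sum -sumrB; apply: eq_bigr => i _.
  by rewrite /upper /lower /link /= /bump /= add1n ExB//; ring.
have bmlink l k k' i : bmeas (fun w => link rep l k k' (Z i w)) by exact: bmeasB.
(* The square of [sg] bounds the sum of the block variances over a class, whose blocks have at most
   [n] vertices in total. In [bb], the 2 comes from centring and [Kb * q] from the block size. *)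
pose sg (l : 'I_L) (k k' : 'I_Q) := Num.sqrt (n * C1) * Lam * Nn l k k'.
pose bb (l : 'I_L) (k k' : 'I_Q) := 2 * Kb * q%:R * Bn l k k'.
pose vr (l : 'I_L) (k k' : 'I_Q) := C1 * (Lam ^+ 2 * Nn l k k' ^+ 2).
pose S := 2 * Num.sqrt (n * C1) * Lam * (G2 + ep) + 2 * Kb * q%:R * (G1 + ep).
have bb0 l k k' : 0 < bb l k k'.
  by rewrite /bb mulr_gt0// !mulr_gt0// (lt_le_trans ltr01).
have sg0 l k k' : 0 <= sg l k k'.
  by rewrite /sg mulr_ge0 ?(ltW (Nn0 _ _ _))// mulr_ge0// sqrtr_ge0.
have Ann ch : A ch -> forall l, (ch l < nn l)%N.
  by move=> /asboolP[f Ff chE] l; rewrite chE; exact: idxn.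
have sum2L : \sum_(l < L) 2 ^+ l <= 2 ^+ L :> R.
  elim: (L) => [|k IHk]; first by rewrite big_ord0 expr0.
  by rewrite big_ord_recr /= exprS mulrDl mul1r lerD2r.
have le2 (l : nat) : 2 `^ (l%:R / 2) <= 2 ^+ l :> R.
  rewrite -powR_mulrn// ler_powR ?ler1n//.
  by rewrite ler_pdivrMr// ler_peMr// ler1n.
have etaA : \sum_(l < L) 2 `^ (l%:R / 2) * eta <= ep.
  rewrite -mulr_suml; apply: le_trans (_ : 2 ^+ L * eta <= _).
    apply: ler_wpM2r; first exact: ltW.
    by apply: le_trans sum2L; apply: ler_sum => l _; exact: le2.
  by rewrite /eta mulrCA divff ?gt_eqF// mulr1.
have etaB : \sum_(l < L) 2 ^+ l * eta <= ep.
  rewrite -mulr_suml; apply: le_trans (_ : 2 ^+ L * eta <= _).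
    by apply: ler_wpM2r => //; exact: ltW.
  by rewrite /eta mulrCA divff ?gt_eqF// mulr1.
have AS ch : A ch -> \sum_(l < L) (2 * 2 `^ (l%:R / 2) * sg l (low_idx ch l) (up_idx ch l)
     + 2 ^+ l * bb l (low_idx ch l) (up_idx ch l)) <= S.
  move=> /asboolP[f Ff chE].
  have lowE (l : 'I_L) : low_idx ch l = idx l f :> nat by rewrite /low_idx chE.
  have upE (l : 'I_L) : up_idx ch l = idx l.+1 f :> nat by rewrite /up_idx chE.
  rewrite big_split /= /S; apply: lerD.
    have -> : \sum_(l < L) 2 * 2 `^ (l%:R / 2) * sg l (low_idx ch l) (up_idx ch l) =
      2 * Num.sqrt (n * C1) * Lam * \sum_(l < L) (2 `^ (l%:R / 2) *
        fine (max_Lnorm Z (2%:E * p) (EFin \o link rep l (idx l f) (idx l.+1 f))) + 2 `^ (l%:R / 2) * eta).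
      by rewrite mulr_sumr; apply: eq_bigr => l _; rewrite /sg /Nn lowE upE; ring.
    apply: ler_wpM2l; first by rewrite !mulr_ge0// sqrtr_ge0.
    rewrite big_split /=; apply: lerD etaA.
    by have := sumA f L Ff; rewrite big_mkord.
  have -> : \sum_(l < L) 2 ^+ l * bb l (low_idx ch l) (up_idx ch l) =
      2 * Kb * q%:R * \sum_(l < L) (2 ^+ l *
        fine (supnorm (EFin \o link rep l (idx l f) (idx l.+1 f))) + 2 ^+ l * eta).
    by rewrite mulr_sumr; apply: eq_bigr => l _; rewrite /bb /Bn lowE upE; ring.
  apply: ler_wpM2l; first by rewrite !mulr_ge0// ltW.
  rewrite big_split /=; apply: lerD etaB.
  by have := sumB f L Ff; rewrite big_mkord.
have S0 : 0 <= S.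
  apply: le_trans (AS [ffun l : 'I_L.+1 => inord (idx l (cst 0)) : 'I_Q] _).
    apply: sumr_ge0 => l _; rewrite addr_ge0// mulr_ge0 ?exprn_ge0//.
    exact: ltW.
  by apply/asboolP; exists (cst 0) => // l; rewrite ffunE inordK// idxQ.
have hb m (l : 'I_L) (k k' : 'I_Q) w :
    `|bs m w (upper l k') - bs m w (lower l k)| <= bb l k k'.
  rewrite bs_link; apply: le_trans (ler_norm_sum _ _ _) _.
  have ub z : `|link rep l k k' z| <= Bn l k k'.
    rewrite -lee_fin; apply: (@le_trans _ _ (supnorm (EFin \o link rep l k k'))).
      exact: (supnorm_ub (EFin \o link rep l k k')).
    by rewrite -[leLHS]fineK// lee_fin lerDl ltW.
  apply: le_trans (_ : \sum_(i in B m) (2 * Bn l k k') <= _).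
    apply: ler_sum => i _; apply: le_trans (ler_normB _ _) _.
    rewrite mulrDl mul1r; apply: lerD; first exact: ub.
    by apply: le_trans (Ex_norm _ _) _ => //; apply: Ex_le => //; exact: bmeas_norm.
  rewrite sumr_const -[leLHS]mulr_natl /bb.
  rewrite (_ : 2 * Kb * q%:R * Bn l k k' = Kb * q%:R * (2 * Bn l k k')); last by ring.
  by apply: ler_wpM2r => //; rewrite mulr_ge0// ltW.
have hvr m (l : 'I_L) (k k' : 'I_Q) :
    Ex (fun w => (bs m w (upper l k') - bs m w (lower l k)) ^+ 2) <= #|B m|%:R * vr l k k'.
  under eq_fun do rewrite bs_link.
  have BV := block_variance mF d1 q0 p1 growth (@diamB m) (cardB m) (linkF l k k')
    (bmlink l k k') (Nn0 l k k') (hN l k k').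
  apply: le_trans BV _.
  rewrite ler_wpM2l// /vr -/C1 ler_wpM2l// ler_wpM2r ?sqr_ge0//.
have hsg k0 (l : 'I_L) (k k' : 'I_Q) :
    (\sum_(m | c m == k0) #|B m|%:R) * vr l k k' <= sg l k k' ^+ 2.
  rewrite /sg !exprMn sqr_sqrtr ?mulr_ge0// /vr.
  rewrite (_ : n * C1 * Lam ^+ 2 * Nn l k k' ^+ 2 = n * (C1 * (Lam ^+ 2 * Nn l k k' ^+ 2))); last by ring.
  apply: ler_wpM2r; first by rewrite mulr_ge0// mulr_ge0// sqr_ge0.
  rewrite /n -sum_card_blocks big_mkcond /=; apply: ler_sum => m _.
  by case: ifP.
have classE k : Ex (fun w => chain_max A (fun j => \sum_(m | c m == k) bs m w j)) <=
    12 * S + A0 * \sum_(m | c m == k) t m.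
  apply: (class_expectation mF A0gt0 FA0 Frep rep0 m0 S0 bb0 sg0 nn2 Ann AS hb hvr (hsg k)).
  by move=> m /eqP <-; exact: ht.
have sq0 : 0 <= (Num.sqrt n)^-1 by rewrite invr_ge0 sqrtr_ge0.
pose H w := \sum_(k < K) chain_max A (fun j => \sum_(m | c m == k) bs m w j).
have bH k : bmeas (fun w => chain_max A (fun j => \sum_(m | c m == k) bs m w j)).
  apply: bmeas_bigmax => ch; apply: bmeas_norm; apply: bmeasB;
    by apply: bmeas_sum => m _; exact: (bmeas_block_sum Z mF FA0 Frep).
have pointwise f w : F f -> empirical_process Z f w <= ep + (Num.sqrt n)^-1 * H w.
  move=> Ff; rewrite /empirical_process -/n.
  pose g := rep L (idx L f).
  have bf i : bmeas (fun w' => f (Z i w')).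
    split; last by exists A0 => w'; exact: FA0.
    by apply: (measurableT_comp (mF Ff)); exact: measurable_funP.
  have bg i : bmeas (fun w' => g (Z i w')) by exact: bmrep.
  have split_i i : f (Z i w) - Ex (fun w' => f (Z i w')) =
     ((f (Z i w) - g (Z i w)) - Ex (fun w' => f (Z i w') - g (Z i w'))) +
     (g (Z i w) - Ex (fun w' => g (Z i w'))) by rewrite ExB//; ring.
  have -> : \sum_i (f (Z i w) - fine 'E_P[(fun w' => f (Z i w'))]) =
     \sum_i ((f (Z i w) - g (Z i w)) - Ex (fun w' => f (Z i w') - g (Z i w'))) +
     \sum_i (g (Z i w) - Ex (fun w' => g (Z i w'))).
    by rewrite -big_split; apply: eq_bigr => i _; exact: split_i.
  rewrite mulrDr; apply: lerD.
    have fg z : `|f z - g z| <= 2 ^- L * G1 by exact: close.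
    apply: le_trans (_ : (Num.sqrt n)^-1 * (n * (2 * (2 ^- L * G1))) <= _).
      apply: ler_wpM2l => //; rewrite /n mulr_natl -sumr_const.
      apply: ler_sum => i _; apply: le_trans (ler_norm _) _.
      apply: le_trans (ler_normB _ _) _; rewrite mulrDl mul1r; apply: lerD => //.
      apply: le_trans (Ex_norm _ _) _; first exact: bmeasB.
      by apply: Ex_le => //; apply: bmeas_norm; exact: bmeasB.
    apply: le_trans hL; rewrite -{2}(sqr_sqrtr n0).
    have [s0|sn0] := eqVneq (Num.sqrt n) 0; first by rewrite s0 invr0 !mul0r !mulr0 mul0r mulr0.
    by rewrite le_eqVlt; apply/orP; left; apply/eqP; field; rewrite sn0 gt_eqF.
  apply: ler_wpM2l => //.
  pose ch : {ffun 'I_L.+1 -> 'I_Q} := [ffun l : 'I_L.+1 => inord (idx l f) : 'I_Q].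
  have chE (l : 'I_L.+1) : ch l = idx l f :> nat by rewrite ffunE inordK// idxQ.
  have Ach : A ch by apply/asboolP; exists f.
  have -> : \sum_i (g (Z i w) - Ex (fun w' => g (Z i w'))) =
     \sum_(k < K) \sum_(m | c m == k) bs m w (ord_max, ch ord_max).
    rewrite sum_over_blocks (partition_big c xpredT)//=.
    apply: eq_bigr => k _; apply: eq_bigr => m _; rewrite /bs /block_sum /=.
    by apply: eq_bigr => i _; rewrite (chE ord_max).
  apply: ler_sum => k _.
  have := @le_bigmax_cond _ _ _ 0 ch A (fun ch =>
    `|\sum_(m | c m == k) bs m w (ord_max, ch ord_max) -
      \sum_(m | c m == k) bs m w (ord0, ch ord0)|) Ach.
  apply: le_trans; rewrite [X in _ - X]big1 ?subr0 ?ler_norm// => m _.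
  by rewrite /bs /block_sum big1// => i _; rewrite /= rep0 (Ex_cst P 0) subrr.
have bHH : bmeas (fun w => ep + (Num.sqrt n)^-1 * H w).
  apply: bmeasD; first exact: bmeas_cst.
  by apply: bmeasZ; apply: bmeas_sum => k _; exact: bH.
rewrite Lnorm1.
apply: (@le_trans _ _ (\int[P]_w (ep + (Num.sqrt n)^-1 * H w)%:E)%E).
  apply: ge0_le_integralT => w; first exact: abse_ge0.
  (* Since [0] is in [F], the supremum is nonnegative, and its integral is compared with that of the
     measurable majorant by monotonicity. *)
  rewrite gee0_abs; last first.
    apply: le_ereal_sup_tmp; exists (empirical_process Z (cst 0) w)%:E; first by exists (cst 0).
    rewrite lee_fin /empirical_process big1 ?mulr0// => i _.
    by rewrite -[fine _]/(Ex (fun=> 0)) Ex_cst subrr.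
  by apply: ge_ereal_sup => _ [f Ff <-]; rewrite lee_fin; exact: pointwise.
have := bmeas_ExE P bHH; rewrite {1}unlock => ->.
rewrite lee_fin ExD; [|exact: bmeas_cst|by apply: bmeasZ; apply: bmeas_sum => k _; exact: bH].
rewrite Ex_cst lerD2l ExZ; last by apply: bmeas_sum => k _; exact: bH.
apply: ler_wpM2l => //; rewrite Ex_sum; last by move=> k _; exact: bH.
by apply: ler_sum => k _; exact: classE.
Qed.

End core.

Lemma sq_le_bigmax (R : realType) (M : nat) (r t : R) (x : 'I_M -> R) m : 0 <= x m ->
  r `^ t * x m <= (\big[Num.max/0]_(k < M) (r `^ (t / 2) * Num.sqrt (x k))) ^+ 2.
Proof.
move=> x0.
have -> : r `^ t * x m = (r `^ (t / 2) * Num.sqrt (x m)) ^+ 2.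
  rewrite exprMn sqr_sqrtr// -powR_mulrn ?powR_ge0// -powRrM.
  by congr (_ `^ _ * _); field.
have xy0 : 0 <= r `^ (t / 2) * Num.sqrt (x m) by rewrite mulr_ge0 ?powR_ge0 ?sqrtr_ge0.
have xy := le_bigmax (0 : R) (fun k => r `^ (t / 2) * Num.sqrt (x k)) m.
by rewrite lerXn2r ?nnegrE ?(le_trans _ xy).
Qed.

Section Lambda_facts.
Context (R : realType) (dO dZ : measure_display) (Om : measurableType dO)
  (P : probability Om R) (Zs : measurableType dZ) (N : finType) (e : rel N)
  (Z : N -> {RV P >-> Zs}) (F : set (Zs -> R)) (d : R) (p : \bar R) (q : nat)
  (M : nat) (B : 'I_M -> {set N}).
Hypothesis mF : forall f, F f -> measurable_fun setT f.
Hypothesis d1 : 1 <= d.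
Hypothesis q0 : (0 < q)%N.
Hypothesis p1 : (1 <= p)%E.
Local Notation al := (fun m => alpha_class e Z F (B m)).

Lemma Lambda_sum_ge1 m : 1 <= Lambda_sum p d q (al m).
Proof.
rewrite /Lambda_sum big_mkord big_ord_recl /= {1}/alpha_class eqxx powR1 lerDl.
by apply: sumr_ge0 => i _; exact: powR_ge0.
Qed.

Lemma Lambda_min_gt0 m : p != 1%E ->
  0 < Num.min (Lambda_sharp p d q (al m)) (Lambda_sum p d q (al m)).
Proof.
move=> pn1; have p1' : (1 < p)%E by rewrite lt_neqAle eq_sym pn1.
have s1 := Lambda_sum_ge1 m; rewrite lt_min (lt_le_trans ltr01 s1) andbT.
have := Lambda_sum_le_sharp p1' d1 q0 (alpha_class_itv e Z mF (B m)).
by move: s1; lra.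
Qed.

Lemma Lambda_ge0 : 0 <= Lambda p d q al.
Proof. by rewrite /Lambda; case: ifP => _; [exact: sqrtr_ge0|exact: bigmax_ge_id]. Qed.

Lemma Lambda_sq_le m : Lambda_sq e Z F d p q (B m) <= Lambda p d q al ^+ 2.
Proof.
rewrite /Lambda_sq /Lambda; case: ifPn => pn1; first by rewrite sqr_sqrtr.
exact: (sq_le_bigmax q%:R (1 - d^-1) 
  (x := fun m => Num.min (Lambda_sharp p d q (al m)) (Lambda_sum p d q (al m)))
  (ltW (Lambda_min_gt0 m pn1))).
Qed.

(** Strict positivity matters in the extended reals, where [0 * +oo = 0]: an infinite gamma_2 must
    make the right-hand side infinite. *)
Lemma Lambda_gt0 (m : 'I_M) : 0 < Lambda p d q al.
Proof.
rewrite lt_neqAle Lambda_ge0 andbT; apply/eqP => L0.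
have := Lambda_sq_le m; rewrite -L0 expr0n /= /Lambda_sq leNgt => /negP; apply.
case: ifPn => pn1; first by rewrite ltr0n.
by rewrite mulr_gt0 ?powR_gt0 ?ltr0n// Lambda_min_gt0.
Qed.

End Lambda_facts.

Lemma talagrand_gamma_ge0 (R : realType) (T : Type) (q s : R) (F : set (T -> R))
    (dd : (T -> \bar R) -> \bar R) f : F f ->
  (forall u, (0 <= dd u)%E) -> (0 <= talagrand_gamma q s F dd)%E.
Proof.
move=> Ff dd0; apply: le_ereal_inf_tmp => _ [Tl _ <-]; apply: le_ereal_sup_tmp.
exists (\sum_(0 <= l <oo) (2 `^ (l%:R / q))%:E * dd (diam_fun f (Tl l)))%E.
  by exists f.
by apply: nneseries_ge0 => l _ _; rewrite mule_ge0// lee_fin powR_ge0.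
Qed.

(** The first term of the series is the sup norm of the diameter of the single cell at level 0,
    which contains both [f] and 0. *)
Lemma norm_le_gamma1 (R : realType) (T : Type) (b g : R) (F : set (T -> R)) :
  F (cst 0) -> 1 <= b -> talagrand_gamma 1 b F (@supnorm R T) = g%:E ->
  forall f z, F f -> `|f z| <= g.
Proof.
move=> F0 b1 gE f z Ff; apply/ler_addgt0Pr => ep ep0.
have sn0 u : (0 <= @supnorm R T u)%E by apply: supnorm_ge0; exists z.
have [|Tl adm /(_ f 1%N Ff)] := gamma_witness (q := 1) (s := b) (F := F) (G := g + ep) sn0.
  by rewrite gE lte_fin ltrDl.
have [nB [iB [_ _ cellB zeroB _]]] := admissible_index b1 adm.
rewrite big_nat1 mul0r powRr0 mul1e -lee_fin; apply: le_trans.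
apply: le_trans (supnorm_ub _ z); apply: le_trans (lee_abs _).
rewrite -[X in (X%:E <= _)%E]/(`|f z|) -[in X in X%:E](subr0 (f z)).
apply: (@diam_fun_ge _ _ f f (cst 0)); apply: cellB => //.
exact: zeroB.
Qed.

Lemma tau_bar_ge0 (R : realType) (dO dZ : measure_display) (Om : measurableType dO)
    (P : probability Om R) (Zs : measurableType dZ) (N : finType)
    (Z : N -> {RV P >-> Zs}) (C : set (Zs -> R)) (M : nat)
    (B : 'I_M -> {set N}) (K : nat) (c : 'I_M -> 'I_K) : (0 <= tau_bar Z C B c)%E.
Proof.
rewrite /tau_bar mule_ge0// ?lee_fin ?invr_ge0 ?ler0n//.
by apply: sume_ge0 => k _; apply: sume_ge0 => m _; exact: Lnorm_ge0.
Qed.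

Section final_bound.
Context (R : realType) (dO dZ : measure_display) (Om : measurableType dO)
  (P : probability Om R) (Zs : measurableType dZ) (N : finType) (e : rel N)
  (Z : N -> {RV P >-> Zs}) (F : set (Zs -> R)) (Cgr d Kb : R) (p : \bar R) (q : nat)
  (M : nat) (m0 : 'I_M) (B : 'I_M -> {set N}) (K : nat) (c : 'I_M -> 'I_K)
  (a b : R).
Hypothesis mF : forall f, F f -> measurable_fun setT f.
Hypothesis F0 : F (cst 0).
Hypothesis d1 : 1 <= d.
Hypothesis q0 : (0 < q)%N.
Hypothesis p1 : (1 <= p)%E.
Hypothesis growth : forall (x : N) (s : R), 1 <= s ->
  #|gsphere e x s|%:R <= Cgr * s `^ (d - 1).
Hypothesis partB : is_partition B.
Hypothesis diamB : forall m i j, i \in B m -> j \in B m ->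
  (gdist R e i j <= (2 * q%:R `^ d^-1)%:E)%E.
Hypothesis cardB : forall m, #|B m|%:R <= Kb * q%:R.
Hypothesis a1 : 1 <= a.
Hypothesis b1 : 1 <= b.
Hypothesis Kb0 : 0 < Kb.
Hypothesis N0 : (0 < #|N|)%N.

Let C1 : R := 56 * (1 + `|Cgr| * 2 `^ (d - 1)) + 2 * Kb.
Let C2 : R := 1 + 24 * K%:R * Num.sqrt C1 + 24 * K%:R * Kb.
Let n : R := #|N|%:R.
Let Lam : R := Lambda p d q (fun m => alpha_class e Z F (B m)).
Local Notation gamma1 := (talagrand_gamma 1 b F (@supnorm R Zs)).
Local Notation gamma2 := (talagrand_gamma 2 a F (max_Lnorm Z (2%:E * p))).
Local Notation tauB k m := (tau P (@dist_class R Zs (cone F) #|B m|)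
  (sigma_gen Z (\bigcup_(m' < M | (c m' == k) && (m' < m)%N) B m')%SET)
  (subvec Z (B m))).

(** In [C2], 24 is the 12 of [chain_expectation] times the 2 carried by both parts of the weight
    bound [S]; [K] appears because the expectations of the color classes are added. *)
Lemma class_process_bound :
  ('N[P]_1[(fun w => ereal_sup [set (empirical_process Z f w)%:E | f in F])]
   <= C2%:E * (Lam%:E * gamma2
       + ((q%:R / Num.sqrt n)%:E + (Num.sqrt n)%:E * tau_bar Z (cone F) B c)
         * gamma1))%E.
Proof.
have n0 : 0 < n by rewrite ltr0n.
have s0 : 0 < Num.sqrt n by rewrite sqrtr_gt0.
have C10 : 0 <= C1.
  by rewrite /C1 addr_ge0 ?mulr_ge0 ?addr_ge0 ?mulr_ge0 ?powR_ge0// ltW.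
have C20 : 0 < C2.
  by rewrite /C2 -addrA ltr_pwDl// addr_ge0// mulr_ge0// ?sqrtr_ge0// ltW.
have Lam0 : 0 < Lam by exact: Lambda_gt0.
have tau0 k m : (0 <= tauB k m)%E by exact: Lnorm_ge0.
have tb0 := tau_bar_ge0 Z (cone F) B c.
have cf0 : (0 < (q%:R / Num.sqrt n)%:E + (Num.sqrt n)%:E * tau_bar Z (cone F) B c)%E.
  apply: (@lt_le_trans _ _ (q%:R / Num.sqrt n)%:E).
    by rewrite lte_fin divr_gt0// ltr0n.
  by rewrite leeDl// mule_ge0// lee_fin ltW.
have addoo (x : \bar R) : (0 <= x)%E -> (x + +oo = +oo)%E by case: x.
have ooadd (x : \bar R) : (0 <= x)%E -> (+oo + x = +oo)%E by case: x.
have g10 : (0 <= gamma1)%E.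
  by apply: (talagrand_gamma_ge0 _ _ F0) => u; apply: supnorm_ge0; exists (point : Zs).
have g20 : (0 <= gamma2)%E.
  by apply: (talagrand_gamma_ge0 _ _ F0) => u; exact: max_Lnorm_ge0.
case g1E : gamma1 g10 => [g1| |] // g10; last first.
  rewrite (gt0_muley cf0) addoo ?gt0_muley ?leey//.
  by rewrite mule_ge0// lee_fin ltW.
case g2E : gamma2 g20 => [g2| |] // g20; last first.
  rewrite gt0_muley// addeC addoo ?gt0_muley ?leey//.
  by rewrite mule_ge0// ltW.
have FA := norm_le_gamma1 F0 b1 g1E.
rewrite lee_fin in g10; rewrite lee_fin in g20.
(* [empirical_bound] is used with [A0 = g1], which must be positive; for [g1 = 0] the class is
   reduced to 0 and the process vanishes. *)
have [g1z|g1p] := eqVneq g1 0.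
  have Fz f : F f -> f = cst 0.
    by move=> Ff; apply/funext => z; apply/normr0_eq0/eqP; rewrite eq_le normr_ge0 -g1z FA.
  rewrite (_ : (fun w => _) = cst 0%E); last first.
    apply/funext => w; rewrite (_ : [set _ | _ in _] = [set 0%E]) ?ereal_sup1//.
    have e0 : (empirical_process Z (cst 0) w) = 0.
      rewrite /empirical_process big1 ?mulr0// => i _.
      by rewrite -[fine _]/(Ex P (fun=> 0)) Ex_cst subrr.
    apply/seteqP; split => [_ [f /Fz -> <-]|_ ->]; first by rewrite /= e0.
    by exists (cst 0); rewrite ?e0.
  rewrite Lnorm0// mule_ge0 ?adde_ge0 ?mule_ge0 ?lee_fin ?(ltW C20) ?(ltW Lam0)//.
  exact: ltW.
have {g1p} g1p : 0 < g1 by rewrite lt_neqAle eq_sym g1p.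
have [tbE|tbf] := eqVneq (tau_bar Z (cone F) B c) +oo%E.
  rewrite tbE gt0_muley ?lte_fin// addoo ?lee_fin ?divr_ge0// ?(ltW s0)//.
  rewrite gt0_mulye ?lte_fin// addoo ?mule_ge0 ?lee_fin ?(ltW Lam0)//.
  by rewrite gt0_muley ?lte_fin// leey.
have tfin m : tauB (c m) m \is a fin_num.
  rewrite ge0_fin_numE// ltNge leye_eq; apply/negP => /eqP tE.
  move/negP : tbf; apply; rewrite /tau_bar (bigD1 (c m))//= (bigD1 m)//= tE.
  rewrite ooadd ?sume_ge0// ooadd; last first.
    by apply: sume_ge0 => k _; exact: sume_ge0.
  by rewrite gt0_muley// lte_fin invr_gt0.
pose t m := fine (tauB (c m) m).
pose ts := \sum_(k < K) \sum_(m | c m == k) t m.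
have tbE : tau_bar Z (cone F) B c = (n^-1 * ts)%:E.
  rewrite /tau_bar EFinM; congr (_ * _)%E.
  rewrite /ts -sumEFin; apply: eq_bigr => k _; rewrite -sumEFin; apply: eq_bigr => m /eqP <-.
  by rewrite fineK.
(* [D] is the total coefficient of the slack [dl] in [empirical_bound]. It contains 48 instead of 24
   because [dl] enters twice, once in [G1] and [G2] and once as [ep]. *)
pose D := 1 + 48 * K%:R * Num.sqrt C1 * Lam + 48 * K%:R * Kb * (q%:R / Num.sqrt n).
have D0 : 0 < D.
  by rewrite /D -addrA ltr_pwDl// addr_ge0// !mulr_ge0 ?sqrtr_ge0 ?invr_ge0 ?sqrtr_ge0 ?(ltW Lam0) ?(ltW Kb0).
apply/lee_addgt0Pr => ep ep0.
pose dl := ep / D.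
have dl0 : 0 < dl by rewrite divr_gt0.
have ht m : (tauB (c m) m <= (t m)%:E)%E by rewrite /t fineK.
have gam2 : (gamma2 < (g2 + dl)%:E)%E by rewrite g2E lte_fin ltrDl.
have gam1 : (gamma1 < (g1 + dl)%:E)%E by rewrite g1E lte_fin ltrDl.
have hL m : Lambda_sq e Z F d p q (B m) <= Lam ^+ 2 by exact: Lambda_sq_le.
have := empirical_bound m0 mF F0 g1p FA d1 q0 p1 growth partB diamB cardB ht a1 b1
  gam2 gam1 (ltW Lam0) hL Kb0 dl0.
move=> /le_trans; apply.
rewrite tbE -!(EFinM, EFinD) lee_fin -/C1 -/n.
rewrite big_split /= sumr_const card_ord -mulr_sumr -/ts -[_ *+ K]mulr_natl.
rewrite (sqrtrM C1 (ltW n0)).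
have -> : ep = dl * D by rewrite /dl divfK// gt_eqF.
have ts0 : 0 <= ts by apply: sumr_ge0 => k _; apply: sumr_ge0 => m _; exact: fine_ge0.
have s2 : Num.sqrt n ^+ 2 = n by rewrite sqr_sqrtr// ltW.
rewrite -subr_ge0 (_ : _ - _ = Lam * g2 * (1 + 24 * K%:R * Kb)
  + q%:R / Num.sqrt n * g1 * (1 + 24 * K%:R * Num.sqrt C1)
  + ts / Num.sqrt n * g1 * (24 * K%:R * Num.sqrt C1 + 24 * K%:R * Kb)); last first.
  by rewrite -[in n^-1]s2 /C2 /D; field; rewrite gt_eqF.
have Kb' := ltW Kb0; have s' := ltW s0; have L' := ltW Lam0.
by rewrite !addr_ge0// !mulr_ge0 ?invr_ge0// addr_ge0// !mulr_ge0 ?sqrtr_ge0.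
Qed.

End final_bound.

Theorem proposition1 (R : realType) (Cdbl : nat) (Cgr d : R) (hd : 1 <= d) :
  exists K : R, 0 < K /\
  forall (N : nat -> finType) (V : forall n, rel (N n))
    (hcard : forall n, #|N n| = n)
    (hsym : forall n, symmetric (V n))
    (hdbl : uniformly_doubling V Cdbl Cgr d)
    (dO : measure_display) (Om : measurableType dO) (P : probability Om R)
    (Zs : ptopologicalType) (hpol : polish R Zs)
    (Z : forall n, N n -> {RV P >-> g_sigma_algebraType (@open Zs)})
    (hindep : forall n (A B : {set N n}), [disjoint A & B]%B ->
       gdist_set R (V n) A B = +oo%E ->
       independent P (sigma_gen (@Z n) A) (sigma_gen (@Z n) B))
    (F : set (g_sigma_algebraType (@open Zs) -> R))
    (hmeas : forall f, F f -> measurable_fun setT f)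
    (hF0 : F (cst 0))
    (n : nat) (a b : R) (ha : 1 <= a) (hb : 1 <= b)
    (p : \bar R) (hp : (1 <= p)%E) (q : nat) (hq : (1 <= q <= n)%N),
  exists (M : nat) (B : 'I_M -> {set N n}),
    [/\ is_partition B,
        forall m, #|B m|%:R <= K * q%:R
      & forall c : 'I_M -> 'I_(coloring_number (V n) B (q%:R `^ d^-1)),
          proper_coloring (V n) B (q%:R `^ d^-1) c ->
          ('N[P]_1[(fun w =>
               ereal_sup [set (empirical_process (@Z n) f w)%:E | f in F])]
           <= K%:E *
              ((Lambda p d q
                  (fun m => alpha_class (V n) (@Z n) F (B m)))%:E
               * talagrand_gamma 2 a F (max_Lnorm (@Z n) (2%:E * p))
               + ((q%:R / Num.sqrt n%:R)%:E
                  + (Num.sqrt n%:R)%:E * tau_bar (@Z n) (cone F) B c)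
                 * talagrand_gamma 1 b F (@supnorm R _)))%E].
Proof.
pose Kb : R := 1 + `|Cgr|.
pose C1 : R := 56 * (1 + `|Cgr| * 2 `^ (d - 1)) + 2 * Kb.
(* Stands in for the number of colors, so that the final constant is fixed before the graphs and the
   sample size. *)
pose Kc : R := (Cdbl ^ 3).+1%:R.
pose C2 : R := 1 + 24 * Kc * Num.sqrt C1 + 24 * Kc * Kb.
have Kb0 : 0 < Kb by rewrite /Kb ltr_pwDl.
have Kc0 : 0 <= 24 * Kc by rewrite mulr_ge0// ler0n.
have C20 : 0 < C2.
  by rewrite /C2 -addrA ltr_pwDl// addr_ge0// mulr_ge0// ?sqrtr_ge0// ltW.
exists (C2 + Kb); split; first exact: addr_gt0.
move=> N V hcard hsym [_ dbl growth] dO Om P Zs _ Z _ F mF F0 n a b a1 b1 p p1 q /andP[q0 qn].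
have q1 : 1 <= q%:R :> R by rewrite ler1n.
have d0 : 0 < d by apply: lt_le_trans hd.
have r1 : 1 <= q%:R `^ d^-1 :> R.
  by rewrite -[leLHS](powRr0 q%:R) ler_powR// invr_ge0 ltW.
have [M [B [partB diamB cardB colB]]] :=
  block_partition (hsym n) (dbl n) (growth n) hd r1.
have rd : (q%:R `^ d^-1) `^ d = q%:R :> R by rewrite -powRrM mulVf ?gt_eqF// powRr1.
have cardB' m : #|B m|%:R <= Kb * q%:R by rewrite -[X in _ * X]rd; exact: cardB.
exists M, B; split => //.
  by move=> m; apply: le_trans (cardB' m) _; rewrite ler_wpM2r// lerDr ltW.
move=> c _.
have N0 : (0 < #|N n|)%N by rewrite hcard (leq_trans q0).
have [m0 _] : exists m0 : 'I_M, True.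
  have /card_gt0P[i _] := N0; case: partB => _ /and3P[/eqP cov _ _].
  have : i \in finset.cover [set B m | m : 'I_M]%SET by rewrite cov inE.
  by move=> /finset.bigcupP[_ /imsetP[m _ _] _]; exists m.
have := class_process_bound (Z n) m0 c mF F0 hd q0 p1 (growth n) partB diamB cardB'
  a1 b1 Kb0 N0.
rewrite hcard => /le_trans; apply; apply: lee_wpmul2r.
  rewrite adde_ge0// mule_ge0// ?lee_fin ?Lambda_ge0//.
  - by apply: (talagrand_gamma_ge0 _ _ F0) => u; exact: max_Lnorm_ge0.
  - have tb0 := tau_bar_ge0 (Z n) (cone F) B c.
    by rewrite adde_ge0 ?lee_fin ?divr_ge0 ?sqrtr_ge0//; apply: mule_ge0 tb0; rewrite lee_fin sqrtr_ge0.
  - by apply: (talagrand_gamma_ge0 _ _ F0) => u; apply: supnorm_ge0; exists (point : Zs).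
rewrite lee_fin -/Kb -/C1 /C2.
have Kc' : (coloring_number (V n) B (q%:R `^ d^-1))%:R <= Kc by rewrite ler_nat.
rewrite -addrA -[leRHS]addrA -[leRHS]addrA lerD2l addrA.
apply: le_trans (_ : 24 * Kc * Num.sqrt C1 + 24 * Kc * Kb <= _); last first.
  by rewrite lerDl ltW.
by apply: lerD; apply: ler_wpM2r; rewrite ?sqrtr_ge0 ?(ltW Kb0)// ler_wpM2l.
Qed.
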